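(* Let $\mu_\Psi$ be a generalized Wright measure on $\mathcal{N}'$ with parameters as in the context, let $\varphi\in\mathcal{N}$ and $n\in\mathbb{N}_0$. Write $M_k^{\mu_\Psi}(\varphi):=M_k^{\mu_\Psi}(\varphi,\dots,\varphi)$. Then the odd moments $M_{2n+1}^{\mu_\Psi}(\varphi)$ are zero, and the even moments are $$M_{2n}^{\mu_\Psi}(\varphi)=\frac1K\,\frac{\prod_{j=1}^m\Gamma(b_j+\beta_j(n+1))}{\prod_{i=1}^p\Gamma(a_i+\alpha_i(n+1))}\,\frac{(2n)!}{n!\,2^n}\,\langle\varphi,\varphi\rangle^n .$$ In particular, for $\varphi,\psi\in\mathcal{N}$, $$\int_{\mathcal{N}'}\langle\omega,\varphi\rangle\langle\omega,\psi\rangle\,\mathrm{d}\mu_\Psi(\omega)=M_2^{\mu_\Psi}(\varphi,\psi)=\frac1K\,\frac{\prod_{j=1}^m\Gamma(b_j+2\beta_j)}{\prod_{i=1}^p\Gamma(a_i+2\alpha_i)}\,\langle\varphi,\psi\rangle,$$ $$\|\langle\cdot,\varphi\rangle\|_{L^2(\mu_\Psi)}^2=M_2^{\mu_\Psi}(\varphi,\varphi)=\frac1K\,\frac{\prod_{j=1}^m\Gamma(b_j+2\beta_j)}{\prod_{i=1}^p\Gamma(a_i+2\alpha_i)}\,|\varphi|^2 .$$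
   Context: Parameters. $m,p\in\mathbb{N}_0=\{0,1,2,\dots\}$; $a_i\in\mathbb{R}$, $\alpha_i>0$, $a_i+\alpha_i>0$ for $i=1,\dots,p$; $b_j\in\mathbb{R}$, $\beta_j>0$, $b_j+\beta_j>0$ for $j=1,\dots,m$. Put $a^*:=\sum_{j=1}^m\beta_j-\sum_{i=1}^p\alpha_i$ and $\mu:=\sum_{j=1}^m b_j-\sum_{i=1}^p a_i+(p-m)/2$. It is assumed that either $a^*>0$, or $a^*=0$ and $\mu<-1$, and that the Fox-$H$ function $$H^{m,0}_{p,m}(\tau):=\frac{1}{2\pi\mathrm{i}}\int_{\gamma-\mathrm{i}\infty}^{\gamma+\mathrm{i}\infty}\frac{\prod_{j=1}^m\Gamma(b_j+\beta_js)}{\prod_{i=1}^p\Gamma(a_i+\alpha_is)}\,\tau^{-s}\,\mathrm{d}s,\qquad \tau>0,$$ is non-negative on $(0,\infty)$; here $\gamma\in(0,1)$ is such that all poles of the numerator lie to the left of the contour. Put $K:=\prod_{j=1}^m\Gamma(b_j+\beta_j)\big/\prod_{i=1}^p\Gamma(a_i+\alpha_i)$. Generalized Wright function. $\Psi$ is formally the power series $\Psi(z)=\sum_{k\ge0}\frac{\prod_{j=1}^m\Gamma(b_j+\beta_j(k+1))}{\prod_{i=1}^p\Gamma(a_i+\alpha_i(k+1))}\frac{z^k}{k!}$ (entire if $a^*<1$); in general, for $z>0$, $\Psi(-z)=\frac{1}{2\pi\mathrm{i}}\int_{\gamma-\mathrm{i}\infty}^{\gamma+\mathrm{i}\infty}\Gamma(s)\frac{\prod_{j=1}^m\Gamma(b_j+\beta_j-\beta_js)}{\prod_{i=1}^p\Gamma(a_i+\alpha_i-\alpha_is)}z^{-s}\,\mathrm{d}s$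 with $0<\gamma<\min\{1,\min_j(b_j+\beta_j)/\beta_j\}$, and $\Psi(0)=K$. Nuclear triple. $\mathcal{H}$ is a real separable Hilbert space with inner product $(\cdot,\cdot)$ and norm $|\cdot|$; $\mathcal{N}=\bigcap_{l\in\mathbb{N}_0}\mathcal{H}_l$ is a nuclear space densely and continuously embedded in $\mathcal{H}$, the projective limit of real separable Hilbert spaces $\mathcal{H}_l$ with norms $|\cdot|_l$, $\mathcal{H}_0=\mathcal{H}$, $|\cdot|_l\le|\cdot|_{l+1}$, all inclusions $\mathcal{H}_{l+1}\subset\mathcal{H}_l$ being Hilbert–Schmidt. $\mathcal{N}'$ is its dual, $\mathcal{N}\subset\mathcal{H}\subset\mathcal{N}'$, with dual pairing $\langle\cdot,\cdot\rangle$ extending the inner product of $\mathcal{H}$, and $\mathcal{C}_\sigma(\mathcal{N}')$ is the cylindrical $\sigma$-algebra. The generalized Wright measure $\mu_\Psi$ is the unique probability measure on $(\mathcal{N}',\mathcal{C}_\sigma(\mathcal{N}'))$ with $\int_{\mathcal{N}'}\mathrm{e}^{\mathrm{i}\langle\omega,\varphi\rangle}\,\mathrm{d}\mu_\Psi(\omega)=\frac1K\Psi\big(-\tfrac{\langle\varphi,\varphi\rangle}{2}\big)$, $\varphi\in\mathcal{N}$. Its generalized moments are $M_n^{\mu_\Psi}(\varphi_1,\dots,\varphi_n):=\int_{\mathcal{N}'}\langle\omega^{\otimes n},\varphi_1\otimes\cdots\otimes\varphi_n\rangle\,\mathrm{d}\mu_\Psi(\omega)=\int_{\mathcal{N}'}\prod_{i=1}^n\langle\omega,\varphi_i\rangle\,\mathrm{d}\mu_\Psi(\omega)$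 for $\varphi_i\in\mathcal{N}$ (and $M_0=1$). *)

(* Defs.v *)
From HB Require Import structures.
From mathcomp Require Import all_boot all_order all_algebra.
From mathcomp Require Import complex.
From mathcomp Require Import all_classical all_reals all_analysis.

Set Implicit Arguments.
Unset Strict Implicit.
Unset Printing Implicit Defensive.

Import Order.TTheory GRing.Theory Num.Theory.
Import numFieldNormedType.Exports.

Local Open Scope classical_set_scope.
Local Open Scope complex_scope.
Local Open Scope ring_scope.

Definition cintegral (R : realType) d (T : measurableType d)
    (mu : {measure set T -> \bar R}) (D : set T) (f : T -> R[i]) : R[i] :=
  (\int[mu]_(x in D) complex.Re (f x)) +i* (\int[mu]_(x in D) complex.Im (f x)).

Definition cexp (R : realType) (z : R[i]) : R[i] :=
  (expR (complex.Re z) * cos (complex.Im z)) +i*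
  (expR (complex.Re z) * sin (complex.Im z)).

(* t ^ z, to be used for t > 0 only *)
Definition cpow (R : realType) (t : R) (z : R[i]) : R[i] :=
  cexp (z * (ln t)%:C).

(* Euler's integral, to be used for x > 0 only *)
Definition Gamma (R : realType) (x : R) : R :=
  \int[lebesgue_measure]_(t in `]0, +oo[) (t `^ (x - 1) * expR (- t)).

(* Euler's integral, to be used for Re z > 0 only *)
Definition cEuler (R : realType) (z : R[i]) : R[i] :=
  cintegral lebesgue_measure `]0, +oo[
    (fun t : R => cpow t (z - 1) * (expR (- t))%:C).

(* Euler's integral extended to the whole plane by
   Gamma(z) = Gamma(z + n) / (z (z + 1) ... (z + n - 1)) with Re (z + n) > 0.
   At the poles 0, -1, -2, ... one factor of the denominator vanishes and the
   value is 0; hence (cGamma z)^-1 is the entire function 1 / Gamma, poles of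
   Gamma included. *)
Definition cGamma (R : realType) (z : R[i]) : R[i] :=
  if 0 < complex.Re z then cEuler z
  else let n := (Num.truncn (- complex.Re z)).+1 in
       cEuler (z + n%:R) / \prod_(k < n) (z + (k : nat)%:R).

Lemma cGamma_real (R : realType) (x : R) : 0 < x ->
  cGamma x%:C = (Gamma x)%:C.
Proof.
move=> x0; rewrite /cGamma /= x0 /cEuler /cintegral /Gamma.
have E (t : R) : t \in `]0, +oo[%classic ->
    cpow t (x%:C - 1) * (expR (- t))%:C = (t `^ (x - 1) * expR (- t))%:C.
  rewrite inE /= in_itv /= andbT => t0.
  rewrite /cpow /cexp /=; simpc; rewrite /= ?(mul0r,mulr0,oppr0,subr0,addr0) cos0 sin0.
  by rewrite mulr0 mulr1 mul0r /powR (gt_eqF t0).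
congr (_ +i* _).
  by apply: eq_Rintegral => t /E ->.
under eq_Rintegral => t /E -> /=.
  over.
by rewrite /Rintegral integral0_eq.
Qed.

(* (1 / (2 pi i)) * the integral of F(s) ds along the vertical line
   s = g + i t, for which ds = i dt *)
Definition vline_integral (R : realType) (g : R) (F : R[i] -> R[i]) : R[i] :=
  ((2 * pi)^-1)%:C *
  cintegral lebesgue_measure setT (fun t : R => F (g +i* t)).

Definition Gamma_ratio (R : realType) (m p : nat) (b beta : 'I_m -> R)
    (a alpha : 'I_p -> R) (x : R) : R :=
  (\prod_(j < m) Gamma (b j + beta j * x)) /
  (\prod_(i < p) Gamma (a i + alpha i * x)).

Definition cGamma_ratio (R : realType) (m p : nat) (b beta : 'I_m -> R)
    (a alpha : 'I_p -> R) (s : R[i]) : R[i] :=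
  (\prod_(j < m) cGamma ((b j)%:C + (beta j)%:C * s)) /
  (\prod_(i < p) cGamma ((a i)%:C + (alpha i)%:C * s)).

Definition wright_astar (R : realType) (m p : nat) (beta : 'I_m -> R)
    (alpha : 'I_p -> R) : R :=
  \sum_(j < m) beta j - \sum_(i < p) alpha i.

Definition wright_mu (R : realType) (m p : nat) (b : 'I_m -> R)
    (a : 'I_p -> R) : R :=
  \sum_(j < m) b j - \sum_(i < p) a i + (p%:R - m%:R) / 2.

Definition wright_K (R : realType) (m p : nat) (b beta : 'I_m -> R)
    (a alpha : 'I_p -> R) : R :=
  (\prod_(j < m) Gamma (b j + beta j)) /
  (\prod_(i < p) Gamma (a i + alpha i)).

(* g is in (0, 1) and the poles - (b_j + k) / beta_j of the functions
   s |-> Gamma(b_j + beta_j s) lie to the left of Re s = g *)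
Definition foxH_contour (R : realType) (m : nat) (b beta : 'I_m -> R)
    (g : R) : Prop :=
  0 < g < 1 /\ forall (j : 'I_m) (k : nat), - (b j + k%:R) / beta j < g.

Definition foxH (R : realType) (m p : nat) (b beta : 'I_m -> R)
    (a alpha : 'I_p -> R) (g : R) (tau : R) : R[i] :=
  vline_integral g (fun s => cGamma_ratio b beta a alpha s * cpow tau (- s)).

Definition wright_contour (R : realType) (m : nat) (b beta : 'I_m -> R)
    (g : R) : Prop :=
  0 < g < 1 /\ forall j : 'I_m, g < (b j + beta j) / beta j.

(* Psi(x) for x <= 0 only: the Mellin-Barnes integral at z = - x if x < 0 *)
Definition wright_Psi (R : realType) (m p : nat) (b beta : 'I_m -> R)
    (a alpha : 'I_p -> R) (g : R) (x : R) : R[i] :=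
  if x == 0 then (wright_K b beta a alpha)%:C
  else vline_integral g (fun s =>
    cGamma s *
    ((\prod_(j < m) cGamma ((b j + beta j)%:C - (beta j)%:C * s)) /
     (\prod_(i < p) cGamma ((a i + alpha i)%:C - (alpha i)%:C * s))) *
    cpow (- x) (- s)).

Record separableHilbert (R : realType) := SeparableHilbert {
  hilb_space :> completeNormedModType R ;
  hilb_ip : {dot hilb_space for idfun} ;
  hilb_ip_norm : forall x : hilb_space, hilb_ip x x = `|x| ^+ 2 ;
  hilb_separable : exists2 D : set hilb_space, countable D & dense D
}.

Definition orthonormal_basis (R : realType) (U : separableHilbert R)
    (E : set U) : Prop :=
  (forall e f : U, E e -> E f -> hilb_ip U e f = (e == f)%:R) /\
  (forall x : U, (forall e, E e -> hilb_ip U x e = 0) -> x = 0).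

Definition hilbert_schmidt (R : realType) (U V : separableHilbert R)
    (A : U -> V) : Prop :=
  exists2 E : set U, orthonormal_basis E &
    (\esum_(e in E) (`|A e| ^+ 2)%:E < +oo)%E.

(* The inclusion of the l-th space of a chain into the space of index 0 *)
Fixpoint chain_inclusion (T : nat -> Type) (inc : forall l, T l.+1 -> T l)
    (l : nat) : T l -> T 0%N :=
  match l with
  | 0 => id
  | l'.+1 => fun x => chain_inclusion inc (inc l' x)
  end.

(* The inclusions H_(l+1) < H_l and N < H_l are represented by injective
   linear maps; nt_inter says that N is the intersection of all H_l inside
   H = H_0, and nt_nbhs0 that N carries the projective limit topology. *)
Record nuclear_triple (R : realType) := NuclearTriple {
  nt_H : nat -> separableHilbert R ;
  nt_inc : forall l, {linear nt_H l.+1 -> nt_H l} ;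
  nt_inc_inj : forall l, injective (nt_inc l) ;
  nt_inc_norm : forall l (x : nt_H l.+1), `|nt_inc l x| <= `|x| ;
  nt_inc_HS : forall l, hilbert_schmidt (nt_inc l) ;
  nt_N : tvsType R ;
  nt_emb : forall l, {linear nt_N -> nt_H l} ;
  nt_emb_inc : forall l (phi : nt_N),
    nt_inc l (nt_emb l.+1 phi) = nt_emb l phi ;
  nt_emb_inj : injective (nt_emb 0%N) ;
  nt_inter : range (nt_emb 0%N) =
    \bigcap_l range (@chain_inclusion nt_H nt_inc l) ;
  nt_nbhs0 : forall A : set nt_N, nbhs (0 : nt_N) A <->
    exists l, exists2 e : R, 0 < e &
      [set phi : nt_N | `|nt_emb l phi| < e] `<=` A ;
  nt_dense : dense (range (nt_emb 0%N))
}.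

(* <phi, psi> for phi, psi in N, i.e. the inner product of H *)
Definition nt_ip (R : realType) (T : nuclear_triple R) (phi psi : nt_N T) : R :=
  hilb_ip (nt_H T 0%N) (nt_emb T 0%N phi) (nt_emb T 0%N psi).

Definition nt_norm (R : realType) (T : nuclear_triple R) (phi : nt_N T) : R :=
  `|nt_emb T 0%N phi|.

(* The topological dual; the pairing <omega, phi> is the value omega phi *)
Record dual (R : realType) (N : tvsType R) := Dual {
  dual_fun :> {scalar N} ;
  dual_continuous : continuous (dual_fun : N -> R)
}.

Lemma dual_zero_continuous (R : realType) (N : tvsType R) :
  continuous ((\0 : {scalar N}) : N -> R).
Proof. by move=> x; exact: cvg_cst. Qed.

HB.instance Definition _ (R : realType) (N : tvsType R) :=
  gen_eqMixin (dual N).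
HB.instance Definition _ (R : realType) (N : tvsType R) :=
  gen_choiceMixin (dual N).
HB.instance Definition _ (R : realType) (N : tvsType R) :=
  isPointed.Build (dual N) (Dual (@dual_zero_continuous R N)).

Definition cylinder_generators (R : realType) (N : tvsType R) :
    set (set (dual N)) :=
  [set Z | exists phi : N, exists2 B : set R,
     measurable B & Z = [set w : dual N | B (w phi)]].

(* N' with its cylindrical sigma-algebra, the smallest one for which all the
   maps omega |-> <omega, phi> are measurable *)
Notation cyl_dual N := (g_sigma_algebraType (@cylinder_generators _ N)).

Definition is_wright_measure (R : realType) (m p : nat) (b beta : 'I_m -> R)
    (a alpha : 'I_p -> R) (g : R) (T : nuclear_triple R)
    (P : probability (cyl_dual (nt_N T)) R) : Prop :=
  forall phi : nt_N T,
    cintegral P setT (fun w : dual (nt_N T) => cexp (0 +i* w phi)) =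
    ((wright_K b beta a alpha)^-1)%:C *
    wright_Psi b beta a alpha g (- (nt_ip phi phi / 2)).

(* M_n(phi_1, ..., phi_n) for s = [:: phi_1; ...; phi_n]. As the integrand is
   measurable, this extended real is finite iff the integrand is integrable. *)
Definition moment (R : realType) (N : tvsType R)
    (P : probability (cyl_dual N) R) (s : seq N) : \bar R :=
  (\int[P]_w (\prod_(phi <- s) (w : dual N) phi)%:E)%E.

(* Main.v *)
Require Import Defs.
From HB Require Import structures.
From mathcomp Require Import all_boot all_order all_algebra.
From mathcomp Require Import complex ring lra.
From mathcomp Require Import all_classical all_reals all_analysis.
From mathcomp Require Import measurable_realfun.

Set Implicit Arguments.
Unset Strict Implicit.
Unset Printing Implicit Defensive.

Import Order.TTheory GRing.Theory Num.Theory.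
Import numFieldNormedType.Exports.

Local Open Scope classical_set_scope.
Local Open Scope complex_scope.
Local Open Scope ring_scope.

(** Let X be the pairing with phi and q half the square of the norm of phi. The
    hypothesis gives the characteristic function of X, namely
    u |-> K^-1 Psi(- u^2 q). It is even, so the odd moments vanish as soon as they
    exist. For the even moments one has to know how Psi expands at 0: its
    Mellin-Barnes integral has the formal series of Psi as an expansion, in general
    only an asymptotic one. Instead of moving the line of integration across the
    poles of Gamma, the proof reduces Psi to an explicit elementary function by
    averaging over its argument.

    A product of Gamma functions is the Mellin transform of the law of a product of
    powers of independent Gamma variables (mellin_measure). Averaging the
    Mellin-Barnes integral over the measure attached to the denominators multiplies
    the integrand by them, so that they cancel (average_mellin_barnes), and the
    numerators are themselves unfolded into an average over a second measure. What is
    left under the two averages is the integral of Gamma(s) z^(-s), multiplied by a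
    polynomial in s when a denominator first had to be moved into the half-plane of
    convergence of Euler's integral. Mellin inversion identifies it as e^(-z)
    multiplied by a polynomial (mellin_inversion, mellin_inversion_comb). The result
    is wright_mixture. Inversion is proved in the logarithmic coordinate t = e^v,
    where Abel summation produces a Poisson kernel.

    In terms of X, this says that the product of X with the square root of an
    independent positive variable has as its cosine transform an average of
    e(t^2 q y) over a law with known moments, e being the elementary function. Its
    expansion at t = 0 follows from Taylor's formula for e. An expansion of a cosine
    transform yields the moments, and their existence, by Fatou's lemma and the
    alternating bounds of the cosine series (even_moment). The moments of the product
    are products of moments, and those of the auxiliary variable are divided out
    (mixture_even_moment).

    The integrals converge absolutely and may be exchanged because, up to
    subexponential factors, Euler's integral decays like e^(-pi |y| / 2) along
    vertical lines, and its inverse grows like e^(pi |y| / 2) (exp_type_cEuler,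
    exp_type_inv_cEuler); the numerators outweigh the denominators since the sum of
    the beta_j is at least that of the alpha_i, and the factor Gamma(s) provides the
    decay. These bounds come from the functional equation, by comparing its iterates
    to an integral (log_product), and from the concentration of the Gamma law at
    large parameters (nrm_cEuler_ge).

    The covariance is the polarization of the second moment. *)

(** * Real and complex integration *)

(* Integrability of real-valued functions, and the modulus as an element of R: the
   norm of R[i] takes its values in R[i]. *)
Local Notation rintegrable mu f := (mu.-integrable setT (EFin \o f)).
Local Notation nrm := (@ComplexField.Normc.normc _).

Section sigma_finite_product.
Local Open Scope ereal_scope.
Context d1 d2 (T1 : measurableType d1) (T2 : measurableType d2) (R : realType).
Variable m1 : {sigma_finite_measure set T1 -> \bar R}.
Variable m2 : {sigma_finite_measure set T2 -> \bar R}.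

(** A name for the product measure to which sigma-finiteness is attached, so that
    products can be iterated. *)
Definition prod_measure : set (T1 * T2) -> \bar R := m1 \x m2.

HB.instance Definition _ := Measure.copy prod_measure (m1 \x m2).

Lemma prod_measure_sigma_finite : sigma_finite setT prod_measure.
Proof.
have /sigma_finiteP[F [TF ndF mF]] := sigma_finiteT m1.
have /sigma_finiteP[G [TG ndG mG]] := sigma_finiteT m2.
exists (fun n => F n `*` G n).
  rewrite -setXTT TF TG; apply/seteqP; split=> [[x y] /= [[i _ Fx] [j _ Gy]]|].
    exists (maxn i j) => //; split.
      by move: x Fx; exact/subsetPset/ndF/leq_maxl.
    by move: y Gy; exact/subsetPset/ndG/leq_maxr.
  by move=> [x y] [n _ [? ?]]; split; exists n.
move=> n; have [mFn ?] := mF n; have [mGn ?] := mG n.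
split; first exact: measurableX.
by rewrite /prod_measure product_measure1E// lte_mul_pinfty// ge0_fin_numE.
Qed.

HB.instance Definition _ :=
  Measure_isSigmaFinite.Build _ _ _ prod_measure prod_measure_sigma_finite.

End sigma_finite_product.

Section real_integration.
Context d (T : measurableType d) (R : realType) (mu : {measure set T -> \bar R}).
Implicit Types f g : T -> R.

Lemma rintegrable_measurable f : rintegrable mu f -> measurable_fun setT f.
Proof. by move=> /measurable_int/measurable_EFinP. Qed.

Lemma rintegrable_le f g : measurable_fun setT f -> rintegrable mu g ->
  (forall x, `|f x| <= g x) -> rintegrable mu f.
Proof.
move=> mf ig fg; apply: le_integrable ig => //; first exact/measurable_EFinP.
by move=> x _ /=; rewrite lee_fin (le_trans (fg x))// ler_norm.
Qed.

Lemma rintegrableZ (k : R) f :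
  rintegrable mu f -> rintegrable mu (fun x => k * f x).
Proof. by move=> fi; exact: (integrableZl _ k fi). Qed.

Lemma rintegrableD f g : rintegrable mu f -> rintegrable mu g ->
  rintegrable mu (fun x => f x + g x).
Proof. by move=> fi gi; exact: (integrableD _ fi gi). Qed.

Lemma rintegrable_sum (I : Type) (s : seq I) (f : I -> T -> R) :
  (forall i, rintegrable mu (f i)) ->
  rintegrable mu (fun x => \sum_(i <- s) f i x).
Proof.
move=> fi; elim: s => [|i s IH].
  by under [X in _ \o X]funext do rewrite big_nil; exact: integrable0.
under [X in _ \o X]funext do rewrite big_cons.
exact: rintegrableD.
Qed.

Lemma Rintegral_sum (I : Type) (s : seq I) (f : I -> T -> R) :
  (forall i, rintegrable mu (f i)) ->
  \int[mu]_x (\sum_(i <- s) f i x) = \sum_(i <- s) \int[mu]_x f i x.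
Proof.
move=> fi; elim: s => [|i s IH].
  rewrite big_nil; under eq_Rintegral do rewrite big_nil.
  by rewrite /Rintegral integral0_eq.
rewrite big_cons -IH -RintegralD//; last exact: rintegrable_sum.
by under eq_Rintegral do rewrite big_cons.
Qed.

Lemma EFin_Rintegral f : rintegrable mu f ->
  (\int[mu]_x f x)%:E = (\int[mu]_x (f x)%:E)%E.
Proof. by move=> fi; rewrite fineK// integrable_fin_num. Qed.

Lemma rintegrable_ge0 f (b : R) : measurable_fun setT f -> (forall x, 0 <= f x) ->
  (\int[mu]_x (f x)%:E <= b%:E)%E -> rintegrable mu f.
Proof.
move=> mf f0 fb; apply/integrableP; split; first exact/measurable_EFinP.
under eq_integral do rewrite /= ger0_norm//.
by rewrite (le_lt_trans fb)// ltry.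
Qed.

End real_integration.

Section real_fubini.
Context d1 d2 (T1 : measurableType d1) (T2 : measurableType d2) (R : realType).
Variable m1 : {sigma_finite_measure set T1 -> \bar R}.
Variable m2 : {sigma_finite_measure set T2 -> \bar R}.

Lemma rintegrable_prod (g1 : T1 -> R) (g2 : T2 -> R) :
  rintegrable m1 g1 -> rintegrable m2 g2 ->
  rintegrable (prod_measure m1 m2) (fun x => g1 x.1 * g2 x.2).
Proof.
move=> i1 i2; apply/integrable12ltyP.
  apply/measurable_EFinP/measurable_funM.
    by apply: measurableT_comp => //; exact: rintegrable_measurable i1.
  by apply: measurableT_comp => //; exact: rintegrable_measurable i2.
under eq_integral => x _.
  under eq_integral => y _ do rewrite /= normrM EFinM.
  rewrite ge0_integralZl//; last first.
    apply/measurable_EFinP/measurableT_comp => //.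
    exact: rintegrable_measurable i2.
  rewrite -(EFin_Rintegral (integrable_norm i2)).
  over.
rewrite ge0_integralZr//; last 2 first.
- apply/measurable_EFinP/measurableT_comp => //.
  exact: rintegrable_measurable i1.
- by rewrite lee_fin; apply: Rintegral_ge0 => x _ /=.
by rewrite -(EFin_Rintegral (integrable_norm i1)) -EFinM ltry.
Qed.

Variables (f : T1 * T2 -> R) (g1 : T1 -> R) (g2 : T2 -> R).
Hypothesis mf : measurable_fun setT f.
Hypothesis ig1 : rintegrable m1 g1.
Hypothesis ig2 : rintegrable m2 g2.
Hypothesis fg : forall x, `|f x| <= g1 x.1 * g2 x.2.

Lemma rintegrable_dominated_prod : rintegrable (prod_measure m1 m2) f.
Proof. exact: rintegrable_le mf (rintegrable_prod ig1 ig2) fg. Qed.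

Lemma rintegrable_section1 x : rintegrable m2 (fun y => f (x, y)).
Proof.
apply: (@rintegrable_le _ _ _ _ _ (fun y => g1 x * g2 y)).
- by apply: measurableT_comp => //; exact: measurable_pair1.
- exact: rintegrableZ.
- by move=> y; exact: (fg (x, y)).
Qed.

Lemma rintegrable_section2 y : rintegrable m1 (fun x => f (x, y)).
Proof.
apply: (@rintegrable_le _ _ _ _ _ (fun x => g2 y * g1 x)).
- by apply: measurableT_comp => //; exact: measurable_pair2.
- exact: rintegrableZ.
- by move=> x; rewrite mulrC; exact: (fg (x, y)).
Qed.

Lemma Rfubini1 :
  \int[prod_measure m1 m2]_x f x = \int[m1]_x \int[m2]_y f (x, y).
Proof.
rewrite {1}/Rintegral -(integral12_prod_meas1 rintegrable_dominated_prod).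
rewrite {1}/Rintegral; congr fine; apply: eq_integral => x _.
by rewrite /fubini_F EFin_Rintegral//; exact: rintegrable_section1.
Qed.

Lemma Rfubini2 :
  \int[prod_measure m1 m2]_x f x = \int[m2]_y \int[m1]_x f (x, y).
Proof.
rewrite {1}/Rintegral -(integral21_prod_meas1 rintegrable_dominated_prod).
rewrite {1}/Rintegral; congr fine; apply: eq_integral => x _.
by rewrite /fubini_G EFin_Rintegral//; exact: rintegrable_section2.
Qed.

End real_fubini.

Section complex_norm.
Variable R : realType.
Implicit Types (z w : R[i]) (x : R).

Lemma nrmE z : nrm z = Num.sqrt (complex.Re z ^+ 2 + complex.Im z ^+ 2).
Proof. by case: z. Qed.

Lemma nrm_ge0 z : 0 <= nrm z. Proof. by rewrite nrmE sqrtr_ge0. Qed.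

Lemma sqr_nrm z : nrm z ^+ 2 = complex.Re z ^+ 2 + complex.Im z ^+ 2.
Proof. by rewrite nrmE sqr_sqrtr// addr_ge0// sqr_ge0. Qed.

Lemma normRe_le z : `|complex.Re z| <= nrm z.
Proof.
by rewrite -(ler_pXn2r (ltn0Sn 1))// ?nnegrE ?nrm_ge0// sqr_nrm real_normK ?num_real// lerDl sqr_ge0.
Qed.

Lemma normIm_le z : `|complex.Im z| <= nrm z.
Proof.
by rewrite -(ler_pXn2r (ltn0Sn 1))// ?nnegrE ?nrm_ge0// sqr_nrm real_normK ?num_real// lerDr sqr_ge0.
Qed.

Lemma nrm_real x : nrm x%:C = `|x|.
Proof. by rewrite nrmE /= expr0n/= addr0 sqrtr_sqr. Qed.

Lemma nrmM z w : nrm (z * w) = nrm z * nrm w.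
Proof. exact: ComplexField.Normc.normcM. Qed.

Lemma nrmV z : nrm z^-1 = (nrm z)^-1.
Proof. exact: ComplexField.Normc.normcV. Qed.

Lemma nrm_eq0 z : (nrm z == 0) = (z == 0).
Proof.
apply/eqP/eqP => [/ComplexField.Normc.eq0_normc//|->].
exact: ComplexField.Normc.normc0.
Qed.

Lemma nrm_prod (I : Type) (s : seq I) (F : I -> R[i]) :
  nrm (\prod_(i <- s) F i) = \prod_(i <- s) nrm (F i).
Proof.
apply: (big_morph (fun z : R[i] => nrm z)); first exact: nrmM.
exact: ComplexField.Normc.normc1.
Qed.

Lemma ReD z w : complex.Re (z + w) = complex.Re z + complex.Re w.
Proof. by case: z w => [? ?] []. Qed.

Lemma ImD z w : complex.Im (z + w) = complex.Im z + complex.Im w.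
Proof. by case: z w => [? ?] []. Qed.

Lemma ReN z : complex.Re (- z) = - complex.Re z.
Proof. by case: z. Qed.

Lemma ImN z : complex.Im (- z) = - complex.Im z.
Proof. by case: z. Qed.

Lemma ReM z w : complex.Re (z * w) =
  complex.Re z * complex.Re w - complex.Im z * complex.Im w.
Proof. by case: z w => [? ?] []. Qed.

Lemma ImM z w : complex.Im (z * w) =
  complex.Re z * complex.Im w + complex.Im z * complex.Re w.
Proof. by case: z w => [? ?] []. Qed.

Lemma Re_realM x z : complex.Re (x%:C * z) = x * complex.Re z.
Proof. by case: z => ? ? /=; rewrite mul0r subr0. Qed.

Lemma Im_realM x z : complex.Im (x%:C * z) = x * complex.Im z.
Proof. by case: z => ? ? /=; rewrite mul0r addr0. Qed.

Lemma cexpD z w : cexp (z + w) = cexp z * cexp w.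
Proof.
rewrite /cexp ReD ImD expRD cosD sinD.
by apply/eqP; rewrite eq_complex ReM ImM/=; apply/andP; split; apply/eqP; ring.
Qed.

Lemma nrm_cexp z : nrm (cexp z) = expR (complex.Re z).
Proof.
by rewrite nrmE /= !exprMn -mulrDr cos2Dsin2 mulr1 sqrtr_sqr ger0_norm// expR_ge0.
Qed.

Lemma cexp0 : cexp 0 = 1 :> R[i].
Proof. by rewrite /cexp /= expR0 cos0 sin0 mulr1 mulr0. Qed.

Lemma cexp_real x : cexp x%:C = (expR x)%:C.
Proof. by rewrite /cexp /= cos0 sin0 mulr1 mulr0. Qed.

End complex_norm.

Section complex_integration.
Context d (T : measurableType d) (R : realType) (mu : {measure set T -> \bar R}).
Implicit Types f g : T -> R[i].

(** Measurability and integrability are those of the two components, since the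
    integral of a complex function is taken component by component. *)
Definition cmeasurable f := measurable_fun setT (fun x => complex.Re (f x)) /\
  measurable_fun setT (fun x => complex.Im (f x)).

Definition cintegrable f := rintegrable mu (fun x => complex.Re (f x)) /\
  rintegrable mu (fun x => complex.Im (f x)).

Lemma cmeasurable_real (h : T -> R) :
  measurable_fun setT h -> cmeasurable (fun x => (h x)%:C).
Proof. by split => //=; exact: measurable_cst. Qed.

Lemma cmeasurable_cst z : cmeasurable (fun=> z).
Proof. by split; exact: measurable_cst. Qed.

Lemma cmeasurableD f g : cmeasurable f -> cmeasurable g ->
  cmeasurable (fun x => f x + g x).
Proof.
move=> [f1 f2] [g1 g2]; split.
  by under eq_fun do rewrite ReD; exact: measurable_funD.
by under eq_fun do rewrite ImD; exact: measurable_funD.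
Qed.

Lemma cmeasurableM f g : cmeasurable f -> cmeasurable g ->
  cmeasurable (fun x => f x * g x).
Proof.
move=> [f1 f2] [g1 g2]; split.
  under eq_fun do rewrite ReM.
  by apply: measurable_funB; exact: measurable_funM.
under eq_fun do rewrite ImM.
by apply: measurable_funD; exact: measurable_funM.
Qed.

Lemma cmeasurableV f : cmeasurable f -> cmeasurable (fun x => (f x)^-1).
Proof.
move=> [f1 f2].
have mn : measurable_fun setT
    (fun x => (complex.Re (f x) ^+ 2 + complex.Im (f x) ^+ 2) `^ (-1)).
  apply: (@measurableT_comp _ _ _ _ _ _ (@powR R ^~ (-1))) => //.
  by apply: measurable_funD; exact: measurable_funX.
have nE x : (complex.Re (f x) ^+ 2 + complex.Im (f x) ^+ 2) `^ (-1) =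
    (complex.Re (f x) ^+ 2 + complex.Im (f x) ^+ 2)^-1.
  by rewrite powR_inv1// addr_ge0// sqr_ge0.
split.
  rewrite [X in measurable_fun _ X](_ : _ = (fun x => complex.Re (f x) *
    (complex.Re (f x) ^+ 2 + complex.Im (f x) ^+ 2) `^ (-1))).
    exact: measurable_funM.
  by apply/funext => x; rewrite nE; case: (f x).
rewrite [X in measurable_fun _ X](_ : _ = (fun x => (- complex.Im (f x)) *
  (complex.Re (f x) ^+ 2 + complex.Im (f x) ^+ 2) `^ (-1))).
  by apply: measurable_funM => //; exact: measurable_funN.
by apply/funext => x; rewrite nE; case: (f x) => a b /=; rewrite mulNr.
Qed.

Lemma cmeasurable_prod (I : Type) (s : seq I) (F : I -> T -> R[i]) :
  (forall i, cmeasurable (F i)) -> cmeasurable (fun x => \prod_(i <- s) F i x).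
Proof.
move=> mF; elim: s => [|i s IH].
  by under [X in cmeasurable X]funext do rewrite big_nil; exact: cmeasurable_cst.
under [X in cmeasurable X]funext do rewrite big_cons.
exact: cmeasurableM.
Qed.

Lemma measurable_sin : measurable_fun [set: R] (@sin R).
Proof. by apply: continuous_measurable_fun; exact: continuous_sin. Qed.

Lemma measurable_cos : measurable_fun [set: R] (@cos R).
Proof. by apply: continuous_measurable_fun; exact: continuous_cos. Qed.

Lemma cmeasurable_cexp f : cmeasurable f -> cmeasurable (fun x => cexp (f x)).
Proof.
move=> [f1 f2]; split => /=; apply: measurable_funM.
- by apply: measurableT_comp => //; exact: measurable_expR.
- by apply: measurableT_comp => //; exact: measurable_cos.
- by apply: measurableT_comp => //; exact: measurable_expR.
- by apply: measurableT_comp => //; exact: measurable_sin.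
Qed.

Lemma cintegrable_le f (g : T -> R) : cmeasurable f -> rintegrable mu g ->
  (forall x, nrm (f x) <= g x) -> cintegrable f.
Proof.
move=> [f1 f2] ig fg; split; apply: rintegrable_le ig _ => // x.
  exact: le_trans (normRe_le _) (fg x).
exact: le_trans (normIm_le _) (fg x).
Qed.

Lemma cintegralZ (z : R[i]) f : cintegrable f ->
  cintegral mu setT (fun x => z * f x) = z * cintegral mu setT f.
Proof.
move=> [f1 f2]; apply/eqP; rewrite eq_complex ReM ImM /=.
apply/andP; split; apply/eqP.
  under eq_Rintegral do rewrite ReM.
  by rewrite RintegralB//= ?RintegralZl//; exact: rintegrableZ.
under eq_Rintegral do rewrite ImM.
by rewrite RintegralD//= ?RintegralZl//; exact: rintegrableZ.
Qed.

Lemma cintegralD f g : cintegrable f -> cintegrable g ->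
  cintegral mu setT (fun x => f x + g x) =
  cintegral mu setT f + cintegral mu setT g.
Proof.
move=> [f1 f2] [g1 g2]; apply/eqP; rewrite eq_complex ReD ImD /=.
apply/andP; split; apply/eqP.
  by under eq_Rintegral do rewrite ReD; rewrite RintegralD.
by under eq_Rintegral do rewrite ImD; rewrite RintegralD.
Qed.

Lemma cintegrableD f g : cintegrable f -> cintegrable g ->
  cintegrable (fun x => f x + g x).
Proof.
move=> [f1 f2] [g1 g2]; split.
  by under [X in _ \o X]funext do rewrite ReD; exact: rintegrableD.
by under [X in _ \o X]funext do rewrite ImD; exact: rintegrableD.
Qed.

Lemma cintegrableZ (z : R[i]) f : cintegrable f -> cintegrable (fun x => z * f x).
Proof.
move=> [f1 f2]; split.
  under [X in _ \o X]funext do rewrite ReM -mulNr.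
  by apply: rintegrableD; exact: rintegrableZ.
under [X in _ \o X]funext do rewrite ImM.
by apply: rintegrableD; exact: rintegrableZ.
Qed.

Lemma eq_cintegral f g : f =1 g -> cintegral mu setT f = cintegral mu setT g.
Proof. by move=> /funext ->. Qed.

Lemma cintegral_real (h : T -> R) :
  cintegral mu setT (fun x => (h x)%:C) = (\int[mu]_x h x)%:C.
Proof.
by rewrite /cintegral/=; congr (_ +i* _); rewrite /Rintegral integral0_eq.
Qed.

Lemma nrm_cintegral_le f (g : T -> R) : cmeasurable f -> rintegrable mu g ->
  (forall x, nrm (f x) <= g x) -> nrm (cintegral mu setT f) <= \int[mu]_x g x.
Proof.
move=> mf ig fg; set I := cintegral _ _ _.
have [->|I0] := eqVneq I 0.
  rewrite ComplexField.Normc.normc0 Rintegral_ge0// => x _.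
  exact: le_trans (nrm_ge0 _) (fg x).
have fi := cintegrable_le mf ig fg.
(* rotate by the phase u of I, so that |I| is the integral of Re (u f) *)
pose u : R[i] := (nrm I)%:C / I.
have uI : complex.Re (u * I) = nrm I by rewrite /u divfK.
have nu : nrm u = 1.
  by rewrite nrmM nrmV nrm_real ger0_norm ?nrm_ge0// divff// nrm_eq0.
rewrite -uI -cintegralZ// /cintegral /=; apply: le_Rintegral => //.
  by have [] := cintegrableZ u fi.
move=> x _; apply: le_trans (fg x); apply: le_trans (ler_norm _) _.
by apply: le_trans (normRe_le _) _; rewrite nrmM nu mul1r.
Qed.

End complex_integration.

Section complex_fubini.
Context d1 d2 (T1 : measurableType d1) (T2 : measurableType d2) (R : realType).
Variable m1 : {sigma_finite_measure set T1 -> \bar R}.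
Variable m2 : {sigma_finite_measure set T2 -> \bar R}.
Variables (f : T1 * T2 -> R[i]) (g1 : T1 -> R) (g2 : T2 -> R).
Hypothesis mf : cmeasurable f.
Hypothesis ig1 : rintegrable m1 g1.
Hypothesis ig2 : rintegrable m2 g2.
Hypothesis fg : forall x y, nrm (f (x, y)) <= g1 x * g2 y.

Let fgR x : `|complex.Re (f x)| <= g1 x.1 * g2 x.2.
Proof. by case: x => x y; exact: le_trans (normRe_le _) (fg x y). Qed.

Let fgI x : `|complex.Im (f x)| <= g1 x.1 * g2 x.2.
Proof. by case: x => x y; exact: le_trans (normIm_le _) (fg x y). Qed.

Lemma cfubini1 : cintegral (prod_measure m1 m2) setT f =
  cintegral m1 setT (fun x => cintegral m2 setT (fun y => f (x, y))).
Proof.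
case: mf => m1' m2'; rewrite /cintegral /=; congr (_ +i* _).
  exact: Rfubini1 m1' ig1 ig2 fgR.
exact: Rfubini1 m2' ig1 ig2 fgI.
Qed.

Lemma cfubini2 : cintegral (prod_measure m1 m2) setT f =
  cintegral m2 setT (fun y => cintegral m1 setT (fun x => f (x, y))).
Proof.
case: mf => m1' m2'; rewrite /cintegral /=; congr (_ +i* _).
  exact: Rfubini2 m1' ig1 ig2 fgR.
exact: Rfubini2 m2' ig1 ig2 fgI.
Qed.

Lemma cfubini :
  cintegral m1 setT (fun x => cintegral m2 setT (fun y => f (x, y))) =
  cintegral m2 setT (fun y => cintegral m1 setT (fun x => f (x, y))).
Proof. by rewrite -cfubini1 cfubini2. Qed.

End complex_fubini.


(** * Calculus on the real line *)

Section derivatives.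
Variable R : realType.
Implicit Types (f g : R -> R) (x a b : R).

Lemma dconst (c : R) x : is_derive x 1 (fun=> c) 0.
Proof. exact: is_derive_cst. Qed.

Lemma did x : is_derive x 1 (fun y : R => y) 1.
Proof. exact: is_derive_id. Qed.

Lemma dD f g x a b : is_derive x 1 f a -> is_derive x 1 g b ->
  is_derive x 1 (fun y => f y + g y) (a + b).
Proof. by move=> ? ?; exact: is_deriveD. Qed.

Lemma dN f x a : is_derive x 1 f a -> is_derive x 1 (fun y => - f y) (- a).
Proof. by move=> ?; exact: is_deriveN. Qed.

Lemma dB f g x a b : is_derive x 1 f a -> is_derive x 1 g b ->
  is_derive x 1 (fun y => f y - g y) (a - b).
Proof. by move=> ? ?; exact: is_deriveB. Qed.

Lemma dM f g x a b : is_derive x 1 f a -> is_derive x 1 g b ->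
  is_derive x 1 (fun y => f y * g y) (f x * b + g x * a).
Proof. by move=> ? ?; exact: is_deriveM. Qed.

Lemma dZ (c : R) f x a : is_derive x 1 f a ->
  is_derive x 1 (fun y => c * f y) (c * a).
Proof. by move=> ?; exact: is_deriveZ. Qed.

Lemma dX f n x a : is_derive x 1 f a ->
  is_derive x 1 (fun y => f y ^+ n.+1) (n.+1%:R * f x ^+ n * a).
Proof.
move=> fa; elim: n => [|n IH].
  by rewrite expr0 mulr1 mul1r; under eq_fun do rewrite expr1.
under eq_fun do rewrite exprS.
apply: is_derive_eq (dM fa IH) _; rewrite exprS [n.+2%:R]mulrS; ring.
Qed.

Lemma dcomp f g x a b : is_derive (g x) 1 f a -> is_derive x 1 g b ->
  is_derive x 1 (fun y => f (g y)) (a * b).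
Proof. exact: is_derive1_comp. Qed.

Lemma dexp f x a : is_derive x 1 f a ->
  is_derive x 1 (fun y => expR (f y)) (expR (f x) * a).
Proof. by apply: dcomp; exact: is_derive_expR. Qed.

Lemma dcos f x a : is_derive x 1 f a ->
  is_derive x 1 (fun y => cos (f y)) (- sin (f x) * a).
Proof. by apply: dcomp; exact: is_derive_cos. Qed.

Lemma dsin f x a : is_derive x 1 f a ->
  is_derive x 1 (fun y => sin (f y)) (cos (f x) * a).
Proof. by apply: dcomp; exact: is_derive_sin. Qed.

Lemma datan f x a : is_derive x 1 f a ->
  is_derive x 1 (fun y => atan (f y)) ((1 + f x ^+ 2)^-1 * a).
Proof. by apply: dcomp; exact: is_derive1_atan. Qed.

Lemma dln f x a : 0 < f x -> is_derive x 1 f a ->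
  is_derive x 1 (fun y => ln (f y)) ((f x)^-1 * a).
Proof. by move=> fx; apply: dcomp; exact: is_derive1_ln. Qed.

Lemma dV f x a : f x != 0 -> is_derive x 1 f a ->
  is_derive x 1 (fun y => (f y)^-1) (- (f x) ^- 2 * a).
Proof. by move=> fx ?; exact: is_deriveV. Qed.

Definition antiderivative f f' := forall x, is_derive x 1 f (f' x).

Lemma derive_continuous f f' : antiderivative f f' -> continuous f.
Proof.
move=> fd x; have [fx _] := fd x.
exact/differentiable_continuous/derivable1_diffP.
Qed.

End derivatives.

Section lebesgue_line.
Variable R : realType.
Notation leb := (@lebesgue_measure R).
Implicit Types (f F G : R -> R) (a b : R).

Lemma Rdominated_cvg d (T : measurableType d) (mu : {measure set T -> \bar R})
    (f_ : nat -> T -> R) (f g : T -> R) :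
  (forall n, measurable_fun setT (f_ n)) ->
  (forall x, f_ n x @[n --> \oo] --> f x) ->
  rintegrable mu g -> (forall n x, `|f_ n x| <= g x) ->
  (\int[mu]_x f_ n x) @[n --> \oo] --> \int[mu]_x f x.
Proof.
move=> mf ff ig fg.
have mlim : measurable_fun setT f.
  by apply: (@measurable_fun_cvg _ _ _ _ f_) => // x _; exact: ff.
have [|||||fi _ cv] := @dominated_convergence _ _ _ mu setT measurableT
    (fun n => EFin \o f_ n) (EFin \o f) (EFin \o g).
- by move=> n; exact/measurable_EFinP.
- exact/measurable_EFinP.
- by apply: aeW => x _; apply: cvg_EFin; [exact: nearW|exact: ff].
- exact: ig.
- by apply: aeW => x n _; rewrite lee_fin.
by move: cv; rewrite -EFin_Rintegral// => /fine_cvgP[].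
Qed.

Lemma Rintegral_line_cvg f : rintegrable leb f ->
  (\int[leb]_(x in `[- n%:R, n%:R]) f x) @[n --> \oo] --> \int[leb]_x f x.
Proof.
move=> fi; have mf := rintegrable_measurable fi.
under eq_fun do rewrite Rintegral_mkcond.
apply: (Rdominated_cvg _ _ (integrable_norm fi)).
- by move=> n; apply/measurable_restrict => //; exact: measurable_funTS.
- move=> x; apply: cvg_near_cst; near=> n.
  rewrite patchE ifT// inE /= in_itv/= -ler_norml; near: n.
  exact: nbhs_infty_ger.
- move=> n x /=; rewrite patchE; case: ifP => //= _.
  by rewrite normr0.
Unshelve. all: by end_near. Qed.

Lemma FTC_segment f F a b : a < b -> continuous f ->
  antiderivative F f ->
  \int[leb]_(x in `[a, b]) f x = F b - F a.
Proof.
move=> ab cf dF; have cF := derive_continuous dF.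
rewrite /Rintegral (@continuous_FTC2 _ f F)//.
- exact: continuous_subspaceT.
- split; [by move=> x _; have [] := dF x| |].
    exact/cvg_at_right_filter/cF.
  exact/cvg_at_left_filter/cF.
- by move=> x _; rewrite derive1E; have [_ ->] := dF x.
Qed.

Lemma FTC_line f F (l l' : R) : rintegrable leb f -> continuous f ->
  antiderivative F f ->
  F n%:R @[n --> \oo] --> l -> F (- n%:R) @[n --> \oo] --> l' ->
  \int[leb]_x f x = l - l'.
Proof.
move=> fi cf dF Fl Fl'.
have cv := Rintegral_line_cvg fi.
have cv' : (\int[leb]_(x in `[- n%:R, n%:R]) f x) @[n --> \oo] --> l - l'.
  apply: cvg_trans (cvgB Fl Fl'); apply: near_eq_cvg; near=> n.
  rewrite (FTC_segment _ cf dF)// gtrN// ltr0n.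
  by near: n; exact: nbhs_infty_gt.
by rewrite -(cvg_lim _ cv)// (cvg_lim _ cv').
Unshelve. all: by end_near. Qed.

End lebesgue_line.

(** * Explicit integrals over the line *)

Section explicit_integrals.
Variable R : realType.
Notation leb := (@lebesgue_measure R).

(** The function f0 is a smooth expression of f on the positive half-line, where
    absolute values are absent. *)
Lemma even_integral (f f0 F : R -> R) (l : R) :
  (forall y, 0 <= f y) -> continuous f -> f =1 f \o -%R ->
  (forall y, 0 <= y -> f y = f0 y) -> continuous f0 ->
  antiderivative F f0 -> F y @[y --> +oo] --> l ->
  (\int[leb]_y (f y)%:E = (2 * (l - F 0))%:E)%E.
Proof.
move=> f_ge0 cf fN ff0 cf0 dF Fl.
rewrite ge0_symfun_integralT//.
have -> : [set y : R | 0 <= y] = `[0, +oo[%classic.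
  by apply/seteqP; split => y /=; rewrite in_itv/= andbT.
rewrite EFinM EFinB; congr (_ * _)%E.
transitivity (\int[leb]_(y in `[0%R, +oo[) (f0 y)%:E)%E.
  by apply: eq_integral => y; rewrite inE /= in_itv/= andbT => y0; rewrite ff0.
apply: ge0_continuous_FTC2y => //.
- by move=> y y0; rewrite -ff0.
- exact: continuous_subspaceT.
- by move=> y _; have [] := dF y.
- exact/cvg_at_right_filter/(derive_continuous dF).
- by move=> y _; rewrite derive1E; have [_ ->] := dF y.
Qed.

Lemma expRN_cvgy (e : R) : 0 < e -> expR (- (e * y)) @[y --> +oo] --> (0 : R).
Proof.
move=> e0; apply: (@cvg_comp _ _ _ (fun y : R => e * y) (fun y => expR (- y)) _ (pinfty_nbhs R)).
  exact: gt0_cvgMry.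
exact: cvgr_expR.
Qed.

Lemma expRN_bounded_cvgy (e C : R) (h : R -> R) : 0 < e -> (forall y, `|h y| <= C) ->
  expR (- (e * y)) * h y @[y --> +oo] --> (0 : R).
Proof.
move=> e0 hC; apply: (@squeeze_cvgr _ _ _ _ (fun y => - (expR (- (e * y)) * C))
  (fun y => expR (- (e * y)) * C)).
- apply: nearW => y; rewrite -ler_norml normrM ger0_norm ?expR_ge0//.
  by rewrite ler_wpM2l// expR_ge0.
- by rewrite -oppr0 -(mul0r C); apply: cvgN; apply: cvgMl; exact: expRN_cvgy.
- by rewrite -(mul0r C); apply: cvgMl; exact: expRN_cvgy.
Qed.

Lemma continuous_expRNabs (e : R) : continuous (fun y : R => expR (- (e * `|y|))).
Proof.
move=> y; apply: continuous_comp; last exact: continuous_expR.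
by apply: cvgN; apply: cvgMr; exact: norm_continuous.
Qed.

Lemma continuous_cosM (x : R) : continuous (fun y : R => cos (x * y)).
Proof. by apply: derive_continuous => y; apply: dcos (dZ _ (did _)). Qed.

Lemma integral_expRNabs (e : R) : 0 < e ->
  (\int[leb]_y (expR (- (e * `|y|)))%:E = (2 / e)%:E)%E.
Proof.
move=> e0; rewrite (@even_integral _ (fun y => expR (- (e * y)))
  (fun y => - e^-1 * expR (- (e * y))) 0).
- by congr EFin; rewrite mulr0 oppr0 expR0; field; rewrite gt_eqF.
- by move=> y; exact: expR_ge0.
- exact: continuous_expRNabs.
- by move=> y /=; rewrite normrN.
- by move=> y y0; rewrite ger0_norm.
- by apply: derive_continuous => y; apply: dexp (dN (dZ _ (did _))).
- move=> y; apply: is_derive_eq (dZ _ (dexp (dN (dZ _ (did _))))) _.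
  by field; rewrite gt_eqF.
- by rewrite -(mulr0 (- e^-1)); apply: cvgMr; exact: expRN_cvgy.
Qed.

Lemma rintegrable_expRNabs (e : R) : 0 < e ->
  rintegrable leb (fun y => expR (- (e * `|y|))).
Proof.
move=> e0; apply: (@rintegrable_ge0 _ _ _ _ _ (2 / e)).
- apply: continuous_measurable_fun; exact: continuous_expRNabs.
- by move=> y; exact: expR_ge0.
- by rewrite integral_expRNabs.
Qed.

(** The Poisson kernel as the cosine transform of the two-sided exponential. *)
Lemma Rintegral_expRNabs_cos (e x : R) : 0 < e ->
  \int[leb]_y (expR (- (e * `|y|)) * cos (x * y)) = 2 * e / (e ^+ 2 + x ^+ 2).
Proof.
move=> e0; have ex0 : e ^+ 2 + x ^+ 2 != 0.
  by rewrite gt_eqF// ltr_pwDl ?exprn_gt0// sqr_ge0.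
have i1 := rintegrable_expRNabs e0.
have mc : measurable_fun setT (fun y : R => cos (x * y)).
  apply: continuous_measurable_fun; exact: continuous_cosM.
have i2 : rintegrable leb (fun y => expR (- (e * `|y|)) * cos (x * y)).
  apply: rintegrable_le i1 _.
    apply: measurable_funM => //.
    apply: continuous_measurable_fun; exact: continuous_expRNabs.
  by move=> y; rewrite normrM ger0_norm ?expR_ge0// ler_piMr ?expR_ge0// cos_max.
have i1E : \int[leb]_y expR (- (e * `|y|)) = 2 / e.
  by rewrite /Rintegral integral_expRNabs.
(* adding the integral of the exponential alone makes the integrand non-negative,
     which allows an improper integral to be evaluated by an antiderivative *)
suff : \int[leb]_y (expR (- (e * `|y|)) + expR (- (e * `|y|)) * cos (x * y)) =
    2 / e + 2 * e / (e ^+ 2 + x ^+ 2).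
  by rewrite RintegralD// i1E => /addrI.
rewrite /Rintegral (@even_integral _
  (fun y => expR (- (e * y)) + expR (- (e * y)) * cos (x * y))
  (fun y => expR (- (e * y)) *
    (- e^-1 + (x * sin (x * y) - e * cos (x * y)) / (e ^+ 2 + x ^+ 2))) 0) /=.
- rewrite !mulr0 oppr0 expR0 sin0 cos0; field.
  by rewrite ex0 gt_eqF.
- move=> y; rewrite -[X in X + _]mulr1 -mulrDr; apply: mulr_ge0.
    exact: expR_ge0.
  by have := cos_geN1 (x * y); lra.
- move=> y; apply: cvgD; first exact: continuous_expRNabs.
  by apply: cvgM; [exact: continuous_expRNabs|exact: continuous_cosM].
- by move=> y /=; rewrite normrN mulrN cosN.
- by move=> y y0; rewrite ger0_norm.
- apply: derive_continuous => y.
  by apply: dD (dexp (dN (dZ _ (did _))))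
    (dM (dexp (dN (dZ _ (did _)))) (dcos (dZ _ (did _)))).
- move=> y.
  have dT := dB (dZ x (dsin (dZ x (did y)))) (dZ e (dcos (dZ x (did y)))).
  have dS := dD (dconst (- e^-1) y) (dM dT (dconst (e ^+ 2 + x ^+ 2)^-1 y)).
  apply: is_derive_eq (dM (dexp (dN (dZ e (did y)))) dS) _.
  by field; rewrite ex0 gt_eqF.
- apply: (@expRN_bounded_cvgy e (e^-1 + (`|x| + e) / (e ^+ 2 + x ^+ 2)) _ e0) => y.
  apply: le_trans (ler_normD _ _) _; rewrite normrN [`|e^-1|]ger0_norm ?invr_ge0 ?(ltW e0)//.
  have d0 : 0 <= (e ^+ 2 + x ^+ 2)^-1 by rewrite invr_ge0 addr_ge0 ?sqr_ge0.
  rewrite lerD2l normrM [X in _ * X](ger0_norm d0); apply: ler_wpM2r => //.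
  apply: le_trans (ler_normB _ _) _; rewrite !normrM [`|e|](gtr0_norm e0).
  apply: lerD; first by rewrite ler_piMr// sin_max.
  by rewrite ler_piMr ?(ltW e0)// cos_max.
Qed.

Let cauchy_ge0 (w : R) : 0 <= (1 + w ^+ 2)^-1.
Proof. by rewrite invr_ge0 addr_ge0// sqr_ge0. Qed.

Lemma continuous_cauchy : continuous (fun w : R => (1 + w ^+ 2)^-1).
Proof.
apply: derive_continuous => w; apply: dV (dD (dconst 1 w) (dX 1 (did w))).
by rewrite gt_eqF// ltr_pwDl// sqr_ge0.
Qed.

Lemma integral_cauchy : (\int[leb]_w ((1 + w ^+ 2)^-1)%:E = (pi : R)%:E)%E.
Proof.
rewrite (@even_integral _ (fun w => (1 + w ^+ 2)^-1) (@atan R) (pi / 2)) //.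
- by rewrite atan0 subr0 mulrC divfK.
- exact: continuous_cauchy.
- by move=> w /=; rewrite sqrrN.
- exact: continuous_cauchy.
- by move=> w; exact: is_derive1_atan.
- exact: cvgy_atan.
Qed.

Lemma rintegrable_cauchy : rintegrable leb (fun w => (1 + w ^+ 2)^-1).
Proof.
apply: (@rintegrable_ge0 _ _ _ _ _ pi) => //.
  apply: continuous_measurable_fun; exact: continuous_cauchy.
by rewrite integral_cauchy.
Qed.

Lemma integral_affine (G : R -> R) (v e : R) : 0 < e -> continuous G ->
  (forall u, 0 <= G u) ->
  (\int[leb]_u (G u)%:E = \int[leb]_w (G (v + e * w) * e)%:E)%E.
Proof.
move=> e0 cG G0; have dF : antiderivative (fun w => v + e * w) (cst e).
  move=> w; by apply: is_derive_eq (dD (dconst _ _) (dZ _ (did _))) _; rewrite add0r mulr1.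
have F' : (fun w => v + e * w)^`()%classic = cst e.
  by apply/funext => w; rewrite derive1E; have [_ ->] := dF w.
rewrite (@increasing_ge0_integration_by_substitutionT _ (fun w => v + e * w)) //.
- by apply: eq_integral => w _ /=; rewrite F'.
- by move=> x y xy; rewrite ltrD2l ltr_pM2l.
- by rewrite F'; exact: cst_continuous.
- by rewrite F'; exact: is_cvg_cst.
- by rewrite F'; exact: is_cvg_cst.
- by apply/cvgrNyPle => A; near=> w; rewrite addrC -lerBrDr -ler_pdivlMl.
- by apply/cvgryPge => A; near=> w; rewrite addrC -lerBlDr -ler_pdivrMl.
Unshelve. all: by end_near. Qed.

(** The logarithmic change of variable t = e^v. *)
Lemma integral_expR_subst (G : R -> R) :
  (forall t, 0 < t -> 0 <= G t) -> (forall t, 0 < t -> {for t, continuous G}) ->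
  (\int[leb]_(t in `]0%R, +oo[) (G t)%:E = \int[leb]_v (G (expR v) * expR v)%:E)%E.
Proof.
move=> G0 cG.
have cGe : continuous (fun v : R => G (expR v) * expR v).
  move=> v; apply: cvgM; last exact: continuous_expR.
  apply: (@continuous_comp _ _ _ expR G); first exact: continuous_expR.
  by apply: cG; exact: expR_gt0.
pose A n : set R := `[expR (- n%:R), expR n%:R]%classic.
pose B n : set R := `[- n%:R, n%:R]%classic.
have UA : \bigcup_n A n = `]0, +oo[%classic.
  apply/seteqP; split => [t [n _]|t] /=; rewrite /A /= !in_itv/= ?andbT.
    by move=> /andP[+ _]; apply: lt_le_trans; exact: expR_gt0.
  move=> t0; exists (Num.truncn `|ln t|).+1 => //=.
  rewrite in_itv/= -{2 3}(lnK t0) !ler_expR -ler_norml.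
  by rewrite ltW// truncnS_gt.
have UB : \bigcup_n B n = setT.
  apply/seteqP; split => // t _; exists (Num.truncn `|t|).+1 => //=.
  by rewrite /B /= in_itv/= -ler_norml ltW// truncnS_gt.
rewrite -UA -[in RHS]UB.
have cA : (\int[leb]_(x in A n) (G x)%:E)%E @[n --> \oo] -->
    (\int[leb]_(x in \bigcup_n A n) (G x)%:E)%E.
  apply: ge0_nondecreasing_set_cvg_integral.
  - move=> n m nm; apply/subsetPset => t; rewrite /A /= !in_itv/= => /andP[h1 h2].
    apply/andP; split; [apply: le_trans h1|apply: le_trans h2 _];
      by rewrite ler_expR ?lerN2 ler_nat.
  - by move=> n; exact: measurable_itv.
  - move=> n; apply/measurable_EFinP.
    apply: (@subspace_continuous_measurable_fun R (A n) G).
      exact: measurable_itv.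
    apply/continuous_in_subspaceT => t; rewrite inE /A /= in_itv/= => /andP[h _].
    by apply: cG; exact: lt_le_trans (expR_gt0 _) h.
  - move=> n t; rewrite /A /= in_itv/= => /andP[h _].
    by rewrite lee_fin G0// (lt_le_trans (expR_gt0 _) h).
have cB : (\int[leb]_(v in B n) (G (expR v) * expR v)%:E)%E @[n --> \oo] -->
    (\int[leb]_(v in \bigcup_n B n) (G (expR v) * expR v)%:E)%E.
  apply: ge0_nondecreasing_set_cvg_integral.
  - move=> n m nm; apply/subsetPset => t; rewrite /B /= !in_itv/= => /andP[h1 h2].
    by apply/andP; split; [apply: le_trans h1|apply: le_trans h2 _];
      rewrite ?lerN2 ler_nat.
  - by move=> n; exact: measurable_itv.
  - move=> n; apply/measurable_EFinP/measurable_funTS.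
    exact: continuous_measurable_fun.
  - by move=> n t _; rewrite lee_fin mulr_ge0 ?G0 ?expR_ge0 ?expR_gt0.
rewrite -(cvg_lim _ cA)// -(cvg_lim _ cB)//; congr (limn _); apply/funext => n.
have e' : expR^`()%classic = @expR R.
  by apply/funext => v; rewrite derive1E; have [_ ->] := is_derive_expR v.
rewrite /A integration_by_substitution_increasing.
- by apply: eq_integral => v _ /=; rewrite e'.
- by rewrite -subr_ge0 opprK addr_ge0.
- by move=> x y _ _; rewrite ltr_expR.
- by move=> x _; rewrite e'; exact: continuous_expR.
- by rewrite e'; apply/cvg_ex; eexists; exact/cvg_at_right_filter/continuous_expR.
- by rewrite e'; apply/cvg_ex; eexists; exact/cvg_at_left_filter/continuous_expR.
- split; first by move=> x _; exact: derivable_expR.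
    exact/cvg_at_right_filter/continuous_expR.
  exact/cvg_at_left_filter/continuous_expR.
- apply/continuous_in_subspaceT => t; rewrite inE /= in_itv/= => /andP[h _].
  by apply: cG; exact: lt_le_trans (expR_gt0 _) h.
Qed.

End explicit_integrals.

(** * Euler's integral in the logarithmic coordinate *)

Section euler_integral.
Variable R : realType.
Notation leb := (@lebesgue_measure R).
Implicit Types (x y v : R) (z : R[i]).

Lemma mul_sub_expR_le (g v : R) : 0 < g -> g * v - expR v <= g * (ln g - 1).
Proof.
move=> g0; have := expR_ge1Dx (v - ln g).
rewrite expRD expRN lnK// ler_pdivlMr// => h; lra.
Qed.

(** The image of the weight t^(x-1) e^(-t) dt under v = ln t. *)
Definition gumbel (x v : R) : R := expR (x * v - expR v).

Lemma gumbel_le x : 0 < x -> exists C e : R, [/\ 0 < C, 0 < e &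
  forall v, gumbel x v <= C * expR (- (e * `|v|))].
Proof.
move=> x0; pose c := (x + 1) * (ln (x + 1) - 1).
exists (expR `|c|), (Num.min x 1); split; first exact: expR_gt0.
  by rewrite lt_min x0 ltr01.
move=> v; rewrite -expRD ler_expR.
have [v0|v0] := leP 0 v; [rewrite (ger0_norm v0)|rewrite (ltr0_norm v0)].
  have h : (x + 1) * v - expR v <= c by apply: mul_sub_expR_le; lra.
  have : Num.min x 1 * v <= 1 * v by rewrite ler_wpM2r// ge_min lexx orbT.
  by have := ler_norm c; lra.
have : Num.min x 1 * - v <= x * - v by rewrite ler_wpM2r ?ge_min ?lexx// oppr_ge0 ltW.
by have := expR_ge0 v; have := normr_ge0 c; lra.
Qed.

Lemma gumbel_gt0 x v : 0 < gumbel x v. Proof. exact: expR_gt0. Qed.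

Lemma continuous_gumbel x : continuous (gumbel x).
Proof.
apply: derive_continuous => v.
exact: (dexp (dB (dZ x (did v)) (dexp (did v)))).
Qed.

Lemma rintegrable_gumbel x : 0 < x -> rintegrable leb (gumbel x).
Proof.
move=> x0; have [C [e [C0 e0 gC]]] := gumbel_le x0.
apply: rintegrable_le (rintegrableZ C (rintegrable_expRNabs e0)) _.
  by apply: continuous_measurable_fun; exact: continuous_gumbel.
by move=> v; rewrite ger0_norm ?(ltW (gumbel_gt0 _ _)).
Qed.

Lemma gumbelS x v : gumbel (x + 1) v = expR v * gumbel x v.
Proof. by rewrite /gumbel -expRD; congr expR; ring. Qed.

Lemma gumbelM x d v : gumbel (x + d) v = gumbel x v * expR (d * v).
Proof. by rewrite /gumbel -expRD; congr expR; ring. Qed.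

(** The change of variable applies to non-negative functions: it is used for the
    weight multiplied by 1 and by 1 + c, and the results are subtracted. *)
Lemma integral_euler_weight x (c : R -> R) : 0 < x -> continuous c ->
  (forall v, `|c v| <= 1) ->
  \int[leb]_(t in `]0, +oo[) (expR ((x - 1) * ln t - t) * c (ln t)) =
  \int[leb]_v (gumbel x v * c v).
Proof.
move=> x0 cc c1.
have ig := rintegrable_gumbel x0.
have igc : rintegrable leb (fun v => gumbel x v * c v).
  apply: rintegrable_le ig _.
    apply: continuous_measurable_fun => v; apply: cvgM; last exact: cc.
    exact: continuous_gumbel.
  by move=> v; rewrite normrM ger0_norm ?(ltW (gumbel_gt0 _ _))// ler_piMr ?(ltW (gumbel_gt0 _ _)).
pose G0 t : R := expR ((x - 1) * ln t - t).
have cG0 t : 0 < t -> {for t, continuous G0}.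
  move=> t0; have [+ _] := dexp (dB (dZ (x - 1) (dln t0 (did t))) (did t)).
  by move=> ?; exact/differentiable_continuous/derivable1_diffP.
have cG1 t : 0 < t -> {for t, continuous (fun t => G0 t * (1 + c (ln t)))}.
  move=> t0; apply: cvgM; first exact: cG0.
  apply: cvgD; first exact: cvg_cst.
  by apply: continuous_comp; [exact: continuous_ln|exact: cc].
have G0e v : G0 (expR v) * expR v = gumbel x v.
  by rewrite /G0 expRK -expRD /gumbel; congr expR; ring.
have G00 t : 0 <= G0 t by exact: expR_ge0.
have c0 v : 0 <= 1 + c v by have := c1 v; rewrite ler_norml; lra.
have s0 := integral_expR_subst (fun t _ => G00 t) cG0.
have s1 := integral_expR_subst (fun t _ => mulr_ge0 (G00 t) (c0 (ln t))) cG1.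
have mpos : measurable (`]0%R, +oo[%classic : set R) by by [].
have mG (G : R -> R) : (forall t, 0 < t -> {for t, continuous G}) ->
    measurable_fun (`]0%R, +oo[%classic : set R) G.
  move=> cG; apply: open_continuous_measurable_fun; first by apply: interval_open.
  by move=> t; rewrite inE /= in_itv/= andbT; exact: cG.
have i0 : leb.-integrable `]0%R, +oo[ (EFin \o G0).
  apply/integrableP; split; first by apply/measurable_EFinP; exact: mG.
  under eq_integral do rewrite /= ger0_norm//.
  rewrite s0; under eq_integral do rewrite G0e.
  by rewrite -EFin_Rintegral// ltry.
have eg1 v : G0 (expR v) * (1 + c (ln (expR v))) * expR v =
    gumbel x v + gumbel x v * c v.
  by rewrite expRK -G0e; ring.
have ig1 : rintegrable leb (fun v => gumbel x v + gumbel x v * c v).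
  exact: rintegrableD.
have i1 : leb.-integrable `]0%R, +oo[ (EFin \o (fun t => G0 t * (1 + c (ln t)))).
  apply/integrableP; split; first by apply/measurable_EFinP; exact: mG.
  under eq_integral do rewrite /= ger0_norm ?mulr_ge0//.
  rewrite s1; under eq_integral do rewrite eg1.
  by rewrite -EFin_Rintegral// ltry.
transitivity (\int[leb]_(t in `]0%R, +oo[) (G0 t * (1 + c (ln t)) - G0 t)).
  by apply: eq_Rintegral => t _; rewrite -/(G0 t); ring.
rewrite RintegralB//.
rewrite {1}/Rintegral s1 {1}/Rintegral s0.
under eq_integral do rewrite eg1.
under [X in _ - fine X]eq_integral do rewrite G0e.
by rewrite -!/(Rintegral _ _ _) RintegralD// addrC addKr.
Qed.

(** With t = e^v, Euler's integrand t^(z-1) e^(-t) dt becomes e^(z v - e^v) dv,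
    smooth on the whole line and decaying at both ends. *)
Definition euler_kernel z v : R[i] := cexp (z * v%:C - (expR v)%:C).

Lemma Re_euler_kernel z v :
  complex.Re (euler_kernel z v) = gumbel (complex.Re z) v * cos (complex.Im z * v).
Proof.
case: z => x y; rewrite /euler_kernel /cexp /gumbel /=.
by congr (expR _ * cos _); ring.
Qed.

Lemma Im_euler_kernel z v :
  complex.Im (euler_kernel z v) = gumbel (complex.Re z) v * sin (complex.Im z * v).
Proof.
case: z => x y; rewrite /euler_kernel /cexp /gumbel /=.
by congr (expR _ * sin _); ring.
Qed.

Lemma nrm_euler_kernel z v : nrm (euler_kernel z v) = gumbel (complex.Re z) v.
Proof.
by rewrite nrm_cexp; case: z => x y; rewrite /gumbel /= mulr0 subr0.
Qed.

Lemma cmeasurable_line (z : R[i]) :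
  cmeasurable (fun v : R => z * v%:C).
Proof.
apply: cmeasurableM; first exact: cmeasurable_cst.
by apply: cmeasurable_real; exact: measurable_id.
Qed.

Lemma cmeasurable_euler_kernel z : cmeasurable (euler_kernel z).
Proof.
apply: cmeasurable_cexp; apply: cmeasurableD; first exact: cmeasurable_line.
have -> : (fun v : R => - (expR v)%:C) = (fun v => (-1) * (expR v)%:C).
  by apply/funext => v; rewrite mulN1r.
apply: cmeasurableM; first exact: cmeasurable_cst.
by apply: cmeasurable_real; exact: measurable_expR.
Qed.

Lemma cintegrable_euler_kernel z : 0 < complex.Re z ->
  cintegrable leb (euler_kernel z).
Proof.
move=> z0; apply: cintegrable_le (rintegrable_gumbel z0) _.
  exact: cmeasurable_euler_kernel.
by move=> v; rewrite nrm_euler_kernel.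
Qed.

Lemma cEulerE z : 0 < complex.Re z ->
  cEuler z = cintegral leb setT (euler_kernel z).
Proof.
case: z => x y /= x0; rewrite /cEuler /cintegral.
have cpowE t : cpow t (x +i* y - 1) * (expR (- t))%:C =
    (expR ((x - 1) * ln t - t) * cos (y * ln t)) +i*
    (expR ((x - 1) * ln t - t) * sin (y * ln t)).
  rewrite expRD; apply/eqP; rewrite eq_complex.
  rewrite ReM ImM /=.
  have -> : (x - 1) * ln t - (y - 0) * 0 = (x - 1) * ln t by ring.
  have -> : (x - 1) * 0 + (y - 0) * ln t = y * ln t by ring.
  by apply/andP; split; apply/eqP; ring.
congr (_ +i* _).
  under eq_Rintegral do rewrite cpowE /=.
  rewrite (@integral_euler_weight x (fun v => cos (y * v)))//.
  - by apply: eq_Rintegral => v _; rewrite Re_euler_kernel.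
  - by apply: derive_continuous => v; exact: (dcos (dZ y (did v))).
  - by move=> v; exact: cos_max.
under eq_Rintegral do rewrite cpowE /=.
rewrite (@integral_euler_weight x (fun v => sin (y * v)))//.
- by apply: eq_Rintegral => v _; rewrite Im_euler_kernel.
- by apply: derive_continuous => v; exact: (dsin (dZ y (did v))).
- by move=> v; exact: sin_max.
Qed.

Lemma cEuler_real x : 0 < x -> cEuler x%:C = (Gamma x)%:C.
Proof. by move=> x0; rewrite -cGamma_real// /cGamma /= x0. Qed.

Lemma GammaE x : 0 < x -> Gamma x = \int[leb]_v gumbel x v.
Proof.
move=> x0; have [<- _] : (complex.Re (cEuler x%:C) = Gamma x) /\ True.
  by rewrite cEuler_real.
rewrite cEulerE//.
transitivity (\int[leb]_v complex.Re (euler_kernel x%:C v)) => //.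
apply: eq_Rintegral => v _; by rewrite Re_euler_kernel /= mul0r cos0 mulr1.
Qed.

Lemma nrm_cEuler_le z : 0 < complex.Re z -> nrm (cEuler z) <= Gamma (complex.Re z).
Proof.
move=> z0; rewrite cEulerE// GammaE//; apply: nrm_cintegral_le.
- exact: cmeasurable_euler_kernel.
- exact: rintegrable_gumbel.
- by move=> v; rewrite nrm_euler_kernel.
Qed.

Lemma Gamma_gt0 x : 0 < x -> 0 < Gamma x.
Proof.
move=> x0; have ig := rintegrable_gumbel x0.
apply: (@lt_le_trans _ _ (\int[leb]_(v in `[0, 1]) expR (- expR 1))).
  rewrite Rintegral_cst//= lebesgue_measure_itv/= lte_fin ltr01 oppr0 addr0 mulr1.
  exact: expR_gt0.
rewrite GammaE// Rintegral_mkcond; apply: le_Rintegral => //.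
  rewrite -restrict_EFin; apply/integrable_restrict => //=; rewrite setTI.
  apply: continuous_compact_integrable; first exact: segment_compact.
  by apply: continuous_subspaceT => v; exact: cvg_cst.
move=> v _; rewrite patchE; case: ifPn => [|_]; last exact/ltW/gumbel_gt0.
rewrite inE /= in_itv/= => /andP[v0 v1]; rewrite ler_expR.
by have := mulr_ge0 (ltW x0) v0; have : expR v <= expR 1 by [rewrite ler_expR]; lra.
Qed.

Let gumbel_bounded_cvg0 x (h : nat -> R) (s : R) : 0 < x -> `|s| = 1 ->
  (forall n, `|h n| <= 1) -> gumbel x (s * n%:R) * h n @[n --> \oo] --> (0 : R).
Proof.
move=> x0 s1 h1; have [C [e [C0 e0 gC]]] := gumbel_le x0.
have cv : C * expR (- (e * n%:R)) @[n --> \oo] --> (0 : R).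
  rewrite -(mulr0 C); apply: cvgMr.
  apply: (@cvg_comp _ _ _ (fun n => n%:R) (fun y => expR (- (e * y))) _ (pinfty_nbhs R)).
    exact: cvgr_idn.
  exact: expRN_cvgy.
apply: (@squeeze_cvgr _ _ _ _ (fun n => - (C * expR (- (e * n%:R))))
  (fun n => C * expR (- (e * n%:R)))) => //; last first.
  by rewrite -oppr0; exact: cvgN.
apply: nearW => n; rewrite -ler_norml normrM ger0_norm ?(ltW (gumbel_gt0 _ _))//.
apply: (@le_trans _ _ (gumbel x (s * n%:R))).
  by rewrite ler_piMr// (ltW (gumbel_gt0 _ _)).
by have := gC (s * n%:R); rewrite normrM s1 mul1r normr_nat.
Qed.

(** Integration by parts: e^(zv - e^v) vanishes at both ends of the line and has
    derivative (z - e^v) e^(zv - e^v). *)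
Lemma cEulerS z : 0 < complex.Re z -> cEuler (z + 1) = z * cEuler z.
Proof.
case: z => x y /= x0.
have x10 : 0 < complex.Re ((x +i* y) + 1 : R[i]) by rewrite ReD /= addr_gt0.
have i0 := @cintegrable_euler_kernel (x +i* y) x0.
have i1 := cintegrable_euler_kernel x10.
rewrite (cEulerE x10) (@cEulerE (x +i* y) x0) -cintegralZ//.
apply/eqP; rewrite -subr_eq0 -mulN1r -[X in _ + X]cintegralZ; last first.
  exact: cintegrableZ.
rewrite -cintegralD//; last by apply: cintegrableZ; exact: cintegrableZ.
have [iR iI] := cintegrableD i1 (cintegrableZ (-1) (cintegrableZ (x +i* y) i0)).
have dg v : is_derive v 1 (gumbel x) (gumbel x v * (x * 1 - expR v * 1)).
  exact: (dexp (dB (dZ x (did v)) (dexp (did v)))).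
pose fR v := - (gumbel x v * (- sin (y * v) * (y * 1)) +
  cos (y * v) * (gumbel x v * (x * 1 - expR v * 1))).
pose fI v := - (gumbel x v * (cos (y * v) * (y * 1)) +
  sin (y * v) * (gumbel x v * (x * 1 - expR v * 1))).
have dR : antiderivative (fun v => - (gumbel x v * cos (y * v))) fR.
  by move=> v; exact: (dN (dM (dg v) (dcos (dZ y (did v))))).
have dI : antiderivative (fun v => - (gumbel x v * sin (y * v))) fI.
  by move=> v; exact: (dN (dM (dg v) (dsin (dZ y (did v))))).
have cg := @continuous_gumbel x.
have cc : continuous (fun v => cos (y * v)).
  by apply: derive_continuous => v; exact: (dcos (dZ y (did v))).
have cs : continuous (fun v => sin (y * v)).
  by apply: derive_continuous => v; exact: (dsin (dZ y (did v))).
have ce : continuous (fun v : R => x * 1 - expR v * 1).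
  move=> v; apply: cvgB; first exact: cvg_cst.
  by apply: cvgMl; exact: continuous_expR.
have cfR : continuous fR.
  move=> v; apply: cvgN; apply: cvgD; apply: cvgM.
  - exact: cg.
  - by apply: cvgMl; apply: cvgN; exact: cs.
  - exact: cc.
  - by apply: cvgM; [exact: cg|exact: ce].
have cfI : continuous fI.
  move=> v; apply: cvgN; apply: cvgD; apply: cvgM.
  - exact: cg.
  - by apply: cvgMl; exact: cc.
  - exact: cs.
  - by apply: cvgM; [exact: cg|exact: ce].
have ER v : complex.Re (euler_kernel (x +i* y + 1) v +
    (-1) * (x +i* y * euler_kernel (x +i* y) v)) = fR v.
  rewrite ReD mulN1r ReN ReM !Re_euler_kernel !Im_euler_kernel ReD ImD /=.
  by rewrite gumbelS addr0 /fR; ring.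
have EI v : complex.Im (euler_kernel (x +i* y + 1) v +
    (-1) * (x +i* y * euler_kernel (x +i* y) v)) = fI v.
  rewrite ImD mulN1r ImN ImM !Re_euler_kernel !Im_euler_kernel ReD ImD /=.
  by rewrite gumbelS addr0 /fI; ring.
have lim (F : R -> R) : (forall v, `|F v| <= 1) -> forall s : R, `|s| = 1 ->
    - (gumbel x (s * n%:R) * F (s * n%:R)) @[n --> \oo] --> (0 : R).
  move=> F1 s s1; rewrite -oppr0; apply: cvgN.
  by apply: (gumbel_bounded_cvg0 (h := fun n => F (s * n%:R))).
have limp (F : R -> R) : (forall v, `|F v| <= 1) ->
    - (gumbel x n%:R * F n%:R) @[n --> \oo] --> (0 : R).
  by move=> F1; have := lim F F1 1 (normr1 _); under eq_fun do rewrite mul1r.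
have limn (F : R -> R) : (forall v, `|F v| <= 1) ->
    - (gumbel x (- n%:R) * F (- n%:R)) @[n --> \oo] --> (0 : R).
  by move=> F1; have := lim F F1 (-1) (normrN1 _); under eq_fun do rewrite mulN1r.
rewrite eq_complex; apply/andP; split; apply/eqP.
  transitivity (\int[leb]_v fR v); first by apply: eq_Rintegral => v _; rewrite -ER.
  rewrite (@FTC_line _ fR _ 0 0 _ cfR dR) ?subr0//.
  - by move: iR; under [X in _ \o X]eq_fun do rewrite ER.
  - by apply: (limp (fun v => cos (y * v))) => v; exact: cos_max.
  - by apply: (limn (fun v => cos (y * v))) => v; exact: cos_max.
transitivity (\int[leb]_v fI v); first by apply: eq_Rintegral => v _; rewrite -EI.
rewrite (@FTC_line _ fI _ 0 0 _ cfI dI) ?subr0//.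
- by move: iI; under [X in _ \o X]eq_fun do rewrite EI.
- by apply: (limp (fun v => sin (y * v))) => v; exact: sin_max.
- by apply: (limn (fun v => sin (y * v))) => v; exact: sin_max.
Qed.

Lemma GammaS x : 0 < x -> Gamma (x + 1) = x * Gamma x.
Proof.
move=> x0; have := @cEulerS x%:C x0; rewrite -[1]/(1%:C) -rmorphD /=.
rewrite !cEuler_real ?addr_gt0// -rmorphM => /= h.
exact: (complexI h).
Qed.

(** Along a vertical line the integral depends continuously on the ordinate, by
    dominated convergence. *)
Lemma measurable_cEuler_line x (d : R) : 0 < x ->
  cmeasurable (fun y => cEuler (x +i* (d * y))).
Proof.
move=> x0; have ig := rintegrable_gumbel x0.
have key (c : R -> R) : continuous c -> (forall v, `|c v| <= 1) ->
    measurable_fun setT (fun y => \int[leb]_v (gumbel x v * c (d * y * v))).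
  move=> cc c1; apply: continuous_measurable_fun => y.
  have cdy v : continuous (fun y => gumbel x v * c (d * y * v)).
    move=> y'; apply: cvgMr.
    apply: (@continuous_comp _ _ _ (fun y => d * y * v) c); last exact: cc.
    by apply: cvgMl; apply: cvgMr; exact: cvg_id.
  apply: (@continuity_under_integral _ _ _ leb (fun y v => gumbel x v * c (d * y * v))
    setT measurableT (y - 1) (y + 1) _ _ (gumbel x)) => //.
  - move=> y' _; apply: rintegrable_le ig _.
      apply: continuous_measurable_fun => v; apply: cvgM.
        exact: continuous_gumbel.
      apply: (@continuous_comp _ _ _ (fun v => d * y' * v) c); last exact: cc.
      by apply: cvgMr; exact: cvg_id.
    by move=> v; rewrite normrM ger0_norm ?(ltW (gumbel_gt0 _ _))// ler_piMr ?(ltW (gumbel_gt0 _ _)).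
  - by apply: aeW => v _ y' _; exact: cdy.
  - move=> y' _; apply: aeW => v _.
    by rewrite normrM ger0_norm ?(ltW (gumbel_gt0 _ _))// ler_piMr ?(ltW (gumbel_gt0 _ _)).
  - by rewrite inE /= in_itv/=; apply/andP; split; lra.
split.
  have -> : (fun y => complex.Re (cEuler (x +i* (d * y)))) =
      (fun y => \int[leb]_v (gumbel x v * cos (d * y * v))).
    apply/funext => y; rewrite cEulerE//.
    transitivity (\int[leb]_v complex.Re (euler_kernel (x +i* (d * y)) v)) => //.
    by apply: eq_Rintegral => v _; rewrite Re_euler_kernel.
  by apply: key; [exact: continuous_cos|exact: cos_max].
have -> : (fun y => complex.Im (cEuler (x +i* (d * y)))) =
    (fun y => \int[leb]_v (gumbel x v * sin (d * y * v))).
  apply/funext => y; rewrite cEulerE//.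
  transitivity (\int[leb]_v complex.Im (euler_kernel (x +i* (d * y)) v)) => //.
  by apply: eq_Rintegral => v _; rewrite Im_euler_kernel.
by apply: key; [exact: continuous_sin|exact: sin_max].
Qed.

End euler_integral.

(** * Alternating Taylor remainders *)

Section taylor_remainders.
Variable R : realType.
Implicit Types (x z : R) (n k : nat).

Lemma antiderivative_ge0 (f f' : R -> R) x : antiderivative f f' -> f 0 = 0 ->
  (forall z, 0 <= z -> 0 <= f' z) -> 0 <= x -> 0 <= f x.
Proof.
move=> df f0 f'0 x0.
have [||c + e] := @MVT_segment _ f f' 0 x x0.
- by move=> z _; exact: df.
- by apply: continuous_subspaceT; exact: derive_continuous df.
by rewrite f0 !subr0 in e; rewrite in_itv/= => /andP[c0 _]; rewrite e mulr_ge0// f'0.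
Qed.

(** The sign is that of the first omitted term. With it the remainders of sine and
    cosine are successive antiderivatives of each other, as are those of e^(-x), so
    that by induction they are non-negative for x >= 0, from order 1 on. *)
Definition cos_rem n x : R :=
  (-1) ^+ n * (cos x - \sum_(0 <= k < n) (-1) ^+ k * (x ^+ (2 * k) / ((2 * k)`!)%:R)).

Definition sin_rem n x : R :=
  (-1) ^+ n * (sin x - \sum_(0 <= k < n) (-1) ^+ k * (x ^+ (2 * k).+1 / ((2 * k).+1`!)%:R)).

Definition exp_rem n x : R :=
  (-1) ^+ n * (expR (- x) - \sum_(0 <= k < n) (-1) ^+ k * (x ^+ k / (k`!)%:R)).

Let dmono n x : is_derive x 1 (fun x => x ^+ n.+1 / (n.+1`!)%:R) (x ^+ n / (n`!)%:R).
Proof.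
apply: is_derive_eq (dM (dX n (did x)) (dconst _ x)) _.
by rewrite mulr0 add0r mulr1 factS natrM invfM mulrACA mulVf ?pnatr_eq0// mul1r mulrC.
Qed.

Let alternate n (c S t : R) :
  (-1) * (-1) ^+ n * (c - (S + (-1) ^+ n * t)) = t - (-1) ^+ n * (c - S).
Proof.
transitivity (((-1) ^+ n) ^+ 2 * t - (-1) ^+ n * (c - S)); first by ring.
by rewrite sqrr_sign mul1r.
Qed.

Lemma cos_remS n x : cos_rem n.+1 x = x ^+ (2 * n) / ((2 * n)`!)%:R - cos_rem n x.
Proof.
by rewrite /cos_rem big_nat_recr//= exprS alternate.
Qed.

Lemma sin_remS n x :
  sin_rem n.+1 x = x ^+ (2 * n).+1 / ((2 * n).+1`!)%:R - sin_rem n x.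
Proof.
by rewrite /sin_rem big_nat_recr//= exprS alternate.
Qed.

Lemma exp_remS n x : exp_rem n.+1 x = x ^+ n / (n`!)%:R - exp_rem n x.
Proof.
by rewrite /exp_rem big_nat_recr//= exprS alternate.
Qed.

Lemma sin_remN n x : sin_rem n (- x) = - sin_rem n x.
Proof.
elim: n => [|n IH]; first by rewrite /sin_rem !big_nil expr0 !mul1r !subr0 sinN.
by rewrite !sin_remS IH exprNn -signr_odd/= mul2n odd_double expr1 mulN1r mulNr opprD.
Qed.

Lemma cos_remN n x : cos_rem n (- x) = cos_rem n x.
Proof.
elim: n => [|n IH]; first by rewrite /cos_rem !big_nil expr0 !mul1r !subr0 cosN.
by rewrite !cos_remS IH exprNn -signr_odd mul2n odd_double expr0 mul1r.
Qed.

Lemma cos_rem0 n : cos_rem n.+1 0 = 0.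
Proof.
elim: n => [|n IH].
  by rewrite cos_remS /cos_rem big_nil cos0 muln0 expr0 fact0 invr1; ring.
by rewrite cos_remS IH mulnS expr0n/= mul0r subr0.
Qed.

Lemma sin_rem0 n : sin_rem n 0 = 0.
Proof.
elim: n => [|n IH]; first by rewrite /sin_rem big_nil sin0; ring.
by rewrite sin_remS IH expr0n/= mul0r subr0.
Qed.

Lemma exp_rem0 n : exp_rem n.+1 0 = 0.
Proof.
elim: n => [|n IH].
  by rewrite exp_remS /exp_rem big_nil oppr0 expR0 expr0 fact0 invr1; ring.
by rewrite exp_remS IH expr0n/= mul0r subr0.
Qed.

Lemma dsin_rem n : antiderivative (sin_rem n) (cos_rem n).
Proof.
move=> x; elim: n => [|n IH].
  rewrite (_ : sin_rem 0 = sin); last first.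
    by apply/funext => y; rewrite /sin_rem big_nil expr0 mul1r subr0.
  by rewrite /cos_rem big_nil expr0 mul1r subr0; exact: is_derive_sin.
rewrite cos_remS; rewrite (funext (sin_remS n)).
exact: dB (dmono (2 * n) x) IH.
Qed.

Lemma dcos_rem n : antiderivative (cos_rem n.+1) (sin_rem n).
Proof.
move=> x; elim: n => [|n IH].
  rewrite (_ : cos_rem 1 = fun y => 1 - cos y); last first.
    by apply/funext => y; rewrite cos_remS /cos_rem big_nil fact0 muln0; field.
  apply: is_derive_eq (dB (dconst 1 x) (is_derive_cos x)) _.
  by rewrite /sin_rem big_nil; ring.
rewrite sin_remS; rewrite (funext (cos_remS n.+1)).
have := dmono (2 * n).+1 x; rewrite -[(2 * n).+2]/(2 + 2 * n)%N -mulnS => h.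
exact: dB h IH.
Qed.

Lemma dexp_rem n : antiderivative (exp_rem n.+1) (exp_rem n).
Proof.
move=> x; elim: n => [|n IH].
  rewrite (_ : exp_rem 1 = fun y => 1 - expR (- y)); last first.
    by apply/funext => y; rewrite exp_remS /exp_rem big_nil fact0; field.
  apply: is_derive_eq (dB (dconst 1 x) (dexp (dN (did x)))) _.
  by rewrite /exp_rem big_nil; ring.
rewrite exp_remS (funext (exp_remS n.+1)).
exact: dB (dmono n x) IH.
Qed.

Lemma exp_rem_ge0 n x : 0 <= x -> 0 <= exp_rem n x.
Proof.
elim: n x => [|n IH] x x0.
  by rewrite /exp_rem big_nil expr0 mul1r subr0 expR_ge0.
exact: antiderivative_ge0 (dexp_rem n) (exp_rem0 n) IH x0.
Qed.

Let cs_rem_ge0 n x : 0 <= x -> 0 <= cos_rem n.+1 x /\ 0 <= sin_rem n.+1 x.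
Proof.
elim: n x => [|n IH] x x0.
  have c x' : 0 <= cos_rem 1 x'.
    rewrite cos_remS muln0 expr0 fact0 divr1 /cos_rem big_nil expr0 mul1r subr0.
    by rewrite subr_ge0 cos_le1.
  split => //; apply: antiderivative_ge0 (dsin_rem 1) (sin_rem0 1) _ x0 => z _.
  exact: c.
have c x' : 0 <= x' -> 0 <= cos_rem n.+2 x'.
  apply: antiderivative_ge0 (dcos_rem n.+1) (cos_rem0 n.+1) _ => z z0.
  exact: (IH z z0).2.
split; first exact: c.
exact: antiderivative_ge0 (dsin_rem n.+2) (sin_rem0 n.+2) c x0.
Qed.

Lemma cos_rem_ge0 n x : 0 <= cos_rem n.+1 x.
Proof.
have [/(cs_rem_ge0 n)[]//|x0] := leP 0 x.
by rewrite -cos_remN; case: (@cs_rem_ge0 n (- x)) => //; rewrite oppr_ge0 ltW.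
Qed.

Lemma cos_rem_le n x : cos_rem n x <= x ^+ (2 * n) / ((2 * n)`!)%:R.
Proof. by rewrite -subr_ge0 -cos_remS cos_rem_ge0. Qed.

Lemma norm_sin_rem_le n x :
  `|sin_rem n.+1 x| <= `|x| ^+ (2 * n).+3 / ((2 * n).+3`!)%:R.
Proof.
wlog x0 : x / 0 <= x.
  have [x0|x0] := leP 0 x; first exact.
  move=> /(_ (- x)); rewrite sin_remN !normrN; apply.
  by rewrite oppr_ge0 ltW.
have [_ s1] := cs_rem_ge0 n x0; have [_ s2] := cs_rem_ge0 n.+1 x0.
by rewrite !ger0_norm// -subr_ge0; move: s2; rewrite sin_remS mulnS.
Qed.

Lemma cos_ge x : 1 - x ^+ 2 / 2 <= cos x.
Proof.
suff -> : cos x = 1 - x ^+ 2 / 2 + cos_rem 2 x by rewrite lerDl cos_rem_ge0.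
rewrite 2!cos_remS /cos_rem big_nil muln0 muln1 fact0 (_ : 2`! = 2)%N//.
by field.
Qed.

End taylor_remainders.

(** * Exponential decay of Euler's integral along vertical lines *)

Section concentration.
Variable R : realType.
Notation leb := (@lebesgue_measure R).

(** For w = v - ln X the mean of the right-hand side under the weight gumbel X is
    explicit, by the functional equation, while that of w^2 is not. *)
Lemma sqr_le_expR (w : R) : w ^+ 2 <= 4 * (expR w + expR (- w) - 2).
Proof.
wlog w0 : w / 0 <= w.
  have [w0|w0] := leP 0 w; first exact.
  move=> /(_ (- w)); rewrite sqrrN opprK [expR (- w) + _]addrC; apply.
  by rewrite oppr_ge0 ltW.
(* the right-hand side is 4 (e^(w/2) - e^(-w/2))^2 *)
have h1 := expR_ge1Dx (w / 2).
have h2 : expR (- (w / 2)) <= 1 by rewrite -[leRHS]expR0 ler_expR; lra.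
have e1 : expR w = expR (w / 2) ^+ 2 by rewrite -expRM_natl; congr expR; field.
have e2 : expR (- w) = expR (- (w / 2)) ^+ 2.
  by rewrite -expRM_natl; congr expR; field.
have e12 : expR (w / 2) * expR (- (w / 2)) = 1 by rewrite -expRD subrr expR0.
have -> : 4 * (expR w + expR (- w) - 2) =
    (2 * (expR (w / 2) - expR (- (w / 2)))) ^+ 2.
  by rewrite e1 e2; lra.
by rewrite ler_pXn2r// ?nnegrE; lra.
Qed.

(** For large X the law with density proportional to t^(X-1) e^(-t) concentrates
    around X in logarithmic scale, so multiplying the density by t^(iy) changes the
    modulus of the integral only by a factor close to 1. *)
Lemma nrm_cEuler_ge (X y : R) : 1 < X ->
  (1 - 2 * y ^+ 2 / (X - 1)) * Gamma X <= nrm (cEuler (X +i* y)).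
Proof.
move=> X1; have X0 : 0 < X by lra.
have X10 : 0 < X - 1 by lra.
have X2 : 0 < X + 1 by lra.
have ik := @cintegrable_euler_kernel R (X +i* y) X0.
pose u : R[i] := cexp (0 +i* (- (y * ln X))).
have nu : nrm u = 1 by rewrite nrm_cexp /= expR0.
have -> : nrm (cEuler (X +i* y)) = nrm (u * cEuler (X +i* y)).
  by rewrite nrmM nu mul1r.
apply: le_trans (le_trans (ler_norm _) (normRe_le _)).
rewrite cEulerE// -cintegralZ//.
have ReE v : complex.Re (u * euler_kernel (X +i* y) v) =
    gumbel X v * cos (y * (v - ln X)).
  rewrite ReM Re_euler_kernel Im_euler_kernel /= expR0 sinN cosN !mul1r.
  by rewrite mulrBr cosB; ring.
have [iR _] := cintegrableZ u ik.
have GX : Gamma X = (X - 1) * Gamma (X - 1) by rewrite -(GammaS X10) subrK.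
have GX1 := GammaS X0.
pose h v := (1 + 4 * y ^+ 2) * gumbel X v +
  ((- (2 * y ^+ 2 / X)) * gumbel (X + 1) v + (- (2 * y ^+ 2 * X)) * gumbel (X - 1) v).
have i1 := rintegrableZ (1 + 4 * y ^+ 2) (rintegrable_gumbel X0).
have i2 := rintegrableZ (- (2 * y ^+ 2 / X)) (rintegrable_gumbel X2).
have i3 := rintegrableZ (- (2 * y ^+ 2 * X)) (rintegrable_gumbel X10).
have i23 := rintegrableD i2 i3.
have ih : rintegrable leb h by exact: rintegrableD i1 i23.
have hG : (1 - 2 * y ^+ 2 / (X - 1)) * Gamma X = \int[leb]_v h v.
  rewrite (RintegralD _ i1 i23)// (RintegralD _ i2 i3)//.
  rewrite (RintegralZl _ _ (rintegrable_gumbel X0))//.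
  rewrite (RintegralZl _ _ (rintegrable_gumbel X2))//.
  rewrite (RintegralZl _ _ (rintegrable_gumbel X10))//.
  rewrite -(GammaE X0) -(GammaE X2) -(GammaE X10) GX1 GX; field.
  by rewrite (gt_eqF X0) (gt_eqF X10).
rewrite hG; apply: le_Rintegral => // v _.
rewrite ReE /h.
have -> : gumbel (X + 1) v = gumbel X v * (X * expR (v - ln X)).
  by rewrite gumbelS expRD expRN lnK//; field; rewrite (gt_eqF X0).
have -> : gumbel (X - 1) v = gumbel X v * (X^-1 * expR (- (v - ln X))).
  rewrite gumbelM mulN1r; congr (_ * _).
  by rewrite opprB expRD lnK// mulKf// gt_eqF.
have := cos_ge (y * (v - ln X)); have := sqr_le_expR (v - ln X).
set w := v - ln X; set E1 := expR w; set E2 := expR (- w) => h1 h2.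
have h3 : 1 - 2 * y ^+ 2 * (E1 + E2 - 2) <= cos (y * w).
  apply: le_trans h2; rewrite lerD2l lerN2 exprMn.
  have : y ^+ 2 * w ^+ 2 <= y ^+ 2 * (4 * (E1 + E2 - 2)).
    by rewrite ler_wpM2l// sqr_ge0.
  by lra.
have g0 := gumbel_gt0 X v.
rewrite [leLHS](_ : _ = gumbel X v * (1 - 2 * y ^+ 2 * (E1 + E2 - 2))).
  by rewrite ler_pM2l.
by field; rewrite gt_eqF.
Qed.

End concentration.

Section vertical_decay.
Variable R : realType.
Implicit Types (x y v : R).

(** The square makes the functional equation rational in x and y; the division by
    Gamma x keeps the quantity bounded by 1 and, for x large, near 1. *)
Definition gamma_modulus x y : R := (nrm (cEuler (x +i* y)) / Gamma x) ^+ 2.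

Lemma gamma_modulus_ge0 x y : 0 <= gamma_modulus x y.
Proof. exact: sqr_ge0. Qed.

Lemma gamma_modulus_le1 x y : 0 < x -> gamma_modulus x y <= 1.
Proof.
move=> x0; have G0 := Gamma_gt0 x0; rewrite expr_le1//.
  by rewrite ler_pdivrMr// mul1r; exact: (@nrm_cEuler_le R (x +i* y) x0).
by rewrite divr_ge0 ?nrm_ge0// ltW.
Qed.

Lemma gamma_modulusS x y : 0 < x ->
  gamma_modulus (x + 1) y = gamma_modulus x y * (1 + (y / x) ^+ 2).
Proof.
move=> x0; have G0 := Gamma_gt0 x0; rewrite /gamma_modulus (GammaS x0).
have -> : (x + 1) +i* y = (x +i* y) + 1 :> R[i].
  by apply/eqP; rewrite eq_complex ReD ImD /= addr0 !eqxx.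
rewrite (@cEulerS _ (x +i* y) x0) nrmM !exprMn !exprVn exprMn (@sqr_nrm _ (x +i* y)) /=.
by field; rewrite (gt_eqF x0) (gt_eqF G0).
Qed.

(** An antiderivative in v of the logarithm of 1 + (y/v)^2: by telescoping it
    replaces the infinite product expansion of the Gamma modulus. *)
Definition log_product y v : R := v * ln (1 + (y / v) ^+ 2) - 2 * y * atan (y / v).

Lemma dlog_product y v : 0 < v ->
  is_derive v 1 (log_product y) (ln (1 + (y / v) ^+ 2)).
Proof.
move=> v0; have v0' : v != 0 by rewrite gt_eqF.
have p0 : 0 < 1 + (y / v) ^+ 2 by rewrite ltr_pwDl// sqr_ge0.
have dq := dM (dconst y v) (dV v0' (did v)).
have dl := @dln _ (fun v => 1 + (y / v) ^+ 2) _ _ p0 (dD (dconst 1 v) (dX 1 dq)).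
have da := @datan _ (fun v => y / v) _ _ dq.
apply: is_derive_eq (dB (dM (did v) dl) (dZ (2 * y) da)) _.
rewrite expr1 mulr0 addr0; field.
rewrite v0' /=; have : v ^+ 2 + y ^+ 2 != 0.
  by rewrite gt_eqF// ltr_pwDl ?exprn_gt0// sqr_ge0.
by rewrite ?[y ^+ 2 + _]addrC => ->.
Qed.

Lemma log_productS y v : 0 <= y -> 0 < v ->
  ln (1 + (y / (v + 1)) ^+ 2) <= log_product y (v + 1) - log_product y v
    <= ln (1 + (y / v) ^+ 2).
Proof.
move=> y0 v0; have vv : v < v + 1 by rewrite ltrDl.
have [||c] := @MVT _ (log_product y) (fun v => ln (1 + (y / v) ^+ 2)) v (v + 1) vv.
- by move=> u; rewrite in_itv/= => /andP[u0 _]; apply: dlog_product; lra.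
- apply: derivable_within_continuous => u; rewrite in_itv/= => /andP[u0 _].
  by have [] := @dlog_product y u (lt_le_trans v0 u0).
rewrite in_itv/= => /andP[c0 c1] ->; rewrite addrAC subrr add0r mulr1.
have c00 : 0 < c by lra.
have le u w : 0 < u -> u <= w -> ln (1 + (y / w) ^+ 2) <= ln (1 + (y / u) ^+ 2).
  move=> u0 uw; have w0 := lt_le_trans u0 uw.
  rewrite ler_ln ?posrE ?ltr_pwDl ?sqr_ge0// lerD2l.
  rewrite ler_pXn2r// ?nnegrE ?divr_ge0 ?(ltW u0) ?(ltW w0)//.
  by rewrite ler_wpM2l// lef_pV2.
by apply/andP; split; apply: le => //; lra.
Qed.

Let expR_ln_factor y v : expR (ln (1 + (y / v) ^+ 2)) = 1 + (y / v) ^+ 2.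
Proof. by rewrite lnK// posrE ltr_pwDl// sqr_ge0. Qed.

(** Between v and v + 1 the function log_product increases by at least the logarithm
    of the factor at v + 1 and at most that of the factor at v: correcting the modulus
    by it gives a sequence that increases along x + n, and one more factor turns it
    into a sequence that decreases. *)
Lemma gamma_modulus_upper_step x y n : 0 <= y -> 0 < x ->
  gamma_modulus x y * expR (- log_product y x) <=
  gamma_modulus (x + n%:R) y * expR (- log_product y (x + n%:R)).
Proof.
move=> y0 x0; elim: n => [|n IH]; first by rewrite addr0.
apply: le_trans IH _; have xn : 0 < x + n%:R by rewrite ltr_pwDl.
rewrite -natr1 addrA gamma_modulusS//.
move: (gamma_modulus _ y) (gamma_modulus_ge0 (x + n%:R) y) => g g0.
rewrite -mulrA ler_wpM2l//.
rewrite -expR_ln_factor -expRD ler_expR.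
by have /andP[_] := log_productS y0 xn; lra.
Qed.

Lemma gamma_modulus_lower_step x y n : 0 <= y -> 0 < x ->
  gamma_modulus (x + n%:R) y * (1 + (y / (x + n%:R)) ^+ 2) *
    expR (- log_product y (x + n%:R)) <=
  gamma_modulus x y * (1 + (y / x) ^+ 2) * expR (- log_product y x).
Proof.
move=> y0 x0; elim: n => [|n IH]; first by rewrite addr0.
apply: le_trans IH; have xn : 0 < x + n%:R by rewrite ltr_pwDl.
rewrite -natr1 addrA gamma_modulusS//.
move: (gamma_modulus _ y) (gamma_modulus_ge0 (x + n%:R) y) => g g0.
rewrite -!mulrA ler_wpM2l//.
rewrite ler_wpM2l ?addr_ge0 ?sqr_ge0//.
rewrite -expR_ln_factor -expRD ler_expR.
by have /andP[+ _] := log_productS y0 xn; lra.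
Qed.

Lemma atan_le y : 0 <= y -> atan y <= y.
Proof.
move=> y0; rewrite -subr_ge0.
apply: (@antiderivative_ge0 _ (fun z => z - atan z) (fun z => 1 - (1 + z ^+ 2)^-1)) => //.
- by move=> z; exact: dB (did z) (is_derive1_atan z).
- by rewrite atan0 subr0.
- by move=> z _; rewrite subr_ge0 invf_le1 ?lerDl ?sqr_ge0// ltr_pwDl// sqr_ge0.
Qed.

Lemma atan_ge0 y : 0 <= y -> 0 <= atan y.
Proof. by move=> y0; rewrite -(atan0 R); exact: le_atan. Qed.

(** After about y^2 unit steps the correction is at most e, and the modulus is at
    most 1. *)
Lemma gamma_modulus_upper x y : 0 <= y -> 0 < x ->
  gamma_modulus x y <= expR (log_product y x + 1).
Proof.
move=> y0 x0; pose n := (Num.truncn (2 * y ^+ 2)).+1.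
have h := gamma_modulus_upper_step n y0 x0.
have xn : 0 < x + n%:R by rewrite ltr_pwDl.
suff h2 : gamma_modulus x y * expR (- log_product y x) <= expR 1.
  rewrite [_ + 1]addrC expRD.
  by move: h2; rewrite expRN ler_pdivrMr ?expR_gt0.
apply: le_trans h _; rewrite -[leRHS]mul1r.
apply: ler_pM => //; rewrite ?gamma_modulus_ge0 ?expR_ge0 ?gamma_modulus_le1//.
rewrite ler_expR /log_product opprB.
have l0 : 0 <= (x + n%:R) * ln (1 + (y / (x + n%:R)) ^+ 2).
  by rewrite mulr_ge0 ?(ltW xn)// ln_ge0// lerDl sqr_ge0.
have q0 : 0 <= y / (x + n%:R) by rewrite divr_ge0// ltW.
have : 2 * y * atan (y / (x + n%:R)) <= 2 * y * (y / (x + n%:R)).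
  by rewrite ler_wpM2l ?mulr_ge0// atan_le.
have : 2 * y * (y / (x + n%:R)) <= 1.
  rewrite mulrA ler_pdivrMr// mul1r -mulrA -expr2.
  apply: (@le_trans _ _ n%:R); last by rewrite lerDr ltW.
  by rewrite ltW// truncnS_gt.
lra.
Qed.

(** After about y^2 unit steps concentration bounds the modulus from below; the
    arctangent in log_product is at most pi/2, whence the rate pi for the square. *)
Lemma gamma_modulus_lower x y : 0 <= y -> 0 < x ->
  expR (- pi * y - 1) / 4 <= gamma_modulus x y * (1 + (y / x) ^+ 2).
Proof.
move=> y0 x0.
(* large enough for 2 y^2 / (x + n - 1) <= 1/2 *)
pose n := (Num.truncn (1 + 4 * y ^+ 2)).+1.
have nn : 1 + 4 * y ^+ 2 < n%:R by exact: truncnS_gt.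
have yy := sqr_ge0 y.
have xn1 : 1 < x + n%:R by lra.
have xn : 0 < x + n%:R by lra.
have G0 := Gamma_gt0 xn.
have S4 : 4^-1 <= gamma_modulus (x + n%:R) y.
  have := nrm_cEuler_ge y xn1; rewrite -ler_pdivlMr// => c.
  have c2 : 2^-1 <= 1 - 2 * y ^+ 2 / (x + n%:R - 1).
    have : 2 * y ^+ 2 / (x + n%:R - 1) <= 2^-1.
      by rewrite ler_pdivrMr; lra.
    lra.
  have -> : (4^-1 : R) = 2^-1 ^+ 2 by field.
  rewrite ler_pXn2r ?nnegrE//; first exact: le_trans c2 c.
  by rewrite divr_ge0 ?nrm_ge0// ltW.
have L1 : - 1 <= - log_product y (x + n%:R).
  have q0 : 0 <= y / (x + n%:R) by rewrite divr_ge0// ltW.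
  rewrite lerN2 /log_product.
  have a0 : 0 <= 2 * y * atan (y / (x + n%:R)) by rewrite !mulr_ge0 ?atan_ge0.
  suff : (x + n%:R) * ln (1 + (y / (x + n%:R)) ^+ 2) <= 1 by lra.
  apply: (@le_trans _ _ ((x + n%:R) * (y / (x + n%:R)) ^+ 2)).
    rewrite ler_wpM2l ?(ltW xn)// -[leRHS]expRK ler_ln ?posrE ?expR_gt0//.
      exact: expR_ge1Dx.
    by rewrite ltr_pwDl// sqr_ge0.
  rewrite [leLHS](_ : _ = y ^+ 2 / (x + n%:R)); last by field; rewrite gt_eqF.
  by rewrite ler_pdivrMr//; lra.
have Lx : - log_product y x <= pi * y.
  rewrite /log_product opprB.
  have l0 : 0 <= x * ln (1 + (y / x) ^+ 2).
    by rewrite mulr_ge0 ?(ltW x0)// ln_ge0// lerDl sqr_ge0.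
  have : 2 * y * atan (y / x) <= 2 * y * (pi / 2).
    by rewrite ler_wpM2l ?mulr_ge0// ltW// atan_ltpi2.
  lra.
have h2 : 4^-1 * expR (- 1) <=
    gamma_modulus x y * (1 + (y / x) ^+ 2) * expR (pi * y).
  apply: (@le_trans _ _ (gamma_modulus x y * (1 + (y / x) ^+ 2) *
      expR (- log_product y x))); last first.
    by rewrite ler_wpM2l ?ler_expR// mulr_ge0 ?gamma_modulus_ge0 ?addr_ge0 ?sqr_ge0.
  apply: le_trans (gamma_modulus_lower_step n y0 x0).
  apply: ler_pM; rewrite ?expR_ge0 ?ler_expR//.
  apply: le_trans S4 _; rewrite ler_peMr ?gamma_modulus_ge0//.
  by rewrite lerDl sqr_ge0.
by rewrite expRD mulNr expRN [leLHS]mulrAC -mulrA mulrC ler_pdivrMr ?expR_gt0.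
Qed.

End vertical_decay.

Section exponential_type.
Variable R : realType.
Notation leb := (@lebesgue_measure R).
Implicit Types (f g : R -> R) (k x y : R).

(** Exponential type at most k on the real line, up to an arbitrarily small loss:
    polynomial factors, whose exponents would have to be tracked through products,
    are absorbed. *)
Definition exp_type f k := forall e, 0 < e ->
  exists2 C, 0 < C & forall y, f y <= C * expR ((k + e) * `|y|).

Lemma exp_type_le f g k : exp_type g k -> (forall y, f y <= g y) -> exp_type f k.
Proof.
move=> gk fg e /gk[C C0 gC]; exists C => // y; exact: le_trans (fg y) (gC y).
Qed.

Lemma exp_type_cst (c : R) : exp_type (fun=> c) 0.
Proof.
move=> e e0; exists (`|c| + 1); first by rewrite ltr_wpDl.
move=> y; apply: le_trans (ler_norm _) _.
apply: le_trans (_ : `|c| <= `|c| + 1) _; first by rewrite lerDl.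
by rewrite ler_peMr// -[leLHS]expR0 ler_expR add0r mulr_ge0// ltW.
Qed.

Lemma exp_typeM f g k k' : (forall y, 0 <= f y) -> (forall y, 0 <= g y) ->
  exp_type f k -> exp_type g k' -> exp_type (fun y => f y * g y) (k + k').
Proof.
move=> f0 g0 fk gk e e0; have e20 : 0 < e / 2 by rewrite divr_gt0.
have [C C0 fC] := fk _ e20; have [D D0 gD] := gk _ e20.
exists (C * D); first exact: mulr_gt0.
move=> y; apply: le_trans (ler_pM (f0 y) (g0 y) (fC y) (gD y)) _.
rewrite mulrACA -expRD ler_wpM2l ?mulr_ge0 ?(ltW C0) ?(ltW D0)// ler_expR.
by rewrite -mulrDl ler_wpM2r//; lra.
Qed.

Lemma exp_type_prod (n : nat) (F : 'I_n -> R -> R) (k : 'I_n -> R) :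
  (forall i y, 0 <= F i y) -> (forall i, exp_type (F i) (k i)) ->
  exp_type (fun y => \prod_(i < n) F i y) (\sum_(i < n) k i).
Proof.
elim: n F k => [|n IH] F k F0 Fk.
  rewrite big_ord0; apply: exp_type_le (exp_type_cst 1) _ => y.
  by rewrite big_ord0.
rewrite big_ord_recl; under [X in exp_type X _]funext do rewrite big_ord_recl.
apply: exp_typeM => //.
  by move=> y; apply: prodr_ge0 => i _.
by apply: IH.
Qed.

Lemma exp_type_prod0 (n : nat) (F : 'I_n -> R -> R) :
  (forall i y, 0 <= F i y) -> (forall i, exp_type (F i) 0) ->
  exp_type (fun y => \prod_(i < n) F i y) 0.
Proof. by move=> F0 Fk; have := exp_type_prod F0 Fk; rewrite big1. Qed.

Lemma exp_type_sqr f k : (forall y, 0 <= f y) ->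
  exp_type (fun y => f y ^+ 2) (2 * k) -> exp_type f k.
Proof.
move=> f0 fk e e0; have [C C0 fC] := fk (2 * e) (mulr_gt0 (ltr0Sn _ 1) e0).
exists (Num.sqrt C); first by rewrite sqrtr_gt0.
move=> y; rewrite -(@ler_pXn2r _ 2)// ?nnegrE ?mulr_ge0 ?sqrtr_ge0 ?expR_ge0//.
apply: le_trans (fC y) _; rewrite exprMn sqr_sqrtr ?(ltW C0)// -expRM_natl.
by rewrite -mulrDr mulrA.
Qed.

Lemma exp_type_scale f k (d : R) : d != 0 ->
  exp_type f k -> exp_type (fun y => f (d * y)) (k * `|d|).
Proof.
move=> d0 fk e e0; have d0' : 0 < `|d| by rewrite normr_gt0.
have [C C0 fC] := fk _ (divr_gt0 e0 d0').
exists C => // y; apply: le_trans (fC _) _.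
rewrite normrM mulrA mulrDl divfK// gt_eqF//.
Qed.

Lemma exp_type_quad (a b : R) : 0 <= b -> exp_type (fun y => a + b * y ^+ 2) 0.
Proof.
move=> b0 e e0.
have B0 : 0 <= 2 * b / e ^+ 2 by rewrite divr_ge0 ?sqr_ge0 ?mulr_ge0.
exists (`|a| + 1 + 2 * b / e ^+ 2); first by apply: ltr_pwDl => //; rewrite ltr_wpDl.
move=> y; rewrite add0r; set u := e * `|y|.
have u0 : 0 <= u by rewrite mulr_ge0// ltW.
have h := expR_ge1Dxn 1 u0.
have -> : b * y ^+ 2 = 2 * b / e ^+ 2 * (u ^+ 2 / 2).
  by rewrite /u exprMn real_normK ?num_real//; field; rewrite gt_eqF.
have h1 : 2 * b / e ^+ 2 * (u ^+ 2 / 2) <= 2 * b / e ^+ 2 * expR u.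
  rewrite ler_wpM2l//; apply: le_trans h.
  by rewrite (_ : 2`! = 2)%N// lerDr.
have h2 : a <= (`|a| + 1) * expR u.
  apply: le_trans (ler_norm _) _; apply: le_trans (_ : `|a| <= `|a| + 1) _.
    by rewrite lerDl.
  by rewrite ler_peMr ?addr_ge0// -[leLHS]expR0 ler_expR.
by rewrite [leRHS]mulrDl; apply: lerD.
Qed.

Lemma rintegrable_exp_type f k : k < 0 -> measurable_fun setT f ->
  (forall y, 0 <= f y) -> exp_type f k -> rintegrable leb f.
Proof.
move=> k0 mf f0 fk; have e0 : 0 < - k / 2 by lra.
have [C C0 fC] := fk _ e0.
apply: rintegrable_le (rintegrableZ C (rintegrable_expRNabs e0)) _ => [|y].
  exact: mf.
rewrite ger0_norm//; apply: le_trans (fC y) _.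
by rewrite ler_wpM2l ?(ltW C0)// ler_expR -mulNr ler_wpM2r//; lra.
Qed.

Lemma rintegrable_nrm_exp_type (G : R -> R[i]) (k : R) : k < 0 ->
  cmeasurable G -> exp_type (fun y => nrm (G y)) k ->
  rintegrable leb (fun y => nrm (G y)).
Proof.
move=> k0 [mR mI] Gk; apply: (@rintegrable_exp_type _ k) => //.
  under eq_fun do rewrite nrmE.
  apply: measurableT_comp; first by apply: continuous_measurable_fun; exact: sqrt_continuous.
  by apply: measurable_funD; exact: measurable_funX.
by move=> y; exact: nrm_ge0.
Qed.

Lemma nrm_cEuler_neg x y : 0 < x ->
  nrm (cEuler (x +i* (- y))) = nrm (cEuler (x +i* y)).
Proof.
move=> x0; rewrite !nrmE !cEulerE//; congr Num.sqrt; congr (_ + _).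
  congr (_ ^+ 2); apply: eq_Rintegral => v _.
  by rewrite !Re_euler_kernel /= mulNr cosN.
have [_ iI] := @cintegrable_euler_kernel R (x +i* y) x0.
rewrite -[RHS]sqrrN -mulN1r; congr (_ ^+ 2).
rewrite -[X in -1 * X]/(\int[leb]_v complex.Im (euler_kernel (x +i* y) v)).
rewrite -RintegralZl//; apply: eq_Rintegral => v _.
by rewrite !Im_euler_kernel /= mulNr sinN mulrN mulN1r.
Qed.

Lemma nrm_cEuler_abs x y : 0 < x ->
  nrm (cEuler (x +i* y)) = nrm (cEuler (x +i* `|y|)).
Proof.
move=> x0; have [y0|y0] := leP 0 y; first by rewrite (ger0_norm y0).
by rewrite (ltr0_norm y0) (nrm_cEuler_neg y x0).
Qed.

Lemma cEuler_neq0 x y : 0 < x -> cEuler (x +i* y) != 0.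
Proof.
move=> x0; rewrite -nrm_eq0 nrm_cEuler_abs//.
have := gamma_modulus_lower (normr_ge0 y) x0.
apply: contraTneq => n0; rewrite /gamma_modulus n0 mul0r expr0n/= mul0r -ltNge.
by rewrite divr_gt0 ?expR_gt0.
Qed.

(** Stirling's formula up to sub-exponential factors, from above and below. *)
Lemma exp_type_cEuler x : 0 < x ->
  exp_type (fun y => nrm (cEuler (x +i* y))) (- pi / 2).
Proof.
move=> x0; have G0 := Gamma_gt0 x0.
have S k : exp_type (gamma_modulus x) (2 * k) ->
    exp_type (fun y => nrm (cEuler (x +i* y))) k.
  move=> h; have -> : (fun y => nrm (cEuler (x +i* y))) =
      (fun y => Gamma x * (nrm (cEuler (x +i* y)) / Gamma x)).
    by apply/funext => y; rewrite mulrCA divff ?gt_eqF// mulr1.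
  rewrite -[k]add0r; apply: exp_typeM.
  - by move=> _; exact: ltW.
  - by move=> y; rewrite divr_ge0 ?nrm_ge0 ?ltW.
  - exact: exp_type_cst.
  - by apply: exp_type_sqr h => y; rewrite divr_ge0 ?nrm_ge0 ?ltW.
apply: S => e e0; pose d := e / (2 * x).
have d0 : 0 < d by rewrite divr_gt0// mulr_gt0.
(* (1 + (y/x)^2)^x grows subexponentially *)
have [C C0 qC] := exp_type_quad 1 (sqr_ge0 x^-1) d0.
(* the arctangent is close to pi/2 far away *)
have [Y [Y0 atY]] : exists Y : R, 0 <= Y /\
    forall y, Y <= y -> pi / 2 - e / 4 <= atan (y / x).
  have e4 : 0 < e / 4 by rewrite divr_gt0.
  have /(_ _ _)/= [] := (@cvgr_ge R _ _ _ _ _ (@cvgy_atan R) (pi / 2 - e / 4)).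
    by rewrite ltrBlDr ltrDl.
  move=> M [_ hM]; exists (x * (`|M| + 1)); split.
    by rewrite mulr_ge0 ?addr_ge0 ?(ltW x0).
  move=> y yM; apply: hM; rewrite ltr_pdivlMr// mulrC.
  apply: lt_le_trans yM; rewrite ltr_pM2l//.
  by have := ler_norm M; lra.
have C1 : 1 <= C.
  have := qC 0; rewrite expr0n/= mulr0 addr0 normr0 mulr0 expR0 mulr1.
  by [].
exists (expR 1 * expR (x * ln C) * expR (pi * Y)).
  by rewrite !mulr_gt0 ?expR_gt0.
move=> y; have -> : gamma_modulus x y = gamma_modulus x `|y|.
  by rewrite /gamma_modulus nrm_cEuler_abs.
move: `|y| (normr_ge0 y) => {}y y0.
rewrite -!expRD; have lC : 0 <= ln C by rewrite ln_ge0.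
have [yY|yY] := leP Y y.
  apply: le_trans (gamma_modulus_upper y0 x0) _; rewrite ler_expR /log_product.
  have lq : ln (1 + (y / x) ^+ 2) <= ln C + d * y.
    rewrite -[d * y]expRK -lnM ?posrE ?expR_gt0//.
    rewrite ler_ln ?posrE ?mulr_gt0 ?expR_gt0//; last first.
      by rewrite ltr_pwDl// sqr_ge0.
    have := qC y; rewrite add0r (ger0_norm y0).
    by rewrite exprMn mulrC.
  have := ler_wpM2l (ltW x0) lq.
  have -> : x * (ln C + d * y) = x * ln C + e / 2 * y.
    by rewrite /d; field; rewrite gt_eqF.
  have : 2 * y * (pi / 2 - e / 4) <= 2 * y * atan (y / x).
    by rewrite ler_wpM2l ?mulr_ge0// atY.
  have pY : 0 <= pi * Y by rewrite mulr_ge0// pi_ge0.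
  lra.
apply: le_trans (gamma_modulus_le1 _ x0) _; rewrite -[leLHS]expR0 ler_expR.
have xl : 0 <= x * ln C by rewrite mulr_ge0// ltW.
have ey : 0 <= e * y by rewrite mulr_ge0// ltW.
have : pi * y <= pi * Y by rewrite ler_wpM2l ?pi_ge0// ltW.
by lra.
Qed.

Lemma exp_type_inv_cEuler x : 0 < x ->
  exp_type (fun y => (nrm (cEuler (x +i* y)))^-1) (pi / 2).
Proof.
move=> x0; have G0 := Gamma_gt0 x0.
apply: exp_type_sqr; first by move=> y; rewrite invr_ge0 nrm_ge0.
have -> : 2 * (pi / 2) = 0 + pi :> R by field.
pose A := 4 * expR 1 / Gamma x ^+ 2.
have A0 : 0 < A by rewrite divr_gt0 ?mulr_gt0 ?expR_gt0 ?exprn_gt0.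
apply: (@exp_type_le _ (fun y => (A + A * x^-1 ^+ 2 * y ^+ 2) * expR (pi * `|y|))).
  apply: exp_typeM.
  - move=> y; rewrite addr_ge0 ?(ltW A0)// -mulrA mulr_ge0 ?(ltW A0)//.
    by rewrite -exprMn sqr_ge0.
  - by move=> y; exact: expR_ge0.
  - by apply: exp_type_quad; rewrite mulr_ge0 ?sqr_ge0 ?(ltW A0).
  - move=> e e0; exists 1 => // y; rewrite mul1r ler_expR ler_wpM2r//.
    by rewrite lerDl ltW.
move=> y; have n0 : 0 < nrm (cEuler (x +i* y)).
  by rewrite lt_def nrm_ge0 nrm_eq0 cEuler_neq0.
have := gamma_modulus_lower (normr_ge0 y) x0.
rewrite /gamma_modulus -(nrm_cEuler_abs y x0).
have -> : (`|y| / x) ^+ 2 = x^-1 ^+ 2 * y ^+ 2.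
  by rewrite exprMn real_normK ?num_real// mulrC.
have -> : expR (- pi * `|y| - 1) = (expR (pi * `|y|))^-1 * (expR 1)^-1.
  by rewrite expRD mulNr !expRN.
have -> : (A + A * x^-1 ^+ 2 * y ^+ 2) * expR (pi * `|y|) =
    A * (1 + x^-1 ^+ 2 * y ^+ 2) * expR (pi * `|y|) by ring.
rewrite /A.
move: (expR_gt0 (pi * `|y|)) (expR_gt0 (1 : R)) (exprn_gt0 2 n0) (exprn_gt0 2 G0).
move: (expR _) (expR 1) (nrm _) (Gamma x) (1 + _) => E E1 N G q E0 E10 N0 GG0.
move=> h; rewrite exprVn -[leLHS]mul1r ler_pdivrMr//.
have E4 : 0 <= 4 * E1 * E by rewrite !mulr_ge0 ?ltW.
have := ler_wpM2r E4 h.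
rewrite [X in X <= _ -> _](_ : _ = 1); last by field; rewrite !gt_eqF.
move=> /le_trans; apply; rewrite le_eqVlt; apply/orP; left; apply/eqP.
have Gn0 : G != 0 by apply: contraTneq GG0 => ->; rewrite expr0n ltxx.
by field.
Qed.

End exponential_type.

(** * Mellin inversion *)

Section mellin_inversion.
Variable R : realType.
Notation leb := (@lebesgue_measure R).
Implicit Types (g v u y e : R).

(* the factor e^(-g v) of the integrand makes the weight at v equal to e^(-e^v) *)
Let weight g v u : R := gumbel g u * expR (- (g * v)).

Let continuous_weight g v : continuous (weight g v).
Proof. by move=> u; apply: cvgMl; exact: continuous_gumbel. Qed.

Let weight_ge0 g v u : 0 <= weight g v u.
Proof. by rewrite mulr_ge0 ?expR_ge0. Qed.

Let rintegrable_weight g v : 0 < g -> rintegrable leb (weight g v).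
Proof.
move=> g0; have := rintegrableZ (expR (- (g * v))) (rintegrable_gumbel g0).
by under [X in _ \o X]funext do rewrite mulrC.
Qed.

Let Re_mellin g v y : 0 < g ->
  complex.Re (cEuler (g +i* y) * cexp (- (g +i* y) * v%:C)) =
  \int[leb]_u (weight g v u * cos ((u - v) * y)).
Proof.
move=> g0; rewrite mulrC (@cEulerE _ (g +i* y) g0).
have ik := @cintegrable_euler_kernel R (g +i* y) g0.
rewrite -(cintegralZ _ ik).
transitivity (\int[leb]_u complex.Re (cexp (- (g +i* y) * v%:C) * euler_kernel (g +i* y) u)) => //.
apply: eq_Rintegral => u _.
rewrite ReM Re_euler_kernel Im_euler_kernel /cexp /weight /=.
have -> : - g * v - - y * 0 = - (g * v) by ring.
have -> : - g * 0 + - y * v = - (y * v) by ring.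
by rewrite cosN sinN mulrBl [u * y]mulrC [v * y]mulrC cosB; ring.
Qed.

(* the integral over y is a Poisson kernel in the logarithmic coordinate, rescaled to the
   Cauchy density by u = v + e w *)
Let mellin_poisson g v e : 0 < g -> 0 < e ->
  \int[leb]_y (expR (- (e * `|y|)) *
    complex.Re (cEuler (g +i* y) * cexp (- (g +i* y) * v%:C))) =
  \int[leb]_w (weight g v (v + e * w) * (2 * (1 + w ^+ 2)^-1)).
Proof.
move=> g0 e0.
pose f (x : measurableTypeR R * measurableTypeR R) := weight g v x.1 * (expR (- (e * `|x.2|)) * cos ((x.1 - v) * x.2)).
have mf : measurable_fun setT f.
  apply: measurable_funM.
    apply: measurableT_comp; last exact: measurable_fst.
    by apply: continuous_measurable_fun; exact: continuous_weight.
  apply: measurable_funM.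
    apply: (@measurableT_comp _ _ _ _ _ _ (fun y => expR (- (e * `|y|)))).
      by apply: continuous_measurable_fun; exact: continuous_expRNabs.
    exact: measurable_snd.
  apply: measurableT_comp; first exact: measurable_cos.
  apply: measurable_funM; last exact: measurable_snd.
  by apply: measurable_funB; [exact: measurable_fst|exact: measurable_cst].
have fb x : `|f x| <= weight g v x.1 * expR (- (e * `|x.2|)).
  rewrite normrM ger0_norm ?weight_ge0// ler_wpM2l ?weight_ge0//.
  by rewrite normrM ger0_norm ?expR_ge0// ler_piMr ?expR_ge0// cos_max.
have iw := rintegrable_weight v g0; have ie := rintegrable_expRNabs e0.
transitivity (\int[leb]_y \int[leb]_u f (u, y)).
  apply: eq_Rintegral => y _; rewrite (Re_mellin _ _ g0) -RintegralZl//.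
    by apply: eq_Rintegral => u _; rewrite /f /=; ring.
  apply: rintegrable_le iw _ => [|u].
    apply: continuous_measurable_fun => u; apply: cvgM; first exact: continuous_weight.
    apply: (@continuous_comp _ _ _ (fun u => (u - v) * y) cos); last exact: continuous_cos.
    by apply: cvgMl; apply: cvgB; [exact: cvg_id|exact: cvg_cst].
  by rewrite normrM ger0_norm ?weight_ge0// ler_piMr ?weight_ge0// cos_max.
rewrite -(Rfubini2 mf iw ie fb) (Rfubini1 mf iw ie fb).
pose G u := weight g v u * (2 * e / (e ^+ 2 + (u - v) ^+ 2)).
have d0 u : 0 < e ^+ 2 + (u - v) ^+ 2 by rewrite ltr_pwDl ?exprn_gt0// sqr_ge0.
transitivity (\int[leb]_u G u).
  apply: eq_Rintegral => u _; rewrite /G -Rintegral_expRNabs_cos// -RintegralZl//.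
  apply: rintegrable_le ie _ => [|y].
    apply: continuous_measurable_fun => y; apply: cvgM; first exact: continuous_expRNabs.
    exact: continuous_cosM.
  by rewrite normrM ger0_norm ?expR_ge0// ler_piMr ?expR_ge0// cos_max.
rewrite /Rintegral (@integral_affine _ G v e)//.
- congr fine; apply: eq_integral => w _; congr EFin.
  rewrite /G; have -> : v + e * w - v = e * w by ring.
  rewrite -mulrA; congr (_ * _); field.
  have := d0 (v + e * w); have -> : v + e * w - v = e * w by ring.
  move=> /gt_eqF ->; rewrite gt_eqF//.
  by rewrite ltr_pwDl// sqr_ge0.
- move=> u; apply: cvgM; first exact: continuous_weight.
  apply: cvgMr; apply: cvgV; first by rewrite gt_eqF.
  apply: cvgD; first exact: cvg_cst.
  apply: (@continuous_comp _ _ _ (fun u => u - v) (fun x => x ^+ 2)).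
    by apply: cvgB; [exact: cvg_id|exact: cvg_cst].
  exact: exprn_continuous.
- by move=> u; rewrite mulr_ge0 ?weight_ge0// divr_ge0 ?mulr_ge0 ?(ltW e0) ?(ltW (d0 u)).
Qed.

Lemma rintegrable_nrm_cEuler g : 0 < g ->
  rintegrable leb (fun y => nrm (cEuler (g +i* y))).
Proof.
move=> g0; have := @measurable_cEuler_line _ g 1 g0.
under [X in cmeasurable X]funext do rewrite mul1r.
move=> mG; apply: (@rintegrable_nrm_exp_type _ _ (- pi / 2)) mG _.
  by rewrite mulNr oppr_lt0 divr_gt0// pi_gt0.
exact: exp_type_cEuler.
Qed.

Lemma cmeasurable_cexp_line g v :
  cmeasurable (fun y => cexp (- (g +i* y) * v%:C)).
Proof.
apply: cmeasurable_cexp; split => /=.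
  under eq_fun do rewrite mulr0 subr0; exact: measurable_cst.
under eq_fun do rewrite mulr0 add0r mulNr.
by apply: measurable_funN; apply: measurable_funM => //; exact: measurable_cst.
Qed.

Lemma nrm_cexp_line g v y : nrm (cexp (- (g +i* y) * v%:C)) = expR (- (g * v)).
Proof. by rewrite nrm_cexp /= mulr0 subr0 mulNr. Qed.

Lemma cintegrable_mellin g v : 0 < g ->
  cintegrable leb (fun y => cEuler (g +i* y) * cexp (- (g +i* y) * v%:C)).
Proof.
move=> g0.
apply: cintegrable_le (rintegrableZ (expR (- (g * v))) (rintegrable_nrm_cEuler g0)) _.
  apply: cmeasurableM; last exact: cmeasurable_cexp_line.
  have := @measurable_cEuler_line _ g 1 g0.
  by under [X in cmeasurable X]funext do rewrite mul1r.
by move=> y; rewrite nrmM nrm_cexp_line mulrC.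
Qed.

(** Abel summation with the factors e^(-e|y|) turns the inversion integral into a
    Poisson integral, which tends to the value at v as e tends to 0. *)
Lemma mellin_inversion g v : 0 < g ->
  complex.Re (cintegral leb setT
    (fun y => cEuler (g +i* y) * cexp (- (g +i* y) * v%:C))) =
  2 * pi * expR (- expR v).
Proof.
move=> g0; pose F y := complex.Re (cEuler (g +i* y) * cexp (- (g +i* y) * v%:C)).
pose e_ n : R := n.+1%:R^-1.
have e_0 n : 0 < e_ n by rewrite invr_gt0.
have e_cvg : e_ n @[n --> \oo] --> (0 : R) by exact: cvg_harmonic.
have [iF _] := cintegrable_mellin v g0.
have c1 : (\int[leb]_y (expR (- (e_ n * `|y|)) * F y)) @[n --> \oo] --> \int[leb]_y F y.
  apply: (Rdominated_cvg _ _ (integrable_norm iF)).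
  - move=> n; apply: measurable_funM; last exact: rintegrable_measurable iF.
    by apply: continuous_measurable_fun; exact: continuous_expRNabs.
  - move=> y; rewrite -[F y in X in _ --> X]mul1r -(@expR0 R) -oppr0 -(mul0r `|y|).
    apply: cvgMl. apply: (@continuous_cvg _ _ _ \oo _ (fun n => - (e_ n * `|y|)) (@expR R)).
      exact: continuous_expR.
    by apply: cvgN; exact: cvgMl.
  - move=> n y; rewrite normrM ger0_norm ?expR_ge0// ler_piMl//.
    by rewrite -[leRHS]expR0 ler_expR oppr_le0 mulr_ge0// ltW.
have pe n : \int[leb]_y (expR (- (e_ n * `|y|)) * F y) =
    \int[leb]_w (weight g v (v + e_ n * w) * (2 * (1 + w ^+ 2)^-1)).
  exact: mellin_poisson.
rewrite (funext pe) in c1.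
have wb u : weight g v u <= expR (g * (ln g - 1)) * expR (- (g * v)).
  by rewrite ler_pM2r ?expR_gt0// ler_expR mul_sub_expR_le.
have ic := rintegrableZ 2 (@rintegrable_cauchy R).
have c2 : (\int[leb]_w (weight g v (v + e_ n * w) * (2 * (1 + w ^+ 2)^-1)))
    @[n --> \oo] --> \int[leb]_w (weight g v v * (2 * (1 + w ^+ 2)^-1)).
  apply: (Rdominated_cvg _ _
    (rintegrableZ (expR (g * (ln g - 1)) * expR (- (g * v))) ic)).
  - move=> n; apply: continuous_measurable_fun => w; apply: cvgM.
      apply: (@continuous_comp _ _ _ (fun w => v + e_ n * w)); last first.
        exact: continuous_weight.
      by apply: cvgD; [exact: cvg_cst|apply: cvgMr; exact: cvg_id].
    by apply: cvgMr; exact: continuous_cauchy.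
  - move=> w; apply: cvgMl.
    have -> : weight g v v = weight g v (v + 0 * w) by rewrite mul0r addr0.
    apply: (@continuous_cvg _ _ _ \oo _ (fun n => v + e_ n * w) (weight g v)).
      exact: continuous_weight.
    by apply: cvgD; [exact: cvg_cst|exact: cvgMl].
  - move=> n w; have c0 : 0 <= 2 * (1 + w ^+ 2)^-1.
      by rewrite mulr_ge0// invr_ge0 addr_ge0// sqr_ge0.
    by rewrite normrM !ger0_norm// ler_wpM2r.
have -> : 2 * pi * expR (- expR v) = \int[leb]_w (weight g v v * (2 * (1 + w ^+ 2)^-1)).
  rewrite (RintegralZl _ _ ic)// (RintegralZl _ _ (@rintegrable_cauchy R))//.
  rewrite [X in _ = _ * (2 * X)]/Rintegral integral_cauchy /= /weight /gumbel.
  rewrite -expRD mulrC; congr (expR _ * _); ring.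
by rewrite -(cvg_lim _ c2)// (cvg_lim _ c1).
Qed.

End mellin_inversion.

(** * Rising factorials and polynomial multiples of the exponential *)

Section rising_factorials.
Variable R : realType.
Notation leb := (@lebesgue_measure R).

Definition rising (K : comNzRingType) (k : nat) (s : K) : K :=
  \prod_(j < k) (s + (j : nat)%:R).

Lemma risingSr (K : comNzRingType) k (s : K) :
  rising k.+1 s = rising k s * (s + k%:R).
Proof. by rewrite /rising big_ord_recr. Qed.

Lemma risingSl (K : comNzRingType) k (s : K) :
  rising k.+1 s = s * rising k (s + 1).
Proof.
rewrite /rising big_ord_recl addr0; congr (_ * _).
by apply: eq_bigr => i _; rewrite -addrA -mulrS.
Qed.

Lemma rising_real k (x : R) : rising k x%:C = (rising k x)%:C.
Proof.
by rewrite /rising rmorph_prod; apply: eq_bigr => i _; rewrite rmorphD rmorph_nat.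
Qed.

Lemma Re_natr n : complex.Re (n%:R : R[i]) = n%:R.
Proof. by rewrite -(rmorph_nat (real_complex R)). Qed.

Lemma Im_natr n : complex.Im (n%:R : R[i]) = 0.
Proof. by rewrite -(rmorph_nat (real_complex R)). Qed.

Lemma cEuler_rising k (s : R[i]) : 0 < complex.Re s ->
  cEuler (s + k%:R) = rising k s * cEuler s.
Proof.
move=> s0; elim: k => [|k IH]; first by rewrite addr0 /rising big_ord0 mul1r.
rewrite -natr1 addrA cEulerS ?ReD ?Re_natr ?ltr_pwDl// IH risingSr.
by rewrite mulrA [_ * rising _ _]mulrC.
Qed.

Lemma Gamma_rising k (x : R) : 0 < x -> Gamma (x + k%:R) = rising k x * Gamma x.
Proof.
move=> x0; elim: k => [|k IH]; first by rewrite addr0 /rising big_ord0 mul1r.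
have xk : 0 < x + k%:R by rewrite ltr_pwDl.
rewrite -natr1 addrA (GammaS xk) IH risingSr.
by rewrite mulrA [_ * rising _ _]mulrC.
Qed.

Definition rising_comb (l : seq (R * nat)) (s : R[i]) : R[i] :=
  \sum_(ck <- l) (ck.1)%:C * rising ck.2 s.

(** Since s is the difference of the factors s + k and k, multiplication by a linear
    factor stays within the span of the rising factorials. *)
Lemma prod_linear_rising_comb (us : seq (R * R)) : exists l, forall s,
  \prod_(u <- us) ((u.1)%:C - (u.2)%:C * s) = rising_comb l s.
Proof.
elim: us => [|u us [l IH]].
  exists [:: (1, 0%N)] => s.
  by rewrite big_nil /rising_comb big_seq1 /rising big_ord0 mulr1.
exists ([seq (ck.1 * (u.1 + u.2 * ck.2%:R), ck.2) | ck <- l] ++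
        [seq (- (u.2 * ck.1), ck.2.+1) | ck <- l]) => s.
rewrite big_cons IH /rising_comb big_cat !big_map /=.
rewrite -[RHS]big_split mulr_sumr /=.
apply: eq_bigr => -[c k] _ /=; rewrite risingSr.
rewrite !(rmorphM, rmorphN, rmorphD, rmorph_nat) /=; ring.
Qed.

(** The inverse Mellin transform of Gamma times the combination l. *)
Definition poly_exp (l : seq (R * nat)) (z : R) : R :=
  \sum_(ck <- l) ck.1 * (z ^+ ck.2 * expR (- z)).

Lemma continuous_poly_exp l : continuous (poly_exp l).
Proof.
rewrite /poly_exp; elim: l => [|[c k] l IH].
  by under eq_fun do rewrite big_nil; exact: cst_continuous.
under eq_fun do rewrite big_cons.
move=> z; apply: cvgD; last exact: IH.
apply: cvgMr; apply: cvgM; first exact: exprn_continuous.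
apply: (@continuous_comp _ _ _ -%R expR); first exact: opp_continuous.
exact: continuous_expR.
Qed.

Lemma mellin_inversion_comb (g v : R) (l : seq (R * nat)) : 0 < g ->
  cintegrable leb (fun y => cEuler (g +i* y) * rising_comb l (g +i* y) *
    cexp (- (g +i* y) * v%:C)) /\
  complex.Re (cintegral leb setT (fun y => cEuler (g +i* y) *
    rising_comb l (g +i* y) * cexp (- (g +i* y) * v%:C))) =
  2 * pi * poly_exp l (expR v).
Proof.
move=> g0; pose F l y := cEuler (g +i* y) * rising_comb l (g +i* y) *
  cexp (- (g +i* y) * v%:C).
rewrite -[X in cintegrable _ X]/(F l) -[X in cintegral _ _ X]/(F l).
elim: l => [|[c k] l [iF eF]].
  have -> : F [::] = fun=> (0 : R)%:C.
    by apply/funext => y; rewrite /F /rising_comb big_nil mulr0 mul0r.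
  rewrite cintegral_real /poly_exp big_nil mulr0 /= Rintegral_cst// mul0r.
  by split => //; split; exact: integrable0.
have gk : 0 < g + k%:R by rewrite ltr_pwDl.
pose H y := cEuler ((g + k%:R) +i* y) * cexp (- ((g + k%:R) +i* y) * v%:C).
have iH : cintegrable leb H by exact: cintegrable_mellin.
have -> : F ((c, k) :: l) = fun y => (c * expR (k%:R * v))%:C * H y + F l y.
  apply/funext => y; rewrite /F /rising_comb big_cons mulrDr mulrDl; congr (_ + _).
  rewrite /H; have -> : (g + k%:R) +i* y = (g +i* y) + k%:R :> R[i].
    by apply/eqP; rewrite eq_complex ReD ImD Re_natr Im_natr addr0 !eqxx.
  rewrite (@cEuler_rising k (g +i* y) g0).
  have -> : - (g +i* y + k%:R) * v%:C = - (g +i* y) * v%:C + (- (k%:R * v))%:C.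
    by rewrite rmorphN rmorphM rmorph_nat /=; ring.
  rewrite cexpD cexp_real /= expRN rmorphM /= fmorphV.
  have e0 : (expR (k%:R * v))%:C != 0 :> R[i].
    by rewrite (inj_eq (@complexI R)) gt_eqF// expR_gt0.
  by field.
split; first by apply: cintegrableD => //; exact: cintegrableZ.
rewrite cintegralD//; last exact: cintegrableZ.
have eH : complex.Re (cintegral leb setT H) = 2 * pi * expR (- expR v).
  exact: mellin_inversion.
rewrite ReD eF (cintegralZ _ iH) Re_realM eH.
rewrite [in RHS]/poly_exp big_cons [RHS]mulrDr; congr (_ + _).
by rewrite -expRM_natl /=; ring.
Qed.

(** Only the behaviour at the right of 0 is prescribed, but the bound holds on the
    whole half-line, which lets the expansion be integrated. *)
Definition has_taylor (e : R -> R) (c : nat -> R) := forall n, exists C,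
  forall z, 0 <= z -> `|e z - \sum_(i < n) c i * z ^+ i| <= C * z ^+ n.

Let rising_coef k i : R := (-1) ^+ i / (i`!)%:R * rising k (- i%:R).

Let has_taylor_monomial k :
  has_taylor (fun z => z ^+ k * expR (- z)) (rising_coef k).
Proof.
elim: k => [|k IH] n.
  exists (n`!%:R)^-1 => z z0.
  rewrite expr0 mul1r.
  have -> : expR (- z) - \sum_(i < n) rising_coef 0 i * z ^+ i = (-1) ^+ n * exp_rem n z.
    rewrite /exp_rem mulrA -expr2 sqrr_sign mul1r big_mkord.
    congr (_ - _); apply: eq_bigr => i _.
    by rewrite /rising_coef /rising big_ord0; ring.
  rewrite normrMsign ger0_norm ?exp_rem_ge0// mulrC.
  by rewrite -subr_ge0 -exp_remS exp_rem_ge0.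
case: n => [|n].
  exists ((k.+1)`!)%:R => z z0; rewrite big_ord0 subr0 expr0 mulr1.
  rewrite ger0_norm ?mulr_ge0 ?exprn_ge0 ?expR_ge0//.
  rewrite expRN ler_pdivrMr ?expR_gt0// mulrC -ler_pdivrMr ?ltr0n ?fact_gt0//.
  by apply: le_trans (expR_ge1Dxn k z0); rewrite lerDr.
have [C hC] := IH n; exists C => z z0.
have -> : z ^+ k.+1 * expR (- z) - \sum_(i < n.+1) rising_coef k.+1 i * z ^+ i =
    z * (z ^+ k * expR (- z) - \sum_(i < n) rising_coef k i * z ^+ i).
  rewrite big_ord_recl /= {1}/rising_coef risingSl oppr0 mul0r mulr0 mul0r add0r.
  rewrite mulrBr exprS mulrA mulr_sumr; congr (_ - _); apply: eq_bigr => i _.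
  rewrite /rising_coef risingSl /bump /= add1n exprS [z ^+ i.+1]exprS.
  have -> : - i.+1%:R + 1 = - i%:R :> R by rewrite -natr1; ring.
  rewrite factS natrM; field.
  by rewrite -[1]/(1%:R) -natrD !pnatr_eq0 -lt0n fact_gt0.
by rewrite normrM (ger0_norm z0) exprS mulrCA ler_wpM2l// hC.
Qed.

(** The coefficients are the residues at -i of Gamma times the combination. *)
Lemma has_taylor_poly_exp l : has_taylor (poly_exp l)
  (fun i => (-1) ^+ i / (i`!)%:R * complex.Re (rising_comb l (- i%:R))).
Proof.
elim: l => [|[c k] l IH] n.
  exists 0 => z z0; rewrite /poly_exp /rising_comb big_nil big1 ?subr0 ?normr0 ?mul0r//.
  by move=> i _; rewrite big_nil mulr0 mul0r.
have [C hC] := IH n; have [D hD] := has_taylor_monomial k n.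
exists (`|c| * D + C) => z z0.
have -> : poly_exp ((c, k) :: l) z - \sum_(i < n) (-1) ^+ i / (i`!)%:R *
      complex.Re (rising_comb ((c, k) :: l) (- i%:R)) * z ^+ i =
    c * (z ^+ k * expR (- z) - \sum_(i < n) rising_coef k i * z ^+ i) +
    (poly_exp l z - \sum_(i < n) (-1) ^+ i / (i`!)%:R *
      complex.Re (rising_comb l (- i%:R)) * z ^+ i).
  rewrite {1}/poly_exp big_cons -/(poly_exp l z) /= mulrBr addrACA; congr (_ + _).
  rewrite -opprD mulr_sumr -big_split; congr (- _); apply: eq_bigr => i _ /=.
  rewrite {1}/rising_comb big_cons -/(rising_comb l _) ReD Re_realM /=.
  rewrite -(rmorph_nat (real_complex R)) -rmorphN /= rising_real /= /rising_coef.
  by ring.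
apply: le_trans (ler_normD _ _) _; rewrite mulrDl lerD ?hC//.
by rewrite normrM -mulrA ler_wpM2l// hD.
Qed.

End rising_factorials.

(** * Products of Gamma functions as Mellin transforms of measures *)

Section mellin_measure.
Variable R : realType.
Notation leb := (@lebesgue_measure R).

Let kernel_shift (c al v : R) (s : R[i]) :
  (gumbel c v)%:C * cexp (s * (al * v)%:C) = euler_kernel (c%:C + al%:C * s) v.
Proof.
rewrite /gumbel -cexp_real -cexpD /euler_kernel; congr cexp.
by rewrite rmorphB !rmorphM /=; ring.
Qed.

(** A product of Gamma functions is the Mellin transform of the law of a product of
    independent variables. The measure is given by a space, a weight W on it and
    the logarithm L of the variable. *)
Lemma mellin_measure (n : nat) (c al : 'I_n -> R) :
  exists (d : measure_display) (T : measurableType d)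
    (rho : {sigma_finite_measure set T -> \bar R}) (L W : T -> R),
  [/\ measurable_fun setT L, measurable_fun setT W, forall w, 0 <= W w &
    forall s : R[i], (forall i, 0 < c i + al i * complex.Re s) ->
      rintegrable rho (fun w => W w * expR (complex.Re s * L w)) /\
      cintegral rho setT (fun w => (W w)%:C * cexp (s * (L w)%:C)) =
        \prod_(i < n) cEuler ((c i)%:C + (al i)%:C * s)].
Proof.
elim: n c al => [|n IH] c al.
  exists _, (measurableTypeR R), (@dirac _ _ (0 : measurableTypeR R) R), (cst 0), (cst 1).
  split => // s _.
  have E : (fun w : measurableTypeR R => (cst (1 : R) w)%:C * cexp (s * (cst (0 : R) w)%:C)) =
      (fun=> (1 : R)%:C).
    by apply/funext => w /=; rewrite mulr0 cexp0 mulr1.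
  rewrite E cintegral_real big_ord0; split.
    under [X in _ \o X]funext do rewrite /= mulr0 expR0 mulr1.
    exact: finite_measure_integrable_cst.
  by rewrite /Rintegral integral_dirac// diracT mul1e.
have [d [T [rho [L [W [mL mW W0 HW]]]]]] := IH (fun i => c (lift ord0 i)) (fun i => al (lift ord0 i)).
exists _, (T * measurableTypeR R)%type, (prod_measure rho leb),
  (fun x => L x.1 + al ord0 * x.2), (fun x => W x.1 * gumbel (c ord0) x.2).
have mg : measurable_fun [set: measurableTypeR R] (gumbel (c ord0)).
  by apply: continuous_measurable_fun; exact: continuous_gumbel.
have mL' : measurable_fun setT (fun x : T * measurableTypeR R => L x.1 + al ord0 * x.2).
  apply: measurable_funD; first by apply: measurableT_comp mL _.
  by apply: measurable_funM => //; exact: measurable_cst.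
have mW' : measurable_fun setT (fun x : T * measurableTypeR R => W x.1 * gumbel (c ord0) x.2).
  by apply: measurable_funM; [apply: measurableT_comp mW _|apply: measurableT_comp mg _].
split => //; first by move=> x; rewrite mulr_ge0// ltW// gumbel_gt0.
move=> s hs.
have [iW eW] := HW s (fun i => hs (lift ord0 i)).
have ig := rintegrable_gumbel (hs ord0).
have Re_cs : complex.Re ((c ord0)%:C + (al ord0)%:C * s) = c ord0 + al ord0 * complex.Re s.
  by rewrite ReD Re_realM.
split.
  have := rintegrable_prod iW ig; congr (_.-integrable _ (_ \o _)).
  apply/funext => x /=; rewrite gumbelM mulrDr expRD.
  have -> : complex.Re s * (al ord0 * x.2) = al ord0 * complex.Re s * x.2 by ring.
  by ring.
have E w v : (W w * gumbel (c ord0) v)%:C * cexp (s * (L w + al ord0 * v)%:C) =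
    ((W w)%:C * cexp (s * (L w)%:C)) * euler_kernel ((c ord0)%:C + (al ord0)%:C * s) v.
  by rewrite -kernel_shift rmorphM rmorphD /= mulrDr cexpD; ring.
have mW2 : cmeasurable (fun w => (W w)%:C * cexp (s * (L w)%:C)).
  apply: cmeasurableM; first exact: cmeasurable_real.
  apply: cmeasurable_cexp; apply: cmeasurableM; first exact: cmeasurable_cst.
  exact: cmeasurable_real.
have nW w : nrm ((W w)%:C * cexp (s * (L w)%:C)) = W w * expR (complex.Re s * L w).
  by rewrite nrmM nrm_real ger0_norm// nrm_cexp [s * _]mulrC Re_realM [L w * _]mulrC.
have cs0 : 0 < complex.Re ((c ord0)%:C + (al ord0)%:C * s) by rewrite Re_cs.
have iW2 : cintegrable rho (fun w => (W w)%:C * cexp (s * (L w)%:C)).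
  by apply: cintegrable_le mW2 iW _ => w; rewrite nW.
rewrite (@cfubini1 _ _ _ _ _ rho leb _ (fun w => W w * expR (complex.Re s * L w))
  (gumbel (c ord0 + al ord0 * complex.Re s)) _ iW ig); last 2 first.
- apply: cmeasurableM; first exact: cmeasurable_real.
  apply: cmeasurable_cexp; apply: cmeasurableM; first exact: cmeasurable_cst.
  exact: cmeasurable_real.
- move=> w v; apply: (@le_trans _ _ (nrm ((W w)%:C * cexp (s * (L w)%:C) *
      euler_kernel ((c ord0)%:C + (al ord0)%:C * s) v))).
    by rewrite -E.
  by rewrite nrmM nW nrm_euler_kernel Re_cs.
transitivity (cintegral rho setT (fun w => cEuler ((c ord0)%:C + (al ord0)%:C * s) *
    ((W w)%:C * cexp (s * (L w)%:C)))).
  apply: eq_cintegral => w; rewrite (cEulerE cs0) mulrC -cintegralZ; last first.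
    exact: cintegrable_euler_kernel.
  by apply: eq_cintegral => v; exact: E.
by rewrite (cintegralZ _ iW2) eW big_ord_recl.
Qed.

End mellin_measure.

(** * Moments from the expansion of a cosine transform *)

Section moment_extraction.
Variable R : realType.

Lemma harmonic_squeeze (u : nat -> R) (l A : R) :
  (forall j, `|u j - l| <= A * j.+1%:R^-1 ^+ 2) -> u j @[j --> \oo] --> l.
Proof.
move=> h; have c : A * j.+1%:R^-1 ^+ 2 @[j --> \oo] --> (0 : R).
  under eq_fun do rewrite expr2.
  rewrite -(mulr0 A) -[X in A * X](mulr0 0).
  by apply: cvgMr; apply: cvgM; exact: cvg_harmonic.
apply: (@squeeze_cvgr _ _ _ _ (fun j => l - A * j.+1%:R^-1 ^+ 2)
  (fun j => l + A * j.+1%:R^-1 ^+ 2)).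
- by apply: nearW => j; rewrite -ler_distl.
- by rewrite -[X in _ --> X]subr0; apply: cvgB => //; exact: cvg_cst.
- by rewrite -[X in _ --> X]addr0; apply: cvgD => //; exact: cvg_cst.
Qed.

Section even_moments.
Context d1 d2 (S1 : measurableType d1) (S2 : measurableType d2).
Variables (m1 : {measure set S1 -> \bar R}) (m2 : {measure set S2 -> \bar R}).
Variables (W Y : S1 -> R) (V tau : S2 -> R) (e : R -> R) (c : nat -> R).
Hypothesis mY : measurable_fun setT Y.
Hypothesis W0 : forall x, 0 <= W x.
Hypothesis iW : rintegrable m1 W.
Hypothesis V0 : forall x, 0 <= V x.
Hypothesis tau0 : forall x, 0 <= tau x.
Hypothesis mtau : measurable_fun setT tau.
Hypothesis iV : forall n, rintegrable m2 (fun x => V x * tau x ^+ n).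
Hypothesis ce : continuous e.
Hypothesis ec : has_taylor e c.
Hypothesis mean : \int[m1]_x W x = c 0 * \int[m2]_x V x.
Hypothesis transform : forall t, 0 < t ->
  \int[m1]_x (W x * cos (t * Y x)) = \int[m2]_x (V x * e (t ^+ 2 * tau x)).

Let mW : measurable_fun setT W. Proof. exact: rintegrable_measurable iW. Qed.

Let mV : measurable_fun setT V.
Proof.
have := rintegrable_measurable (iV 0).
by under eq_fun do rewrite expr0 mulr1.
Qed.

Let mcos t : measurable_fun setT (fun x => cos (t * Y x)).
Proof.
apply: measurableT_comp; first exact: measurable_cos.
by apply: measurable_funM => //; exact: measurable_cst.
Qed.

Let icos t : rintegrable m1 (fun x => W x * cos (t * Y x)).
Proof.
apply: rintegrable_le iW _ => [|x]; first exact: measurable_funM.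
by rewrite normrM ger0_norm// ler_piMr// cos_max.
Qed.

Let iVe t : rintegrable m2 (fun x => V x * e (t ^+ 2 * tau x)).
Proof.
have [C hC] := ec 0.
apply: rintegrable_le (rintegrableZ C (iV 0)) _ => [|x].
  apply: measurable_funM => //; apply: measurableT_comp.
    exact: continuous_measurable_fun.
  by apply: measurable_funM => //; exact: measurable_cst.
have := hC (t ^+ 2 * tau x) (mulr_ge0 (sqr_ge0 _) (tau0 x)).
rewrite big_ord0 subr0 expr0 mulr1 => h; rewrite /= mulr1 in h *.
rewrite normrM (ger0_norm (V0 x)) [C * _]mulrC. by apply: ler_wpM2l.
Qed.

Let J n : R := \int[m2]_x (V x * tau x ^+ n).

Let transform_taylor n : exists A, forall t, 0 < t ->
  `|\int[m2]_x (V x * e (t ^+ 2 * tau x)) - \sum_(k < n) c k * t ^+ (2 * k) * J k|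
    <= A * t ^+ (2 * n).
Proof.
have [C hC] := ec n; exists (C * J n) => t t0.
have iS k : rintegrable m2 (fun x => c k * t ^+ (2 * k) * (V x * tau x ^+ k)).
  exact: rintegrableZ.
have -> : \int[m2]_x (V x * e (t ^+ 2 * tau x)) - \sum_(k < n) c k * t ^+ (2 * k) * J k
    = \int[m2]_x (V x * e (t ^+ 2 * tau x)
        - \sum_(k < n) c k * t ^+ (2 * k) * (V x * tau x ^+ k)).
  rewrite RintegralB//; last by apply: rintegrable_sum => k; exact: iS.
  rewrite Rintegral_sum; last by move=> k; exact: iS.
  congr (_ - _); apply: eq_bigr => k _.
  by rewrite RintegralZl.
have pw x : `|V x * e (t ^+ 2 * tau x) - \sum_(k < n) c k * t ^+ (2 * k) * (V x * tau x ^+ k)|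
    <= C * t ^+ (2 * n) * (V x * tau x ^+ n).
  have -> : V x * e (t ^+ 2 * tau x) - \sum_(k < n) c k * t ^+ (2 * k) * (V x * tau x ^+ k)
     = V x * (e (t ^+ 2 * tau x) - \sum_(k < n) c k * (t ^+ 2 * tau x) ^+ k).
    rewrite mulrBr mulr_sumr; congr (_ - _); apply: eq_bigr => k _.
    by rewrite exprMn -exprM; ring.
  rewrite normrM (ger0_norm (V0 x)).
  have -> : C * t ^+ (2 * n) * (V x * tau x ^+ n) = V x * (C * (t ^+ 2 * tau x) ^+ n).
    by rewrite exprMn -exprM; ring.
  by rewrite ler_wpM2l// hC// mulr_ge0// sqr_ge0.
have iD : rintegrable m2 (fun x => V x * e (t ^+ 2 * tau x)
        - \sum_(k < n) c k * t ^+ (2 * k) * (V x * tau x ^+ k)).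
  have iSum : rintegrable m2 (fun x => \sum_(k < n) c k * t ^+ (2 * k) * (V x * tau x ^+ k)).
    by apply: rintegrable_sum => k; exact: iS.
  have := rintegrableD (iVe t) (rintegrableZ (-1) iSum).
  by congr (_.-integrable _ (_ \o _)); apply/funext => x; rewrite mulN1r.
apply: le_trans (le_normr_Rintegral _ iD) _ => //.
rewrite mulrAC -RintegralZl//; apply: le_Rintegral => //.
- exact: (integrable_norm iD).
- exact: rintegrableZ.
Qed.

(* normalized so as to tend, as t tends to 0, to the n-th coefficient of the cosine
   series in t, up to sign *)
Let scaled n t x : R := W x * (cos_rem n (t * Y x) / t ^+ (2 * n)).

Let scaled_ge0 n t x : 0 <= scaled n.+1 t x.
Proof.
by rewrite mulr_ge0// divr_ge0 ?cos_rem_ge0// mulnC exprM sqr_ge0.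
Qed.

Let scaled_le n t x : 0 < t ->
  scaled n t x <= (((2 * n)`!)%:R)^-1 * (W x * Y x ^+ (2 * n)).
Proof.
move=> t0; rewrite mulrCA ler_wpM2l// ler_pdivrMr ?exprn_gt0//.
apply: le_trans (cos_rem_le _ _) _; rewrite exprMn.
by rewrite le_eqVlt; apply/orP; left; apply/eqP; ring.
Qed.

Let scaled_cvg n x : scaled n j.+1%:R^-1 x @[j --> \oo] -->
  (((2 * n)`!)%:R)^-1 * (W x * Y x ^+ (2 * n)).
Proof.
apply: (@harmonic_squeeze _ _ (W x * (Y x ^+ (2 * n.+1) / ((2 * n.+1)`!)%:R))) => j.
set t := j.+1%:R^-1; have t0 : 0 < t by rewrite invr_gt0.
have -> : scaled n t x - (((2 * n)`!)%:R)^-1 * (W x * Y x ^+ (2 * n)) =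
    - (W x * (cos_rem n.+1 (t * Y x) / t ^+ (2 * n))).
  rewrite cos_remS /scaled exprMn; field.
  by rewrite pnatr_eq0 -lt0n fact_gt0 expf_neq0// gt_eqF.
rewrite normrN normrM (ger0_norm (W0 x)) -mulrA ler_wpM2l//.
have t2 : 0 < t ^+ (2 * n) by rewrite exprn_gt0.
rewrite ger0_norm ?divr_ge0 ?cos_rem_ge0 ?(ltW t2)// ler_pdivrMr//.
apply: le_trans (cos_rem_le _ _) _.
by rewrite exprMn mulnS !exprD le_eqVlt; apply/orP; left; apply/eqP; ring.
Qed.

(** If the moments below 2 n are known, subtracting the corresponding terms of the
    expansion and dividing by t^(2 n) leaves a limit on the right. On the left it
    leaves the non-negative alternating remainder of the cosine, to which Fatou's
    lemma applies; this makes the next moment finite, and the upper bound of the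
    remainder turns the inequality into an equality. *)
Lemma even_moment n : rintegrable m1 (fun x => W x * Y x ^+ (2 * n)) /\
  \int[m1]_x (W x * Y x ^+ (2 * n)) =
    (-1) ^+ n * ((2 * n)`!)%:R * c n * \int[m2]_x (V x * tau x ^+ n).
Proof.
elim/ltn_ind: n => -[|n] IH.
  rewrite muln0; under [X in _ \o X]funext do rewrite expr0 mulr1.
  split => //; under eq_Rintegral do rewrite expr0 mulr1.
  rewrite mean fact0 expr0 !mul1r; congr (_ * _).
  by apply: eq_Rintegral => x _; rewrite expr0 mulr1.
pose a t := \int[m1]_x scaled n.+1 t x.
have iS k t : (k < n.+1)%N -> rintegrable m1
    (fun x => (-1) ^+ k * t ^+ (2 * k) / ((2 * k)`!)%:R * (W x * Y x ^+ (2 * k))).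
  by move=> kn; apply: rintegrableZ; have [] := IH k kn.
have scaledE t x : 0 < t -> scaled n.+1 t x = (-1) ^+ n.+1 / t ^+ (2 * n.+1) *
    (W x * cos (t * Y x) + (-1) * \sum_(k < n.+1)
      (-1) ^+ k * t ^+ (2 * k) / ((2 * k)`!)%:R * (W x * Y x ^+ (2 * k))).
  move=> t0; rewrite /scaled /cos_rem big_mkord mulN1r.
  have -> : \sum_(k < n.+1) (-1) ^+ k * t ^+ (2 * k) / ((2 * k)`!)%:R * (W x * Y x ^+ (2 * k))
      = W x * \sum_(k < n.+1) (-1) ^+ k * ((t * Y x) ^+ (2 * k) / ((2 * k)`!)%:R).
    by rewrite mulr_sumr; apply: eq_bigr => k _; rewrite exprMn; ring.
  by ring.
have iSum t : rintegrable m1 (fun x => \sum_(k < n.+1)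
    (-1) ^+ k * t ^+ (2 * k) / ((2 * k)`!)%:R * (W x * Y x ^+ (2 * k))).
  by apply: rintegrable_sum => k; exact: iS.
have iscaled t : 0 < t -> rintegrable m1 (scaled n.+1 t).
  move=> t0; rewrite (funext (fun x => scaledE t x t0)); apply: rintegrableZ.
  by apply: rintegrableD => //; exact: rintegrableZ.
have aE t : 0 < t -> a t = (-1) ^+ n.+1 / t ^+ (2 * n.+1) *
    (\int[m2]_x (V x * e (t ^+ 2 * tau x)) - \sum_(k < n.+1) c k * t ^+ (2 * k) * J k).
  move=> t0; rewrite /a; under eq_Rintegral do rewrite scaledE//.
  rewrite RintegralZl//; last by apply: rintegrableD => //; exact: rintegrableZ.
  rewrite RintegralD//; last exact: rintegrableZ.
  rewrite RintegralZl// transform// mulN1r; congr (_ * (_ - _)).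
  rewrite Rintegral_sum; last by move=> k; exact: iS.
  apply: eq_bigr => k _; have [ik ek] := IH k (ltn_ord k).
  rewrite RintegralZl// ek -/(J k).
  have f0 : ((2 * k)`!)%:R != 0 :> R by rewrite pnatr_eq0 -lt0n fact_gt0.
  transitivity (((-1) ^+ k) ^+ 2 * (c k * t ^+ (2 * k) * J k)); first by field.
  by rewrite sqrr_sign mul1r.
have alim : a j.+1%:R^-1 @[j --> \oo] --> (-1) ^+ n.+1 * c n.+1 * J n.+1.
  have [A hA] := transform_taylor n.+2.
  apply: (@harmonic_squeeze _ _ A) => j; set t := j.+1%:R^-1.
  have t0 : 0 < t by rewrite invr_gt0.
  have := hA t t0; rewrite big_ord_recr/= => h; rewrite aE//.
  set D := \int[m2]_x _ in h *; set S := \sum_(k < n.+1) _ in h *.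
  have t2 : 0 < t ^+ (2 * n.+1) by rewrite exprn_gt0.
  have -> : (-1) ^+ n.+1 / t ^+ (2 * n.+1) * (D - S) - (-1) ^+ n.+1 * c n.+1 * J n.+1 =
      (-1) ^+ n.+1 * ((D - (S + c n.+1 * t ^+ (2 * n.+1) * J n.+1)) / t ^+ (2 * n.+1)).
    by field; rewrite expf_neq0// gt_eqF.
  rewrite normrMsign normrM [X in _ * X]ger0_norm ?invr_ge0 ?(ltW t2)//.
  rewrite ler_pdivrMr//; apply: le_trans h _.
  by rewrite [(2 * n.+2)%N]mulnS exprD mulrA.
have f0 : 0 < (((2 * n.+1)`!)%:R)^-1 :> R by rewrite invr_gt0 ltr0n fact_gt0.
have mP : measurable_fun setT (fun x => W x * Y x ^+ (2 * n.+1)).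
  by apply: measurable_funM => //; exact: measurable_funX.
have P0 x : 0 <= W x * Y x ^+ (2 * n.+1).
  by rewrite mulr_ge0// mulnC exprM sqr_ge0.
have h0 j : 0 < j.+1%:R^-1 :> R by rewrite invr_gt0.
have fat : (\int[m1]_x ((((2 * n.+1)`!)%:R)^-1 * (W x * Y x ^+ (2 * n.+1)))%:E
    <= ((-1) ^+ n.+1 * c n.+1 * J n.+1)%:E)%E.
  have mj j : measurable_fun setT (fun x => (scaled n.+1 j.+1%:R^-1 x)%:E).
    by apply/measurable_EFinP; exact: rintegrable_measurable (iscaled _ (h0 j)).
  have p0 j x : setT x -> (0 <= (scaled n.+1 j.+1%:R^-1 x)%:E)%E.
    by rewrite lee_fin scaled_ge0.
  have := fatou m1 measurableT mj p0.
  have -> : limn_einf (fun j => (\int[m1]_x (scaled n.+1 j.+1%:R^-1 x)%:E)%E) =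
      ((-1) ^+ n.+1 * c n.+1 * J n.+1)%:E.
    apply: (cvg_limn_einf_sup _).1.
    have -> : (fun j => (\int[m1]_x (scaled n.+1 j.+1%:R^-1 x)%:E)%E) =
        (fun j => (a j.+1%:R^-1)%:E).
      by apply/funext => j; rewrite /a EFin_Rintegral//; exact: iscaled.
    by apply: cvg_EFin; [exact: nearW|exact: alim].
  congr (_ <= _)%E; apply: eq_integral => x _.
  apply: (cvg_limn_einf_sup _).1.
  by apply: cvg_EFin; [exact: nearW|exact: scaled_cvg].
have iP : rintegrable m1 (fun x => W x * Y x ^+ (2 * n.+1)).
  have := rintegrableZ ((2 * n.+1)`!)%:R (rintegrable_ge0 _ _ fat).
  under [X in _ \o X]funext do rewrite mulrA divff ?mul1r ?pnatr_eq0 -?lt0n ?fact_gt0//.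
  apply => //; first by apply: measurable_funM => //; exact: measurable_cst.
  by move=> x; rewrite mulr_ge0// ltW.
split => //; set I := \int[m1]_x _.
have le1 : (((2 * n.+1)`!)%:R)^-1 * I <= (-1) ^+ n.+1 * c n.+1 * J n.+1.
  by move: fat; rewrite -EFin_Rintegral ?RintegralZl ?lee_fin//; exact: rintegrableZ.
have le2 : (-1) ^+ n.+1 * c n.+1 * J n.+1 <= (((2 * n.+1)`!)%:R)^-1 * I.
  rewrite -(cvg_lim _ alim)//; apply: limr_le; first by apply/cvg_ex; eexists; exact: alim.
  apply: nearW => j; rewrite -RintegralZl//; apply: le_Rintegral => //.
  - exact: iscaled.
  - exact: rintegrableZ.
  - by move=> x _; exact: scaled_le.
have h : (((2 * n.+1)`!)%:R)^-1 * I = (-1) ^+ n.+1 * c n.+1 * J n.+1.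
  by apply/eqP; rewrite eq_le le1 le2.
by rewrite -[LHS](mulKf (lt0r_neq0 f0)) h invrK -/(J n.+1); ring.
Qed.

End even_moments.

Section odd_moments.
Context d (S : measurableType d).
Variables (m : {measure set S -> \bar R}) (Y : S -> R).
Hypothesis mY : measurable_fun setT Y.
Hypothesis iY : forall n, rintegrable m (fun x => `|Y x| ^+ n).
Hypothesis sine0 : forall t, 0 < t -> \int[m]_x sin (t * Y x) = 0.

Let iYn n : rintegrable m (fun x => Y x ^+ n).
Proof.
apply: rintegrable_le (iY n) _ => [|x]; first exact: measurable_funX.
by rewrite normrX.
Qed.

Let isin t : rintegrable m (fun x => sin (t * Y x)).
Proof.
apply: rintegrable_le (iY 0) _ => [|x]; last by rewrite expr0 sin_max.
apply: measurableT_comp; first exact: measurable_sin.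
by apply: measurable_funM => //; exact: measurable_cst.
Qed.

(** Once the lower odd moments vanish, the sine transform being zero says that the
    next one is t^2 times a bounded quantity, for every t > 0. *)
Lemma odd_moment n : \int[m]_x Y x ^+ (2 * n).+1 = 0.
Proof.
elim/ltn_ind: n => n IH; pose I := \int[m]_x Y x ^+ (2 * n).+1.
pose f : R := ((2 * n).+1`!)%:R; have f0 : 0 < f by rewrite ltr0n fact_gt0.
pose A := f * \int[m]_x (`|Y x| ^+ (2 * n).+3 / ((2 * n).+3`!)%:R).
suff cv : I @[_ --> \oo] --> (0 : R).
  by rewrite -/I -(cvg_lim _ cv)// lim_cst.
apply: (@harmonic_squeeze _ _ A) => j; set t := j.+1%:R^-1.
have t0 : 0 < t by rewrite invr_gt0.
pose g k x := (-1) ^+ k * t ^+ (2 * k).+1 / ((2 * k).+1`!)%:R * Y x ^+ (2 * k).+1.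
have ig k : rintegrable m (g k) by exact: rintegrableZ.
have igs : rintegrable m (fun x => \sum_(k < n.+1) g k x).
  by apply: rintegrable_sum => k; exact: ig.
have remE x : sin_rem n.+1 (t * Y x) =
    (-1) ^+ n.+1 * (sin (t * Y x) + (-1) * \sum_(k < n.+1) g k x).
  rewrite /sin_rem big_mkord mulN1r; congr (_ * (_ - _)).
  by apply: eq_bigr => k _; rewrite exprMn /g; ring.
have irem : rintegrable m (fun x => sin_rem n.+1 (t * Y x)).
  rewrite (funext remE); apply: rintegrableZ.
  by apply: rintegrableD => //; exact: rintegrableZ.
have sumE : \int[m]_x sin_rem n.+1 (t * Y x) = t ^+ (2 * n).+1 / f * I.
  under eq_Rintegral do rewrite remE.
  rewrite RintegralZl//; last by apply: rintegrableD => //; exact: rintegrableZ.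
  rewrite RintegralD//; last exact: rintegrableZ.
  rewrite sine0// add0r RintegralZl// Rintegral_sum; last by move=> k; exact: ig.
  rewrite big_ord_recr /= big1 ?add0r; last first.
    by move=> k _; rewrite /g RintegralZl// IH ?mulr0.
  rewrite /g RintegralZl// -/I exprS -/f.
  transitivity (((-1) ^+ n) ^+ 2 * (t ^+ (2 * n).+1 / f * I)); first by ring.
  by rewrite sqrr_sign mul1r.
have bound : `|t ^+ (2 * n).+1 / f * I| <= t ^+ (2 * n).+3 * (A / f).
  rewrite -sumE; apply: le_trans (le_normr_Rintegral _ irem) _ => //.
  rewrite /A [f * _]mulrC mulfK ?gt_eqF//.
  have i3 : rintegrable m (fun x => `|Y x| ^+ (2 * n).+3 / ((2 * n).+3`!)%:R).
    have := rintegrableZ (((2 * n).+3`!)%:R)^-1 (iY (2 * n).+3).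
    by congr (_.-integrable _ (_ \o _)); apply/funext => x; rewrite mulrC.
  rewrite -RintegralZl//; apply: le_Rintegral => //.
  - exact: (integrable_norm irem).
  - exact: rintegrableZ.
  - move=> x _; apply: le_trans (norm_sin_rem_le _ _) _.
    by rewrite normrM (gtr0_norm t0) exprMn -mulrA.
rewrite subr0; move: bound.
rewrite normrM ger0_norm; last by rewrite divr_ge0 ?exprn_ge0 ?ltW.
have -> : t ^+ (2 * n).+3 * (A / f) = t ^+ (2 * n).+1 / f * (A * t ^+ 2).
  by rewrite -[(2 * n).+3]addn2 -[(2 * n).+1]addn1 !exprD; ring.
by rewrite ler_pM2l// divr_gt0// exprn_gt0.
Qed.

End odd_moments.
End moment_extraction.

(** * The transform of a generalized Wright measure *)

Section line_integrals.
Variable R : realType.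
Notation leb := (@lebesgue_measure R).

(** How far a line Re z = x has to be moved to the right, in unit steps, to enter
    the half-plane of convergence of Euler's integral. *)
Definition euler_shift (x : R) : nat := if 0 < x then 0 else (Num.truncn (- x)).+1.

Lemma euler_shift_gt0 x : 0 < x + (euler_shift x)%:R.
Proof.
rewrite /euler_shift; case: ifPn => [x0|_]; first by rewrite addr0.
by rewrite -ltrBlDl sub0r truncnS_gt.
Qed.

Lemma cGammaV (z : R[i]) : (cGamma z)^-1 =
  rising (euler_shift (complex.Re z)) z /
  cEuler (z + (euler_shift (complex.Re z))%:R).
Proof.
rewrite /cGamma /euler_shift; case: ifPn => _.
  by rewrite /rising big_ord0 addr0 mul1r.
by rewrite invf_div.
Qed.

Lemma affine_line (A al g y : R) :
  A%:C - al%:C * (g +i* y) = (A - al * g) +i* (- al * y) :> R[i].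
Proof.
by apply/eqP; rewrite eq_complex ReD ImD ReN ImN Re_realM Im_realM /= add0r mulNr !eqxx.
Qed.

(** Averaging a Mellin-Barnes integral over the argument multiplies its integrand by
    the Mellin transform of the averaging measure. *)
Lemma average_mellin_barnes d (T : measurableType d)
    (rho : {sigma_finite_measure set T -> \bar R}) (L W : T -> R)
    (G : R -> R[i]) (g lam : R) :
  measurable_fun setT L -> measurable_fun setT W -> (forall w, 0 <= W w) ->
  rintegrable rho (fun w => W w * expR (- g * L w)) ->
  cmeasurable (G : measurableTypeR R -> _) -> rintegrable leb (fun y => nrm (G y)) ->
  cintegral rho setT (fun w => (W w)%:C *
    cintegral leb setT (fun y => G y * cexp (- (g +i* y) * (lam + L w)%:C))) =
  cintegral leb setT (fun y => G y * cexp (- (g +i* y) * lam%:C) *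
    cintegral rho setT (fun w => (W w)%:C * cexp (- (g +i* y) * (L w)%:C))).
Proof.
move=> mL mW W0 iW mG iG.
pose f (x : T * measurableTypeR R) := (W x.1)%:C *
  (G x.2 * cexp (- (g +i* x.2) * (lam + L x.1)%:C)).
have mf : cmeasurable f.
  apply: cmeasurableM.
    by apply: cmeasurable_real; apply: measurableT_comp mW _.
  apply: cmeasurableM.
    by case: mG => [m1 m2]; split; [apply: measurableT_comp m1 _|apply: measurableT_comp m2 _].
  apply: cmeasurable_cexp; apply: cmeasurableM; last first.
    apply: cmeasurable_real; apply: measurable_funD; first exact: measurable_cst.
    by apply: measurableT_comp mL _.
  split => /=; first exact: measurable_cst.
  by apply: measurable_funN; exact: measurable_snd.
have iG' := rintegrableZ (expR (- g * lam)) iG.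
have fb w y : nrm (f (w, y)) <= W w * expR (- g * L w) * (expR (- g * lam) * nrm (G y)).
  rewrite /f /= !nrmM nrm_real (ger0_norm (W0 w)) nrm_cexp_line -mulNr mulrDr expRD.
  by rewrite le_eqVlt; apply/orP; left; apply/eqP; ring.
transitivity (cintegral rho setT (fun w => cintegral leb setT (fun y => f (w, y)))).
  apply: eq_cintegral => w; rewrite -cintegralZ//.
  apply: cintegrable_le (rintegrableZ (expR (- (g * (lam + L w)))) iG) _ => [|y].
    by apply: cmeasurableM => //; exact: cmeasurable_cexp_line.
  by rewrite nrmM nrm_cexp_line mulrC.
rewrite (cfubini mf iW iG' fb); apply: eq_cintegral => y.
rewrite -cintegralZ; last first.
  apply: cintegrable_le iW _ => [|w].
    apply: cmeasurableM; first exact: cmeasurable_real.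
    apply: cmeasurable_cexp; apply: cmeasurableM; first exact: cmeasurable_cst.
    exact: cmeasurable_real.
  by rewrite nrmM nrm_real (ger0_norm (W0 w)) nrm_cexp_line mulNr.
apply: eq_cintegral => w; rewrite /f /= rmorphD /= mulrDr cexpD; ring.
Qed.

Lemma Re_cintegral_real d (T : measurableType d) (mu : {measure set T -> \bar R})
    (W : T -> R) (Z : T -> R[i]) :
  complex.Re (cintegral mu setT (fun w => (W w)%:C * Z w)) =
  \int[mu]_w (W w * complex.Re (Z w)).
Proof.
transitivity (\int[mu]_w complex.Re ((W w)%:C * Z w)) => //.
by apply: eq_Rintegral => w _; rewrite Re_realM.
Qed.

End line_integrals.

Section wright_transform.
Context (R : realType) (m p : nat).
Variables (b beta : 'I_m -> R) (a alpha : 'I_p -> R).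
Notation leb := (@lebesgue_measure R).
Hypothesis halpha : forall i, 0 < alpha i.
Hypothesis ha : forall i, 0 < a i + alpha i.
Hypothesis hbeta : forall j, 0 < beta j.
Hypothesis hb : forall j, 0 < b j + beta j.
Hypothesis astar_ge0 : 0 <= wright_astar beta alpha.
Variable g : R.
Hypothesis hg : wright_contour b beta g.

Let g0 : 0 < g. Proof. by case: hg => /andP[]. Qed.

Let A i : R := a i + alpha i.
Let B j : R := b j + beta j.
Let k i : nat := euler_shift (A i - alpha i * g).

Let Bg j : 0 < B j - beta j * g.
Proof.
by case: hg => _ /(_ j); rewrite ltr_pdivlMr// mulrC subr_gt0.
Qed.

Let Akg i : 0 < A i + (k i)%:R - alpha i * g.
Proof. by rewrite addrAC; exact: euler_shift_gt0. Qed.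

Let num (s : R[i]) := \prod_(j < m) cEuler ((B j)%:C - (beta j)%:C * s).
Let den (s : R[i]) := \prod_(i < p) cEuler ((A i + (k i)%:R)%:C - (alpha i)%:C * s).
Let pol (s : R[i]) := \prod_(i < p) rising (k i) ((A i)%:C - (alpha i)%:C * s).

Let den_neq0 y : den (g +i* y) != 0.
Proof.
by apply/prodf_neq0 => i _; rewrite affine_line cEuler_neq0.
Qed.

(** The reciprocals of the Gamma functions in the denominator, which may have their
    argument left of the half-plane of convergence, are split into a polynomial and
    reciprocals of Euler integrals. *)
Lemma wright_Psi_line x : 0 < x ->
  wright_Psi b beta a alpha g (- x) = ((2 * pi)^-1)%:C *
  cintegral leb setT (fun y => cEuler (g +i* y) * (num (g +i* y) * pol (g +i* y) /
    den (g +i* y)) * cexp (- (g +i* y) * (ln x)%:C)).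
Proof.
move=> x0; rewrite /wright_Psi oppr_eq0 (gt_eqF x0) /vline_integral.
congr (_ * _); apply: eq_cintegral => y; rewrite opprK /cpow; congr (_ * _ * _).
  by rewrite /cGamma /= g0.
rewrite -mulrA; congr (_ * _).
  by apply: eq_bigr => j _; rewrite affine_line /cGamma /= Bg.
rewrite -prodfV /pol /den -prodf_div; apply: eq_bigr => i _.
rewrite cGammaV affine_line /= -/(A i) -/(k i); congr (_ / cEuler _).
by rewrite rmorphD rmorph_nat /= [in RHS]addrAC affine_line.
Qed.

Let cmeasurable_euler c al : 0 < c - al * g ->
  cmeasurable (fun y : measurableTypeR R => cEuler (c%:C - al%:C * (g +i* y))).
Proof.
move=> c0; under [X in cmeasurable X]funext do rewrite affine_line.
exact: measurable_cEuler_line.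
Qed.

Let cmeasurable_rising n c al :
  cmeasurable (fun y : measurableTypeR R => rising n (c%:C - al%:C * (g +i* y))).
Proof.
apply: cmeasurable_prod => j; under [X in cmeasurable X]funext do rewrite affine_line.
apply: cmeasurableD; last exact: cmeasurable_cst.
split => /=; first exact: measurable_cst.
by apply: measurable_funM => //; exact: measurable_cst.
Qed.

Let cmeasurable_base : cmeasurable (fun y : measurableTypeR R => cEuler (g +i* y)).
Proof.
have := @measurable_cEuler_line _ g 1 g0.
by under [X in cmeasurable X]funext do rewrite mul1r.
Qed.

Let exp_type_euler c al : 0 < al -> 0 < c - al * g ->
  exp_type (fun y => nrm (cEuler (c%:C - al%:C * (g +i* y)))) (- pi / 2 * al).
Proof.
move=> al0 c0; under [X in exp_type X _]funext do rewrite affine_line.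
have := exp_type_scale (_ : - al != 0) (exp_type_cEuler c0).
by rewrite normrN gtr0_norm// oppr_eq0 gt_eqF//; apply.
Qed.

Let exp_type_inv_euler c al : 0 < al -> 0 < c - al * g ->
  exp_type (fun y => (nrm (cEuler (c%:C - al%:C * (g +i* y))))^-1) (pi / 2 * al).
Proof.
move=> al0 c0; under [X in exp_type X _]funext do rewrite affine_line.
have := exp_type_scale (_ : - al != 0) (exp_type_inv_cEuler c0).
by rewrite normrN gtr0_norm// oppr_eq0 gt_eqF//; apply.
Qed.

Let exp_type_rising n c al :
  exp_type (fun y => nrm (rising n (c%:C - al%:C * (g +i* y)))) 0.
Proof.
under [X in exp_type X _]funext do rewrite affine_line nrm_prod.
apply: exp_type_prod0 => j; first by move=> y; exact: nrm_ge0.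
apply: exp_type_sqr; first by move=> y; exact: nrm_ge0.
rewrite mulr0; apply: exp_type_le (exp_type_quad ((c - al * g + j%:R) ^+ 2) (sqr_ge0 al)) _.
move=> y; rewrite sqr_nrm ReD ImD Re_natr Im_natr /= addr0 exprMn sqrrN.
exact: lexx.
Qed.

Let exp_type_pol : exp_type (fun y => nrm (pol (g +i* y))) 0.
Proof.
under [X in exp_type X _]funext do rewrite nrm_prod.
apply: exp_type_prod0 => j; first by move=> y; exact: nrm_ge0.
exact: exp_type_rising.
Qed.

Let G1 y : R[i] := cEuler (g +i* y) * (num (g +i* y) * pol (g +i* y) / den (g +i* y)).
Let G2 y : R[i] := cEuler (g +i* y) * pol (g +i* y).

Let cmeasurable_G2 : cmeasurable (G2 : measurableTypeR R -> _).
Proof.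
apply: cmeasurableM; first exact: cmeasurable_base.
by apply: cmeasurable_prod => i; exact: cmeasurable_rising.
Qed.

Let cmeasurable_G1 : cmeasurable (G1 : measurableTypeR R -> _).
Proof.
apply: cmeasurableM; first exact: cmeasurable_base.
apply: cmeasurableM; last first.
  apply: cmeasurableV; apply: cmeasurable_prod => i; apply: cmeasurable_euler.
  exact: Akg.
apply: cmeasurableM; first by apply: cmeasurable_prod => j; apply: cmeasurable_euler; exact: Bg.
by apply: cmeasurable_prod => i; exact: cmeasurable_rising.
Qed.

Let rintegrable_G2 : rintegrable leb (fun y => nrm (G2 y)).
Proof.
apply: (@rintegrable_nrm_exp_type _ _ (- pi / 2 + 0)) => //.
  by rewrite addr0 mulNr oppr_lt0 divr_gt0// pi_gt0.
under [X in exp_type X _]funext do rewrite nrmM.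
apply: exp_typeM.
- by move=> y; exact: nrm_ge0.
- by move=> y; exact: nrm_ge0.
- exact: exp_type_cEuler.
- exact: exp_type_pol.
Qed.

(* the exponential rates add up to - (1 + astar) pi / 2 *)
Let rintegrable_G1 : rintegrable leb (fun y => nrm (G1 y)).
Proof.
apply: (@rintegrable_nrm_exp_type _ _ (- pi / 2 +
  (\sum_(j < m) (- pi / 2 * beta j) + 0 + \sum_(i < p) (pi / 2 * alpha i)))) => //.
  rewrite addr0 -!mulr_sumr.
  have : 0 <= pi / 2 * wright_astar beta alpha :> R.
    by rewrite mulr_ge0// divr_ge0// pi_ge0.
  rewrite /wright_astar mulrBr; have := pi_gt0 R; lra.
under [X in exp_type X _]funext do rewrite !nrmM nrmV.
have nn (z : R -> R[i]) y : 0 <= nrm (z y) by exact: nrm_ge0.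
apply: exp_typeM; first exact: nn.
- by move=> y; rewrite !mulr_ge0 ?invr_ge0 ?nrm_ge0.
- exact: exp_type_cEuler.
apply: exp_typeM.
- by move=> y; rewrite mulr_ge0 ?nrm_ge0.
- by move=> y; rewrite invr_ge0 nrm_ge0.
- apply: exp_typeM; [exact: nn|exact: nn| |exact: exp_type_pol].
  under [X in exp_type X _]funext do rewrite nrm_prod.
  apply: exp_type_prod => j; first by move=> y; exact: nrm_ge0.
  by apply: exp_type_euler => //; exact: Bg.
under [X in exp_type X _]funext do rewrite nrm_prod -prodfV.
apply: exp_type_prod => i; first by move=> y; rewrite invr_ge0 nrm_ge0.
by apply: exp_type_inv_euler => //; exact: Akg.
Qed.

Let pol_comb : exists l, forall s, pol s = rising_comb l s.
Proof.
have [l hl] := prod_linear_rising_comb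
  [seq (A i + j%:R, alpha i) | i <- index_enum 'I_p, j <- iota 0 (k i)].
exists l => s; rewrite -hl big_allpairs_dep /=; apply: eq_bigr => i _.
rewrite /rising -(big_mkord xpredT (fun j => (A i)%:C - (alpha i)%:C * s + j%:R)).
rewrite /index_iota subn0; apply: eq_bigr => j _.
by rewrite /= addrAC -(rmorph_nat (real_complex R)) -(rmorphD (real_complex R)).
Qed.

Let realC_prod n (F : 'I_n -> R) : \prod_(i < n) (F i)%:C = (\prod_(i < n) F i)%:C :> R[i].
Proof. by rewrite (rmorph_prod (real_complex R)). Qed.

(** The denominators of the Gamma ratio, shifted into the half-plane of convergence,
    and its numerators are the Mellin transforms of two measures. Averaging Psi over
    the first measure cancels the denominators; what remains is the average over the
    second measure of an explicit function e, the exponential multiplied by a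
    polynomial that accounts for the shifts. *)
Lemma wright_mixture :
  exists (d1 : measure_display) (T1 : measurableType d1)
    (rho : {sigma_finite_measure set T1 -> \bar R}) (L W : T1 -> R)
    (d2 : measure_display) (T2 : measurableType d2)
    (nu : {sigma_finite_measure set T2 -> \bar R}) (L' W' : T2 -> R)
    (e : R -> R) (rise : nat -> R),
  [/\ [/\ measurable_fun setT L, measurable_fun setT W & forall w, 0 <= W w],
      measurable_fun setT L' /\ (forall w, 0 <= W' w),
      (forall j, [/\ 0 < rise j, rintegrable rho (fun w => W w * expR (j%:R * L w)) &
        \int[rho]_w (W w * expR (j%:R * L w)) =
          rise j * \prod_(i < p) Gamma (a i + alpha i * j.+1%:R)]) &
      (forall j, rintegrable nu (fun w => W' w * expR (j%:R * L' w)) /\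
        \int[nu]_w (W' w * expR (j%:R * L' w)) =
          \prod_(i < m) Gamma (b i + beta i * j.+1%:R))] /\
  [/\ continuous e, has_taylor e (fun j => (-1) ^+ j / (j`!)%:R * rise j) &
      forall x, 0 < x ->
        \int[rho]_w (W w * (2 * pi *
          complex.Re (wright_Psi b beta a alpha g (- (x * expR (L w)))))) =
        \int[nu]_w (W' w * (2 * pi * e (x * expR (L' w))))].
Proof.
have [d1 [T1 [rho [L [W [mL mW W0 HW]]]]]] := mellin_measure (fun i => A i + (k i)%:R) alpha.
have [d2 [T2 [nu [L2 [W2 [mL2 mW2 W20 HW2]]]]]] := mellin_measure B beta.
have [l hl] := pol_comb.
have Ai_gt0 i : 0 < A i by exact: ha.
have Bj_gt0 j : 0 < B j by exact: hb.
(* on the line Re s = - g the transforms are the factors of the integrand; at the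
   non-negative integers they are the moments *)
have line y : complex.Re (- (g +i* y)) = - g by [].
have [iWg _] := HW (- (g +i* 0)) (fun i => ltac:(by rewrite line mulrN; exact: Akg)).
have [iW2g _] := HW2 (- (g +i* 0)) (fun j => ltac:(by rewrite line mulrN; exact: Bg)).
have denE y : cintegral rho setT (fun w => (W w)%:C * cexp (- (g +i* y) * (L w)%:C)) =
    den (g +i* y).
  have [|_ ->] := HW (- (g +i* y)); first by move=> i; rewrite line mulrN; exact: Akg.
  by apply: eq_bigr => i _; rewrite mulrN.
have numE y : cintegral nu setT (fun w => (W2 w)%:C * cexp (- (g +i* y) * (L2 w)%:C)) =
    num (g +i* y).
  have [|_ ->] := HW2 (- (g +i* y)); first by move=> i; rewrite line mulrN; exact: Bg.
  by apply: eq_bigr => i _; rewrite mulrN.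
have Wn j : rintegrable rho (fun w => W w * expR (j%:R * L w)) /\
    \int[rho]_w (W w * expR (j%:R * L w)) =
      \prod_(i < p) Gamma (A i + (k i)%:R + alpha i * j%:R).
  have c0 i : 0 < A i + (k i)%:R + alpha i * j%:R.
    by apply: ltr_wpDr; [rewrite mulr_ge0// ltW|exact: ltr_wpDr].
  have [//|iw ew] := HW (j%:R)%:C.
  split; first exact: iw.
  apply: (@complexI R); rewrite -cintegral_real -realC_prod.
  transitivity (cintegral rho setT (fun w => (W w)%:C * cexp ((j%:R)%:C * (L w)%:C))).
    by apply: eq_cintegral => w; rewrite -[_ * (L w)%:C]rmorphM cexp_real -rmorphM.
  rewrite ew; apply: eq_bigr => i _.
  by rewrite -(cEuler_real (c0 i)) -(rmorphM (real_complex R)) -(rmorphD (real_complex R)).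
have W2n j : rintegrable nu (fun w => W2 w * expR (j%:R * L2 w)) /\
    \int[nu]_w (W2 w * expR (j%:R * L2 w)) = \prod_(i < m) Gamma (B i + beta i * j%:R).
  have c0 i : 0 < B i + beta i * j%:R.
    by apply: ltr_wpDr => //; rewrite mulr_ge0// ltW.
  have [//|iw ew] := HW2 (j%:R)%:C.
  split; first exact: iw.
  apply: (@complexI R); rewrite -cintegral_real -realC_prod.
  transitivity (cintegral nu setT (fun w => (W2 w)%:C * cexp ((j%:R)%:C * (L2 w)%:C))).
    by apply: eq_cintegral => w; rewrite -[_ * (L2 w)%:C]rmorphM cexp_real -rmorphM.
  rewrite ew; apply: eq_bigr => i _.
  by rewrite -(cEuler_real (c0 i)) -(rmorphM (real_complex R)) -(rmorphD (real_complex R)).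
(* the average over rho cancels the denominators, and the numerators are unfolded into
   an average over nu *)
have average lam : \int[rho]_w (W w * complex.Re (cintegral leb setT
      (fun y => G1 y * cexp (- (g +i* y) * (lam + L w)%:C)))) =
    \int[nu]_w (W2 w * (2 * pi * poly_exp l (expR (lam + L2 w)))).
  rewrite -Re_cintegral_real (average_mellin_barnes lam mL mW W0 iWg cmeasurable_G1 rintegrable_G1).
  transitivity (complex.Re (cintegral nu setT (fun w => (W2 w)%:C *
      cintegral leb setT (fun y => G2 y * cexp (- (g +i* y) * (lam + L2 w)%:C))))).
    rewrite (average_mellin_barnes lam mL2 mW2 W20 iW2g cmeasurable_G2 rintegrable_G2).
    congr complex.Re; apply: eq_cintegral => y; rewrite denE numE /G1 /G2.
    by field; exact: den_neq0.
  rewrite Re_cintegral_real; apply: eq_Rintegral => w _; congr (_ * _).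
  have [_ <-] := mellin_inversion_comb (lam + L2 w) l g0.
  by congr complex.Re; apply: eq_cintegral => y; rewrite /G2 hl.
pose rise j : R := \prod_(i < p) rising (k i) (A i + alpha i * j%:R).
have Aj_gt0 i j : 0 < A i + alpha i * j%:R.
  by apply: ltr_wpDr => //; rewrite mulr_ge0// ltW.
have shift c al j : c + al + al * j%:R = c + al * j.+1%:R :> R.
  by rewrite mulrS mulrDr mulr1 addrA.
exists d1, T1, rho, L, W, d2, T2, nu, L2, W2, (poly_exp l), rise.
split; [split|split].
- exact: And3 mL mW W0.
- exact: conj mL2 W20.
- move=> j; have [iw ew] := Wn j; split; last 1 first.
  + rewrite ew -big_split; apply: eq_bigr => i _ /=.
    by rewrite addrAC (Gamma_rising _ (Aj_gt0 i j)) /A shift.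
  + by apply: prodr_gt0 => i _; apply: prodr_gt0 => o _; exact: ltr_wpDr.
  + exact: iw.
- move=> j; have [iw ew] := W2n j; split; first exact: iw.
  by rewrite ew; apply: eq_bigr => i _; rewrite /B shift.
- exact: continuous_poly_exp.
- have := has_taylor_poly_exp l; congr has_taylor.
  apply/funext => j; congr (_ * _).
  rewrite -hl -[RHS]/(complex.Re (rise j)%:C) -realC_prod; congr complex.Re.
  apply: eq_bigr => i _; rewrite -rising_real mulrN opprK.
  by rewrite -(rmorph_nat (real_complex R)) -(rmorphM (real_complex R)) -(rmorphD (real_complex R)).
- move=> x x0; have logE v : x * expR v = expR (ln x + v) by rewrite expRD lnK.
  have pi2 : 2 * pi != 0 :> R by rewrite mulf_neq0// gt_eqF// pi_gt0.
  transitivity (\int[rho]_w (W w * complex.Re (cintegral leb setT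
      (fun y => G1 y * cexp (- (g +i* y) * (ln x + L w)%:C))))).
    apply: eq_Rintegral => w _; congr (_ * _).
    by rewrite logE wright_Psi_line ?expR_gt0// expRK Re_realM mulVKf.
  by rewrite average; apply: eq_Rintegral => w _; rewrite logE.
Qed.

End wright_transform.

Section mixture_moments.
Variable R : realType.
Context d1 (T1 : measurableType d1) (rho : {sigma_finite_measure set T1 -> \bar R}).
Context d2 (T2 : measurableType d2) (nu : {sigma_finite_measure set T2 -> \bar R}).
Context d (S : measurableType d) (P : probability S R).
Variables (L W : T1 -> R) (L2 W2 : T2 -> R) (e Psi : R -> R).
Variables (rise N D : nat -> R) (K q : R) (X : S -> R).
Hypothesis mL : measurable_fun setT L.
Hypothesis mW : measurable_fun setT W.
Hypothesis W0 : forall w, 0 <= W w.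
Hypothesis mL2 : measurable_fun setT L2.
Hypothesis W20 : forall w, 0 <= W2 w.
Hypothesis Wn : forall j, [/\ 0 < rise j,
  rintegrable rho (fun w => W w * expR (j%:R * L w)) &
  \int[rho]_w (W w * expR (j%:R * L w)) = rise j * D j].
Hypothesis W2n : forall j, rintegrable nu (fun w => W2 w * expR (j%:R * L2 w)) /\
  \int[nu]_w (W2 w * expR (j%:R * L2 w)) = N j.
Hypothesis ce : continuous e.
Let c j : R := (-1) ^+ j / (j`!)%:R * rise j.
Hypothesis ec : has_taylor e c.
Hypothesis average : forall x, 0 < x ->
  \int[rho]_w (W w * (2 * pi * Psi (x * expR (L w)))) =
  \int[nu]_w (W2 w * (2 * pi * e (x * expR (L2 w)))).
Hypothesis D0 : forall j, 0 < D j.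
Hypothesis K0 : 0 < K.
Hypothesis KE : K = N 0 / D 0.
Hypothesis q0 : 0 < q.
Hypothesis mX : measurable_fun setT X.
Hypothesis charX : forall u, 0 < u ->
  \int[P]_x cos (u * X x) = K^-1 * Psi (u ^+ 2 * q).

(** Multiplying X by an independent variable e^(L/2) turns its cosine transform into
    an average of Psi, hence of e, whose Taylor coefficients at 0 are known. This
    yields the moments of the product, and those of e^(L/2) are divided out. *)
Lemma mixture_even_moment n : (\int[P]_x (X x ^+ (2 * n))%:E = (K^-1 *
  (N n / D n) * (((2 * n)`!)%:R / (n`!)%:R) * q ^+ n)%:E)%E.
Proof.
have pi0 : 0 < 2 * pi :> R by rewrite mulr_gt0// pi_gt0.
pose kap := 2 * pi * K; have kap0 : 0 < kap by rewrite mulr_gt0.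
pose m1 := prod_measure rho P.
pose Wx (x : T1 * S) := kap * W x.1.
pose Y (x : T1 * S) := expR (L x.1 / 2) * X x.2.
pose V w := 2 * pi * W2 w; pose tau w := q * expR (L2 w).
have mWx : measurable_fun setT Wx.
  by apply: measurable_funM; [exact: measurable_cst|exact: measurableT_comp mW _].
have mY : measurable_fun setT Y.
  apply: measurable_funM; last exact: measurableT_comp mX _.
  apply: measurableT_comp; first exact: measurable_expR.
  by apply: measurable_funM; [exact: measurableT_comp mL _|exact: measurable_cst].
have Wx0 x : 0 <= Wx x by rewrite mulr_ge0// ltW.
have V0 w : 0 <= V w by rewrite mulr_ge0// ltW.
have tau0 w : 0 <= tau w by rewrite mulr_ge0 ?expR_ge0// ltW.
have mtau : measurable_fun setT tau.
  apply: measurable_funM; first exact: measurable_cst.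
  by apply: measurableT_comp mL2; exact: measurable_expR.
have iW0 : rintegrable rho W.
  have [_ + _] := Wn 0%N; congr (_.-integrable _ (_ \o _)).
  by apply/funext => w; rewrite mul0r expR0 mulr1.
have ikW : rintegrable rho (fun w => kap * W w) by exact: rintegrableZ.
have i1 : rintegrable P (fun=> (1 : R)) by exact: finite_measure_integrable_cst.
have iWx : rintegrable m1 Wx.
  have := rintegrable_prod ikW i1; congr (_.-integrable _ (_ \o _)).
  by apply/funext => x; rewrite mulr1.
have VtauE j w : V w * tau w ^+ j = 2 * pi * q ^+ j * (W2 w * expR (j%:R * L2 w)).
  by rewrite /V /tau exprMn expRM_natl; ring.
have iV j : rintegrable nu (fun w => V w * tau w ^+ j).
  rewrite (funext (VtauE j)); apply: rintegrableZ.
  by have [] := W2n j.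
have intV j : \int[nu]_w (V w * tau w ^+ j) = 2 * pi * q ^+ j * N j.
  under eq_Rintegral do rewrite VtauE.
  by have [iw ew] := W2n j; rewrite RintegralZl// ew.
have mean : \int[m1]_x Wx x = c 0%N * \int[nu]_w V w.
  have -> : \int[nu]_w V w = 2 * pi * N 0%N.
    rewrite -[RHS]mulr1 mulrAC -(expr0 q) -intV.
    by apply: eq_Rintegral => w _; rewrite expr0 mulr1.
  have fb x : `|Wx x| <= kap * W x.1 * 1 by rewrite mulr1 ger0_norm.
  rewrite (Rfubini1 mWx ikW i1 fb) /Wx /=.
  under eq_Rintegral do rewrite Rintegral_cst//= probability_setT mulr1.
  rewrite RintegralZl//.
  have [_ _] := Wn 0%N; under eq_Rintegral do rewrite mul0r expR0 mulr1.
  move=> ->; rewrite /c fact0 expr0 /kap KE.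
  by field; rewrite gt_eqF.
have transform t : 0 < t ->
    \int[m1]_x (Wx x * cos (t * Y x)) = \int[nu]_w (V w * e (t ^+ 2 * tau w)).
  move=> t0; pose f x := Wx x * cos (t * Y x).
  have mf : measurable_fun setT f.
    apply: measurable_funM => //; apply: measurableT_comp; first exact: measurable_cos.
    by apply: measurable_funM => //; exact: measurable_cst.
  have fb x : `|f x| <= kap * W x.1 * 1.
    by rewrite mulr1 normrM (ger0_norm (Wx0 x)) ler_piMr// cos_max.
  rewrite -[LHS]/(\int[m1]_x f x) (Rfubini1 mf ikW i1 fb).
  have tq0 : 0 < t ^+ 2 * q by rewrite mulr_gt0// exprn_gt0.
  transitivity (\int[rho]_w (W w * (2 * pi * Psi (t ^+ 2 * q * expR (L w))))).
    apply: eq_Rintegral => w _; rewrite /f /Wx /Y /=.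
    have u0 : 0 < t * expR (L w / 2) by rewrite mulr_gt0// expR_gt0.
    rewrite RintegralZl//; last first.
      apply: rintegrable_le i1 _ => [|x]; last exact: cos_max.
      apply: measurableT_comp; first exact: measurable_cos.
      apply: measurable_funM; first exact: measurable_cst.
      by apply: measurable_funM => //; exact: measurable_cst.
    under eq_Rintegral do rewrite mulrA.
    rewrite (charX u0).
    have -> : (t * expR (L w / 2)) ^+ 2 * q = t ^+ 2 * q * expR (L w).
      rewrite exprMn -expRM_natl.
      have -> : 2 * (L w / 2) = L w by field.
      by rewrite mulrAC.
    by rewrite /kap; field; rewrite gt_eqF.
  rewrite average//; apply: eq_Rintegral => w _; rewrite /V /tau.
  by rewrite -(mulrA (t ^+ 2)); ring.
have [iE eE] := even_moment mY Wx0 iWx V0 tau0 mtau iV ce ec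
  mean transform n.
have rn0 : 0 < rise n by case: (Wn n).
have rD0 : 0 < kap * (rise n * D n) by exact: mulr_gt0 kap0 (mulr_gt0 rn0 (D0 n)).
have E1 : ((\int[m1]_x (Wx x * Y x ^+ (2 * n)))%:E =
    (kap * (rise n * D n))%:E * \int[P]_x (X x ^+ (2 * n))%:E)%E.
  rewrite EFin_Rintegral// /m1 /prod_measure fubini_tonelli1; last 2 first.
  - by apply/measurable_EFinP; exact: rintegrable_measurable iE.
  - by move=> x; rewrite lee_fin mulr_ge0// exprM exprn_ge0// sqr_ge0.
  have XX x : (0 <= (X x ^+ (2 * n))%:E)%E by rewrite lee_fin exprM exprn_ge0// sqr_ge0.
  have mXn : measurable_fun setT (fun x => (X x ^+ (2 * n))%:E).
    by apply/measurable_EFinP; exact: measurable_funX.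
  transitivity (\int[rho]_w ((kap * (W w * expR (n%:R * L w)))%:E *
      \int[P]_x (X x ^+ (2 * n))%:E))%E.
    apply: eq_integral => w _; rewrite /fubini_F /Wx /Y /=.
    rewrite -ge0_integralZl_EFin//; last first.
      by rewrite mulr_ge0 ?(ltW kap0)// mulr_ge0 ?expR_ge0.
    apply: eq_integral => x _; rewrite -EFinM exprMn; congr EFin.
    have -> : expR (L w / 2) ^+ (2 * n) = expR (n%:R * L w).
      by rewrite -expRM_natl natrM; congr expR; field.
    by ring.
  have [_ iw ew] := Wn n.
  rewrite ge0_integralZr//; last 3 first.
  - by apply/measurable_EFinP; exact: rintegrable_measurable (rintegrableZ kap iw).
  - by move=> w _; rewrite lee_fin mulr_ge0 ?(ltW kap0)// mulr_ge0 ?expR_ge0.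
  - by apply: integral_ge0.
  by rewrite -(EFin_Rintegral (rintegrableZ kap iw)) RintegralZl// ew.
have -> : (\int[P]_x (X x ^+ (2 * n))%:E =
    ((kap * (rise n * D n))^-1)%:E * (\int[m1]_x (Wx x * Y x ^+ (2 * n)))%:E)%E.
  by rewrite E1 muleA -EFinM mulVf ?mul1e// gt_eqF.
rewrite eE intV -EFinM; congr EFin.
rewrite /c /kap; transitivity (((-1) ^+ n) ^+ 2 * (K^-1 * (N n / D n) *
    (((2 * n)`!)%:R / (n`!)%:R) * q ^+ n)); last by rewrite sqrr_sign mul1r.
move: (2 * pi) (lt0r_neq0 pi0) => tp tp0.
field; rewrite tp0 (gt_eqF K0) (gt_eqF rn0) (gt_eqF (D0 n)) /=.
by rewrite pnatr_eq0 -lt0n fact_gt0.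
Qed.

End mixture_moments.

Section wright_moments.
Context (R : realType) (m p : nat).
Variables (b beta : 'I_m -> R) (a alpha : 'I_p -> R).
Hypothesis halpha : forall i, 0 < alpha i.
Hypothesis ha : forall i, 0 < a i + alpha i.
Hypothesis hbeta : forall j, 0 < beta j.
Hypothesis hb : forall j, 0 < b j + beta j.
Notation K := (wright_K b beta a alpha).

Lemma wright_K_gt0 : 0 < K.
Proof.
by apply: divr_gt0; apply: prodr_gt0 => i _; exact: Gamma_gt0.
Qed.

Lemma Gamma_ratio1 : Gamma_ratio b beta a alpha 1 = K.
Proof.
rewrite /Gamma_ratio (eq_bigr (fun j => Gamma (b j + beta j))); last first.
  by move=> j _; rewrite (mulr1 (beta j)).
rewrite [X in _ / X](eq_bigr (fun i => Gamma (a i + alpha i))) => [//|i _].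
by rewrite (mulr1 (alpha i)).
Qed.

Lemma wright_even_moment (g : R) d (S : measurableType d) (P : probability S R)
    (X : S -> R) (q : R) (n : nat) :
  0 <= wright_astar beta alpha -> wright_contour b beta g ->
  measurable_fun setT X -> 0 < q ->
  (forall u, 0 < u -> \int[P]_x cos (u * X x) =
    K^-1 * complex.Re (wright_Psi b beta a alpha g (- (u ^+ 2 * q)))) ->
  (\int[P]_x (X x ^+ (2 * n))%:E = (K^-1 *
    Gamma_ratio b beta a alpha n.+1%:R * (((2 * n)`!)%:R / (n`!)%:R) * q ^+ n)%:E)%E.
Proof.
move=> astar0 hg mX q0 charX.
have [d1 [T1 [rho [L [W [d2 [T2 [nu [L2 [W2 [e [rise]]]]]]]]]]]] :=
  wright_mixture halpha ha hbeta hb astar0 hg.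
move=> [[[mL mW W0] [mL2 W20] Wn W2n] [ce ec average]].
apply: (mixture_even_moment
  (Psi := fun x => complex.Re (wright_Psi b beta a alpha g (- x)))
  mL mW W0 mL2 W20 Wn W2n ce ec average _ wright_K_gt0 _ q0 mX charX).
  move=> j; apply: prodr_gt0 => i _; apply: Gamma_gt0; rewrite mulrS mulrDr mulr1 addrA.
  by apply: ltr_wpDr => //; rewrite mulr_ge0// ltW.
by rewrite -Gamma_ratio1.
Qed.

End wright_moments.

(** * Moments of the generalized Wright measure *)

Section nuclear_pairing.
Variables (R : realType) (T : nuclear_triple R).
Implicit Types (phi psi : nt_N T).

Lemma nt_ip_norm phi : nt_ip phi phi = nt_norm phi ^+ 2.
Proof. exact: hilb_ip_norm. Qed.

Lemma nt_normZ u phi : nt_norm (u *: phi) = `|u| * nt_norm phi.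
Proof. by rewrite /nt_norm linearZ/= normrZ. Qed.

Lemma nt_norm_eq0 phi : nt_norm phi = 0 -> phi = 0.
Proof.
by move=> /normr0_eq0 h; apply: (@nt_emb_inj _ T); rewrite h linear0.
Qed.

Lemma nt_ip_polarization phi psi :
  nt_norm (phi + psi) ^+ 2 - nt_norm (phi - psi) ^+ 2 = 4 * nt_ip phi psi.
Proof.
rewrite -!nt_ip_norm /nt_ip linearD linearB.
set x := nt_emb _ _ phi; set y := nt_emb _ _ psi.
have yx : hilb_ip _ y x = hilb_ip _ x y by rewrite hermC expr0 mul1r.
rewrite !(linearDl (hilb_ip _)) !(linearNl (hilb_ip _)) !(linearDr (hilb_ip _))
  !(linearNr (hilb_ip _)) /= yx.
ring.
Qed.

Lemma measurable_pairing phi :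
  measurable_fun [set: cyl_dual (nt_N T)] (fun w : cyl_dual (nt_N T) => (w : dual (nt_N T)) phi).
Proof.
move=> _ B mB; rewrite setTI; apply: sub_sigma_algebra.
by exists phi; exists B.
Qed.

End nuclear_pairing.

Lemma sqr_L2norm d (T : measurableType d) (R : realType)
    (mu : {measure set T -> \bar R}) (f : T -> R) (r : R) :
  (\int[mu]_x (f x ^+ 2)%:E = r%:E)%E -> ('N[mu]_2%:E[EFin \o f] ^+ 2)%E = r%:E.
Proof.
move=> fr; have two0 : (2 : R) != 0 by [].
have := poweR_Lnorm mu (EFin \o f) two0.
have -> : (\int[mu]_x (`|(EFin \o f) x| `^ 2) = r%:E)%E.
  rewrite -fr; apply: eq_integral => x _.
  by rewrite /= powR_mulrn// real_normK ?num_real.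
have := Lnorm_ge0 mu 2%:E (EFin \o f).
case: ('N[mu]_2%:E[EFin \o f])%E => [x|_|//].
  by rewrite lee_fin => x0 /=; rewrite powR_mulrn// => -[<-].
by rewrite poweRyr.
Qed.

Lemma moment_nseq (R : realType) (N : tvsType R) (P : probability (cyl_dual N) R)
    (n : nat) (phi : N) :
  moment P (nseq n phi) = (\int[P]_w ((w : dual N) phi ^+ n)%:E)%E.
Proof.
apply: eq_integral => w _; congr EFin; rewrite big_nseq.
by elim: n => [|n IH] //=; rewrite IH exprS.
Qed.

Section wright_measure.
Context (R : realType) (m p : nat).
Variables (b beta : 'I_m -> R) (a alpha : 'I_p -> R).
Hypothesis halpha : forall i, 0 < alpha i.
Hypothesis ha : forall i, 0 < a i + alpha i.
Hypothesis hbeta : forall j, 0 < beta j.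
Hypothesis hb : forall j, 0 < b j + beta j.
Hypothesis astar_ge0 : 0 <= wright_astar beta alpha.
Variable g : R.
Hypothesis hg : wright_contour b beta g.
Variables (T : nuclear_triple R) (mu : probability (cyl_dual (nt_N T)) R).
Hypothesis hmu : is_wright_measure b beta a alpha g mu.
Notation K := (wright_K b beta a alpha).
Notation C := (Gamma_ratio b beta a alpha).
Notation ev phi := (fun w : cyl_dual (nt_N T) => (w : dual (nt_N T)) phi).

Let characteristic phi u :
  ((\int[mu]_w cos (u * ev phi w)) +i* (\int[mu]_w sin (u * ev phi w))) =
  (K^-1)%:C * wright_Psi b beta a alpha g (- (u ^+ 2 * (nt_ip phi phi / 2))).
Proof.
have -> : u ^+ 2 * (nt_ip phi phi / 2) = nt_ip (u *: phi) (u *: phi) / 2.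
  by rewrite !nt_ip_norm nt_normZ exprMn real_normK ?num_real// mulrA.
rewrite -(hmu (u *: phi)) /cintegral; congr (_ +i* _); apply: eq_Rintegral => w _;
  by rewrite /cexp /= expR0 mul1r linearZ.
Qed.

Lemma wright_cos_transform phi u : \int[mu]_w cos (u * ev phi w) =
  K^-1 * complex.Re (wright_Psi b beta a alpha g (- (u ^+ 2 * (nt_ip phi phi / 2)))).
Proof.
have := congr1 (@complex.Re R) (characteristic phi u).
by rewrite Re_realM.
Qed.

Let sin_transform_odd phi u :
  \int[mu]_w sin (u * ev phi w) = \int[mu]_w sin (- u * ev phi w).
Proof.
have := congr1 (@complex.Im R) (characteristic phi u).
by rewrite -sqrrN -characteristic.
Qed.

(** The characteristic function of u phi depends on u only through u^2. *)
Lemma wright_sin_transform phi u : \int[mu]_w sin (u * ev phi w) = 0.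
Proof.
have mX := @measurable_pairing R T phi.
have isin : rintegrable mu (fun w => sin (u * ev phi w)).
  apply: (rintegrable_le (g := fun=> 1)).
  - apply: measurableT_comp; first exact: measurable_sin.
    by apply: measurable_funM => //; exact: measurable_cst.
  - exact: finite_measure_integrable_cst.
  - by move=> w; exact: sin_max.
have h : \int[mu]_w sin (- u * ev phi w) = -1 * \int[mu]_w sin (u * ev phi w).
  rewrite -RintegralZl//; apply: eq_Rintegral => w _.
  by rewrite mulNr sinN mulN1r.
by have := sin_transform_odd phi u; rewrite h; lra.
Qed.

(** For phi of norm zero the argument of Psi is 0, where Psi is not an integral; but
    then phi itself is 0. *)
Lemma wright_pairing_even_moment phi n :
  (\int[mu]_w (ev phi w ^+ (2 * n))%:E = (K^-1 * C n.+1%:R *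
    (((2 * n)`!)%:R / ((n`!)%:R * 2 ^+ n)) * nt_ip phi phi ^+ n)%:E)%E.
Proof.
have K0 : 0 < K := wright_K_gt0 ha hb.
have [n0|n0] := eqVneq (nt_norm phi) 0.
  rewrite (nt_norm_eq0 n0).
  under eq_integral do rewrite linear0.
  rewrite integral_cst//= probability_setT mule1; congr EFin.
  rewrite nt_ip_norm (_ : nt_norm 0 = 0); last by rewrite /nt_norm linear0 normr0.
  case: n => [|n]; last by rewrite mulnS !expr0n /= mulr0.
  rewrite muln0 !expr0 fact0 !mulr1 divr1 mulr1.
  rewrite (Gamma_ratio1 b beta a alpha).
  by rewrite mulVf// gt_eqF.
have q0 : 0 < nt_ip phi phi / 2.
  by rewrite divr_gt0// nt_ip_norm exprn_gt0// lt_def n0 normr_ge0.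
rewrite (wright_even_moment halpha ha hbeta hb n astar_ge0 hg (@measurable_pairing R T phi) q0).
  congr EFin; rewrite exprMn exprVn; field.
  by rewrite (gt_eqF K0) pnatr_eq0 -lt0n fact_gt0 expf_neq0.
by move=> u _; exact: wright_cos_transform.
Qed.

Lemma rintegrable_pairing_sqr phi n : rintegrable mu (fun w => ev phi w ^+ (2 * n)).
Proof.
apply: rintegrable_ge0; last by rewrite wright_pairing_even_moment.
  exact: measurable_funX (@measurable_pairing R T phi).
by move=> w; rewrite exprM exprn_ge0// sqr_ge0.
Qed.

(** The absolute moments are finite because y <= 1 + y^2. *)
Lemma wright_pairing_odd_moment phi n :
  (\int[mu]_w (ev phi w ^+ (2 * n).+1)%:E = 0)%E.
Proof.
have mX := @measurable_pairing R T phi.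
have iabs k : rintegrable mu (fun w => `|ev phi w| ^+ k).
  have i1 : rintegrable mu (fun=> (1 : R)) by exact: finite_measure_integrable_cst.
  apply: rintegrable_le (rintegrableD i1 (rintegrable_pairing_sqr phi k)) _.
    by apply: measurable_funX; exact: measurableT_comp mX.
  move=> w; rewrite normrX normr_id [X in _ + X]exprM.
  rewrite -[X in _ + X ^+ k]real_normK ?num_real// -exprM mulnC exprM.
  move: (`|_| ^+ k) (exprn_ge0 k (normr_ge0 (ev phi w))) => y y0.
  by have := sqr_ge0 (y - 1); have := sqr_ge0 y; lra.
have iX : rintegrable mu (fun w => ev phi w ^+ (2 * n).+1).
  apply: rintegrable_le (iabs (2 * n).+1) _; first exact: measurable_funX.
  by move=> w; rewrite normrX.
rewrite -EFin_Rintegral// (odd_moment mX iabs)// => t _.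
exact: wright_sin_transform.
Qed.

(** Polarization of the second moment, the pairing being linear in the test vector. *)
Lemma wright_covariance phi psi :
  (\int[mu]_w (ev phi w * ev psi w)%:E = (K^-1 * C 2 * nt_ip phi psi)%:E)%E.
Proof.
have sq chi : rintegrable mu (fun w => ev chi w ^+ 2) /\
    \int[mu]_w (ev chi w ^+ 2) = K^-1 * C 2 * nt_norm chi ^+ 2.
  split; first exact: (rintegrable_pairing_sqr chi 1).
  rewrite /Rintegral (wright_pairing_even_moment chi 1) /= nt_ip_norm expr1.
  rewrite (_ : ((2 * 1)`!%:R : R) / (1`!%:R * 2) = 1) ?mulr1//.
  by rewrite mul1r divff.
have [i1 e1] := sq (phi + psi); have [i2 e2] := sq (phi - psi).
have E w : ev phi w * ev psi w = 4^-1 * (ev (phi + psi) w ^+ 2 + (-1) * ev (phi - psi) w ^+ 2).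
  by rewrite !linearD linearN /=; field.
have i3 := rintegrableD i1 (rintegrableZ (-1) i2).
under eq_integral do rewrite E.
rewrite -(EFin_Rintegral (rintegrableZ 4^-1 i3)) RintegralZl//.
rewrite RintegralD//; last exact: rintegrableZ.
rewrite RintegralZl// e1 e2; congr EFin.
have := nt_ip_polarization phi psi; set u := _ ^+ 2; set v := _ ^+ 2 => uv.
transitivity (4^-1 * (K^-1 * C 2) * (u - v)); first by ring.
by rewrite uv; field; rewrite gt_eqF// wright_K_gt0.
Qed.

End wright_measure.

Theorem theorem3p5 (R : realType) (m p : nat)
    (b beta : 'I_m -> R) (a alpha : 'I_p -> R)
    (halpha : forall i, 0 < alpha i) (ha : forall i, 0 < a i + alpha i)
    (hbeta : forall j, 0 < beta j) (hb : forall j, 0 < b j + beta j)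
    (hpar : 0 < wright_astar beta alpha \/
            (wright_astar beta alpha = 0 /\ wright_mu b a < -1))
    (gH : R) (hgH : foxH_contour b beta gH)
    (hH : forall tau : R, 0 < tau -> 0 <= foxH b beta a alpha gH tau)
    (gPsi : R) (hgPsi : wright_contour b beta gPsi)
    (T : nuclear_triple R) (mu : probability (cyl_dual (nt_N T)) R)
    (hmu : is_wright_measure b beta a alpha gPsi mu) :
  let K := wright_K b beta a alpha in
  let C := Gamma_ratio b beta a alpha in
  (forall (phi : nt_N T) (n : nat),
     moment mu (nseq (2 * n).+1%N phi) = 0%E /\
     moment mu (nseq (2 * n)%N phi) =
       (K^-1 * C (n.+1)%:R * (((2 * n)`!)%:R / ((n`!)%:R * 2 ^+ n))
        * nt_ip phi phi ^+ n)%:E) /\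
  (forall phi psi : nt_N T,
     (\int[mu]_w ((w : dual (nt_N T)) phi * (w : dual (nt_N T)) psi)%:E)%E =
       moment mu [:: phi; psi] /\
     moment mu [:: phi; psi] = (K^-1 * C 2 * nt_ip phi psi)%:E) /\
  (forall phi : nt_N T,
     ('N[mu]_2%:E[EFin \o (fun w : dual (nt_N T) => w phi)] ^+ 2)%E =
       moment mu [:: phi; phi] /\
     moment mu [:: phi; phi] = (K^-1 * C 2 * nt_norm phi ^+ 2)%:E).
Proof.
have astar_ge0 : 0 <= wright_astar beta alpha by case: hpar => [/ltW|[->]].
have cov := wright_covariance halpha ha hbeta hb astar_ge0 hgPsi hmu.
have pair phi psi : (\int[mu]_w ((w : dual (nt_N T)) phi * (w : dual (nt_N T)) psi)%:E)%E =
    moment mu [:: phi; psi].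
  by apply: eq_integral => w _; rewrite !big_cons big_nil mulr1.
split; [|split].
- move=> phi n; rewrite !moment_nseq; split.
    exact: (wright_pairing_odd_moment halpha ha hbeta hb astar_ge0 hgPsi hmu).
  exact: (wright_pairing_even_moment halpha ha hbeta hb astar_ge0 hgPsi hmu).
- by move=> phi psi; rewrite -pair cov.
- move=> phi; rewrite -pair cov nt_ip_norm; split => //.
  by apply: sqr_L2norm; rewrite -nt_ip_norm -cov.
Qed.
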